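(* Let $f,g: S^1\to S^1$ be $C^\infty$-stable smooth maps. Then $$f\sim_{\mathcal A_\infty} g \iff N(f)=N(g)\ \text{ and }\ [\mathrm{Ast}(f)]_E=[\mathrm{Ast}(g)]_E .$$
   Context: $S^1$ is the unit circle in $\mathbb R^2$. Two smooth maps $f,g:S^1\to S^1$ are $\mathcal A_\infty$-equivalent, written $f\sim_{\mathcal A_\infty}g$, if there are $C^\infty$ diffeomorphisms $h,k$ of $S^1$ with $k\circ f=g\circ h$. $\Sigma(f)$ denotes the set of singular (critical) points of $f$. A smooth map $f:S^1\to S^1$ is ($C^\infty$-)stable in the usual sense; equivalently, all its singular points are of Morse type (nondegenerate in local charts), $\Sigma(f)$ is finite, and $f|_{\Sigma(f)}$ is injective (no singular double points). Associated tuple. Let $P:[0,2\pi)\to S^1$, $P(t)=(\cos t,\sin t)$. Let $f:S^1\to S^1$ be stable and let $\Delta(f)=f(\Sigma(f))$. If $\Sigma(f)\neq\emptyset$, put $A(f)=P^{-1}(f^{-1}(\Delta(f)))=\{a_1<a_2<\dots<a_{N(f)}\}$, so $N(f)=\# f^{-1}(\Delta(f))$. For $a\in A(f)$ let $T(a)$ be the symbol $s$ if $P(a)\in\Sigma(f)$ and the symbol $p$ otherwise. Then $\mathrm{Ast}(f)=(T(a_1),\dots,T(a_{N(f)}))\in\{s,p\}^{N(f)}$. If $\Sigma(f)=\emptyset$, then $\mathrm{Ast}(f)=(p,p,\dots,p)$, where $p$ is repeated $\#f^{-1}((1,0))$ times, and $N(f)$ is the length $\#f^{-1}((1,0))$ of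 this tuple. Equivalence of tuples. For a set $X$ and $k\ge1$, two tuples $(t_1,\dots,t_k),(t'_1,\dots,t'_k)\in X^k$ are $E_k$-equivalent if there are $a\in\mathbb Z$ and a sign $\varepsilon\in\{1,-1\}$ such that $t_i=t'_{\varepsilon i+a}$ for all $i=1,\dots,k$, indices being read modulo $k$ in $\{1,\dots,k\}$ (i.e. the tuples agree up to cyclic shifts and reversal). The $E_k$-equivalence class of $t$ is denoted $[t]_E$. *)

(* Defs.v *)
From Stdlib Require Import Reals List Sorting.Sorted ZArith Lra ClassicalEpsilon.
From Coquelicot Require Import Coquelicot.
Open Scope R_scope.

Definition S1 : Type := { v : R * R | (fst v) ^ 2 + (snd v) ^ 2 = 1 }.

Lemma cos_sin_on_S1 (t : R) : (fst (cos t, sin t)) ^ 2 + (snd (cos t, sin t)) ^ 2 = 1.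
Proof. simpl. pose proof (sin2_cos2 t) as H. unfold Rsqr in H. lra. Qed.

(* The whole covering R -> S1; the bijection [0, 2 PI) -> S1 is its restriction. *)
Definition P (t : R) : S1 :=
  exist (fun v : R * R => (fst v) ^ 2 + (snd v) ^ 2 = 1) (cos t, sin t) (cos_sin_on_S1 t).

Definition curve1 (f : S1 -> S1) (t : R) : R := fst (proj1_sig (f (P t))).
Definition curve2 (f : S1 -> S1) (t : R) : R := snd (proj1_sig (f (P t))).

(* P is a local diffeomorphism onto S1 and S1 is an embedded submanifold of R^2,
   so f is smooth iff the 2 PI-periodic curve f o P : R -> R^2 is, and df at P t
   sends the unit tangent vector P'(t) to the velocity of that curve at t. *)
Definition smooth (f : S1 -> S1) : Prop :=
  forall (n : nat) (t : R), ex_derive_n (curve1 f) n t /\ ex_derive_n (curve2 f) n t.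

Definition diffeo (h : S1 -> S1) : Prop :=
  smooth h /\
  exists h' : S1 -> S1,
    smooth h' /\ (forall x, h' (h x) = x) /\ (forall x, h (h' x) = x).

Definition A_equiv (f g : S1 -> S1) : Prop :=
  exists h k : S1 -> S1, diffeo h /\ diffeo k /\ forall x, k (f x) = g (h x).

(* As S1 is compact, the sets { g smooth | Cr_close r eps f g }, r in nat, eps > 0,
   form a neighbourhood basis of f in the (Whitney) C^infinity topology. *)
Definition Cr_close (r : nat) (eps : R) (f g : S1 -> S1) : Prop :=
  forall (n : nat) (t : R), (n <= r)%nat ->
    Rabs (Derive_n (curve1 g) n t - Derive_n (curve1 f) n t) < eps /\
    Rabs (Derive_n (curve2 g) n t - Derive_n (curve2 f) n t) < eps.

Definition stable (f : S1 -> S1) : Prop :=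
  smooth f /\
  exists (r : nat) (eps : R), 0 < eps /\
    forall g : S1 -> S1, smooth g -> Cr_close r eps f g -> A_equiv f g.

Definition Sigma (f : S1 -> S1) (x : S1) : Prop :=
  exists t : R, P t = x /\ Derive (curve1 f) t = 0 /\ Derive (curve2 f) t = 0.

Definition Delta (f : S1 -> S1) (y : S1) : Prop :=
  exists x : S1, Sigma f x /\ f x = y.

Definition A_set (f : S1 -> S1) (a : R) : Prop :=
  0 <= a < 2 * PI /\ Delta f (f (P a)).

(* Unspecified when S is infinite. *)
Definition card {X : Type} (S : X -> Prop) : nat :=
  epsilon (inhabits 0%nat)
    (fun n => exists l : list X, NoDup l /\ length l = n /\ forall x, In x l <-> S x).

(* The list a_1 < a_2 < ... of the elements of S; unspecified when S is infinite. *)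
Definition increasing_enum (S : R -> Prop) : list R :=
  epsilon (inhabits nil)
    (fun l => StronglySorted Rlt l /\ forall x, In x l <-> S x).

Inductive symbol : Type := s | p.

Definition T (f : S1 -> S1) (a : R) : symbol :=
  if excluded_middle_informative (Sigma f (P a)) then s else p.

Definition fiber_10 (f : S1 -> S1) (x : S1) : Prop := proj1_sig (f x) = (1, 0).

Definition N_of (f : S1 -> S1) : nat :=
  if excluded_middle_informative (exists x, Sigma f x)
  then card (fun x => Delta f (f x))
  else card (fiber_10 f).

Definition Ast (f : S1 -> S1) : list symbol :=
  if excluded_middle_informative (exists x, Sigma f x)
  then map (T f) (increasing_enum (A_set f))
  else repeat p (card (fiber_10 f)).

(* t_j with the index j in Z read modulo k = length t in {1, ..., k}. *)
Definition entry {X : Type} (t : list X) (j : Z) : option X :=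
  nth_error t (Z.to_nat ((j - 1) mod Z.of_nat (length t))).

(* A k-tuple is a list of length k, so this is E_k-equivalence for all k at once. *)
Definition E_equiv {X : Type} (t t' : list X) : Prop :=
  length t = length t' /\
  exists a eps : Z, (eps = 1 \/ eps = -1)%Z /\
    forall i : Z, (1 <= i <= Z.of_nat (length t))%Z -> entry t i = entry t' (eps * i + a)%Z.

Definition E_class {X : Type} (t : list X) : list X -> Prop := fun t' => E_equiv t t'.

(* Main.v *)
From Stdlib Require Import Reals List Sorting.Sorted ZArith Lra Lia ClassicalEpsilon.
From Stdlib Require Import FunctionalExtensionality PropExtensionality ProofIrrelevance.
From Coquelicot Require Import Coquelicot.
Require Import Defs.
Open Scope R_scope.
Set Bullet Behavior "Strict Subproofs".

(** A map of the circle is studied through its lift [F] to the line, with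
    [f (P t) = P (F t)] and [F (t + 2 PI) = F t + 2 PI d]. Diffeomorphisms lift
    to maps [H] commuting with the period up to sign, and [f] and [g] are
    equivalent exactly when [K (F t) = G (H t)] for two such lifts
    ([A_equiv_lift], [A_equiv_of_lift]).

    Stability enters only through two perturbations of [F]. Almost every
    [F + a cos + b sin] is Morse, because the bad parameters [(a, b)] form a
    Lipschitz curve; as equivalence preserves nondegeneracy, a stable [f] is
    itself Morse ([stable_morse]). If two critical points shared a value, some
    [F + eps phi] with the same critical points would separate these values and
    merge no others, contradicting the invariance of the number of double pairs
    ([stable_injective]).

    The critical fibre (the preimage of the critical values) and the set of
    critical values then become periodic discrete sets, listed by the integers.
    Between consecutive points of the fibre [F] is monotone and joins
    neighbouring critical values, so it induces a walk with steps [1] and [-1]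
    on the indices of the critical values; it turns back exactly at the critical
    points ([itinerary_exists]). Thus the cyclic word in [s] and [p] determines
    the walk up to the symmetries of source and target. The numbers of critical
    values also agree, since distinct critical points have distinct values and
    are counted by the letters [s].

    Two lifts with the same walk are equivalent ([same_itinerary]). A smooth
    [K] sends the critical values of [F] to those of [G] in order
    ([interpolation]), and on each interval [H] is forced to be the inverse of
    [G] applied to [K (F t)]. No condition on [K] is needed for [H] to be
    smooth: at a fold the Morse lemma writes [K (F t)] and [G] as plus or minus
    the squares of local coordinates, and [H] matches these coordinates
    ([H_smooth]).

    Conversely the lift [H] of an equivalence maps one critical fibre onto the
    other, preserving or reversing the order and preserving the symbols, which
    is a cyclic shift or a reversal of the word. Without critical points the
    lift is monotone, hence equivalent to [d t], and [N_of] is the absolute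
    value of the degree [d] ([nonsingular_classification]). *)

(** * Germs of smooth functions of one variable *)

(** Iterated differentiability of the germ of [F] at [t]. Being attached to a
    germ, it is local by construction, so a function defined piecewise can be
    shown smooth by exhibiting a good formula near each point. *)
Fixpoint Cn (n : nat) (F : R -> R) (t : R) : Prop :=
  match n with
  | O => True
  | S m => exists G, locally t (fun u => is_derive F u (G u)) /\ Cn m G t
  end.

Definition smooth_at (F : R -> R) (t : R) : Prop := forall n, Cn n F t.
Definition smooth1 (F : R -> R) : Prop := forall t, smooth_at F t.

Lemma is_derive_Rext (F G : R -> R) (t a : R) :
  (forall u, F u = G u) -> is_derive F t a -> is_derive G t a.
Proof. intros E. now apply is_derive_ext. Qed.

Lemma is_derive_Rmult (F G : R -> R) (t a b : R) :
  is_derive F t a -> is_derive G t b ->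
  is_derive (fun u => F u * G u) t (a * G t + F t * b).
Proof.
  intros HF HG. apply (is_derive_mult F G t a b HF HG). intros; apply Rmult_comm.
Qed.

Lemma is_derive_Rcomp (F G : R -> R) (t a b : R) :
  is_derive F (G t) a -> is_derive G t b ->
  is_derive (fun u => F (G u)) t (b * a).
Proof. intros HF HG. exact (is_derive_comp F G t a b HF HG). Qed.

Lemma is_derive_Rplus (F G : R -> R) (t a b : R) :
  is_derive F t a -> is_derive G t b ->
  is_derive (fun u => F u + G u) t (a + b).
Proof. intros HF HG. exact (is_derive_plus F G t a b HF HG). Qed.

Lemma is_derive_eq (F : R -> R) (t a b : R) : is_derive F t a -> a = b -> is_derive F t b.
Proof. intros; subst; assumption. Qed.

Lemma is_derive_Rconst (c t : R) : is_derive (fun _ : R => c) t 0.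
Proof. apply @is_derive_const. Qed.

Lemma is_derive_Rid (t : R) : is_derive (fun u : R => u) t 1.
Proof. apply @is_derive_id. Qed.

Lemma is_derive_Rminus (F G : R -> R) (t a b : R) :
  is_derive F t a -> is_derive G t b ->
  is_derive (fun u => F u - G u) t (a - b).
Proof. intros HF HG. exact (is_derive_minus F G t a b HF HG). Qed.

Lemma is_derive_Ropp (F : R -> R) (t a : R) :
  is_derive F t a -> is_derive (fun u => - F u) t (- a).
Proof. intros HF. exact (is_derive_opp F t a HF). Qed.

Lemma is_derive_continuous (F : R -> R) t a : is_derive F t a -> continuous F t.
Proof. intros H. apply (ex_derive_continuous F t). now exists a. Qed.

Lemma continuous_locally (F : R -> R) t (Q : R -> Prop) :
  continuous F t -> locally (F t) Q -> locally t (fun u => Q (F u)).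
Proof. intros HF HQ. exact (HF Q HQ). Qed.

Lemma continuous_neq (F : R -> R) t c : continuous F t -> F t <> c -> locally t (fun u => F u <> c).
Proof.
  intros HF Hn. apply (continuous_locally F t (fun y => y <> c)); auto.
  assert (0 < Rabs (F t - c)) by (apply Rabs_pos_lt; lra).
  exists (mkposreal _ H). intros y Hy ->.
  unfold ball in Hy; simpl in Hy; unfold AbsRing_ball, abs, minus, plus, opp in Hy; simpl in Hy.
  rewrite (Rabs_minus_sym (F t) c) in Hy. unfold Rminus in Hy. lra.
Qed.

Lemma continuous_lt (F : R -> R) t c : continuous F t -> c < F t -> locally t (fun u => c < F u).
Proof.
  intros HF Hn. apply (continuous_locally F t (fun y => c < y)); auto.
  apply (open_gt c (F t)); auto.
Qed.

Lemma window_of_locally (t : R) (Q : R -> Prop) :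
  locally t Q -> exists e, 0 < e /\ forall u, t - e < u < t + e -> Q u.
Proof.
  intros [e He]. exists e. split. apply cond_pos. intros u Hu. apply He.
  unfold ball; simpl; unfold AbsRing_ball, abs, minus, plus, opp; simpl.
  apply Rabs_def1; lra.
Qed.

Lemma locally_of_window (t e : R) (Q : R -> Prop) :
  0 < e -> (forall u, t - e < u < t + e -> Q u) -> locally t Q.
Proof.
  intros He H. exists (mkposreal e He). intros u Hu. apply H.
  unfold ball in Hu; simpl in Hu; unfold AbsRing_ball, abs, minus, plus, opp in Hu; simpl in Hu.
  apply Rabs_def2 in Hu. lra.
Qed.

Lemma Cn_ext_loc n F G t : locally t (fun u => F u = G u) -> Cn n F t -> Cn n G t.
Proof.
  destruct n; simpl; auto. intros He [F' [H1 H2]]. exists F'. split; auto.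
  apply locally_locally in He. generalize (filter_and _ _ He H1).
  apply filter_imp. intros u [Hu1 Hu2]. now apply is_derive_ext_loc with F.
Qed.

Lemma Cn_S n : forall F t, Cn (S n) F t -> Cn n F t.
Proof.
  induction n; intros F t. now simpl. intros [G [H1 H2]]. exists G; split; auto.
Qed.

Lemma Cn_continuous n F t : Cn (S n) F t -> locally t (fun u => continuous F u).
Proof.
  intros [G [H1 _]]. revert H1; apply filter_imp. intros u Hu.
  now apply is_derive_continuous with (G u).
Qed.

Lemma Cn_const c n : forall t, Cn n (fun _ => c) t.
Proof.
  revert c; induction n; intros c t; simpl; auto. exists (fun _ => 0). split; auto.
  apply filter_forall. intros u. apply is_derive_Rconst.
Qed.

Lemma Cn_id n : forall t, Cn n (fun u => u) t.
Proof.
  destruct n; intros t; simpl; auto. exists (fun _ => 1). split; [|apply Cn_const].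
  apply filter_forall. intros u. apply is_derive_Rid.
Qed.

Lemma Cn_plus n : forall F G t, Cn n F t -> Cn n G t -> Cn n (fun u => F u + G u) t.
Proof.
  induction n; intros F G t; simpl; auto. intros [F' [HF1 HF2]] [G' [HG1 HG2]].
  exists (fun u => F' u + G' u). split; auto.
  generalize (filter_and _ _ HF1 HG1). apply filter_imp. intros u [? ?].
  now apply is_derive_Rplus.
Qed.

Lemma Cn_mult n : forall F G t, Cn n F t -> Cn n G t -> Cn n (fun u => F u * G u) t.
Proof.
  induction n; intros F G t; auto. intros HF HG.
  pose proof (Cn_S _ _ _ HF). pose proof (Cn_S _ _ _ HG).
  destruct HF as [F' [HF1 HF2]], HG as [G' [HG1 HG2]].
  exists (fun u => F' u * G u + F u * G' u). split.
  - generalize (filter_and _ _ HF1 HG1). apply filter_imp. intros u [? ?].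
    now apply is_derive_Rmult.
  - apply Cn_plus; auto.
Qed.

Lemma Cn_comp n : forall F G t, Cn n F (G t) -> Cn n G t -> Cn n (fun u => F (G u)) t.
Proof.
  induction n; intros F G t; auto. intros HF HG.
  pose proof (Cn_S _ _ _ HG). pose proof (locally_singleton _ _ (Cn_continuous _ _ _ HG)) as Hc.
  destruct HF as [F' [HF1 HF2]], HG as [G' [HG1 HG2]].
  exists (fun u => G' u * F' (G u)). split.
  - apply (continuous_locally G t _ Hc) in HF1.
    generalize (filter_and _ _ HF1 HG1). apply filter_imp. intros u [? ?].
    now apply is_derive_Rcomp.
  - apply Cn_mult; auto.
Qed.

Lemma Cn_opp n F t : Cn n F t -> Cn n (fun u => - F u) t.
Proof.
  intros H. apply Cn_ext_loc with (fun u => (-1) * F u).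
  apply filter_forall; intros; ring. apply Cn_mult; auto. apply Cn_const.
Qed.

Lemma Cn_Rinv n : forall t, t <> 0 -> Cn n Rinv t.
Proof.
  induction n; intros t Ht; simpl; auto.
  exists (fun u => - (/ u * / u)). split.
  - generalize (continuous_neq (fun u => u) t 0 (continuous_id t) Ht).
    apply filter_imp. intros u Hu.
    eapply is_derive_eq. apply (is_derive_inv (fun u => u) u 1); auto. apply is_derive_Rid.
    field; auto.
  - apply Cn_opp. apply Cn_mult; auto.
Qed.

Lemma Cn_sincos n : forall t, Cn n sin t /\ Cn n cos t.
Proof.
  induction n; intros t; simpl; auto. split.
  - exists cos. split; [|apply IHn]. apply filter_forall, is_derive_sin.
  - exists (fun u => - sin u). split; [|apply Cn_opp, IHn]. apply filter_forall, is_derive_cos.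
Qed.

Lemma Cn_sqrt n : forall t, 0 < t -> Cn n sqrt t.
Proof.
  induction n; intros t Ht; simpl; auto. exists (fun u => / (2 * sqrt u)). split.
  - generalize (continuous_lt (fun u => u) t 0 (continuous_id t) Ht).
    apply filter_imp. intros u Hu.
    eapply is_derive_eq. apply (is_derive_sqrt (fun u => u) u 1); auto. apply is_derive_Rid.
    field. generalize (sqrt_lt_R0 u Hu); lra.
  - apply (Cn_comp n Rinv). apply Cn_Rinv. generalize (sqrt_lt_R0 t Ht); lra.
    apply Cn_mult; auto. apply Cn_const.
Qed.

Lemma smooth1_const c : smooth1 (fun _ => c).
Proof. intros t n; apply Cn_const. Qed.
Lemma smooth1_id : smooth1 (fun u => u).
Proof. intros t n; apply Cn_id. Qed.
Lemma smooth1_plus F G : smooth1 F -> smooth1 G -> smooth1 (fun u => F u + G u).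
Proof. intros HF HG t n; apply Cn_plus; [apply HF|apply HG]. Qed.
Lemma smooth1_mult F G : smooth1 F -> smooth1 G -> smooth1 (fun u => F u * G u).
Proof. intros HF HG t n; apply Cn_mult; [apply HF|apply HG]. Qed.
Lemma smooth1_opp F : smooth1 F -> smooth1 (fun u => - F u).
Proof. intros HF t n; apply Cn_opp; apply HF. Qed.
Lemma smooth1_minus F G : smooth1 F -> smooth1 G -> smooth1 (fun u => F u - G u).
Proof. intros HF HG; apply smooth1_plus; auto; now apply smooth1_opp. Qed.
Lemma smooth1_comp F G : smooth1 F -> smooth1 G -> smooth1 (fun u => F (G u)).
Proof. intros HF HG t n; apply Cn_comp; [apply HF|apply HG]. Qed.
Lemma smooth1_sin : smooth1 sin.
Proof. intros t n; apply Cn_sincos. Qed.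
Lemma smooth1_cos : smooth1 cos.
Proof. intros t n; apply Cn_sincos. Qed.

Lemma smooth_at_derive F t : smooth_at F t -> is_derive F t (Derive F t).
Proof.
  intros H. apply Derive_correct. destruct (H 1%nat) as [G [H1 _]].
  exists (G t). now apply locally_singleton in H1.
Qed.

Lemma smooth_at_Derive F t : smooth_at F t -> smooth_at (Derive F) t.
Proof.
  intros H n. destruct (H (S n)) as [G [H1 H2]]. apply Cn_ext_loc with G; auto.
  revert H1; apply filter_imp. intros u Hu. symmetry. now apply is_derive_unique.
Qed.

Lemma smooth_at_continuous F t : smooth_at F t -> continuous F t.
Proof. intros H. eapply is_derive_continuous, smooth_at_derive, H. Qed.

Lemma smooth_at_locally_derive F t :
  smooth_at F t -> locally t (fun u => is_derive F u (Derive F u)).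
Proof.
  intros H. destruct (H 1%nat) as [G [H1 _]]. revert H1; apply filter_imp.
  intros u Hu. apply Derive_correct. now exists (G u).
Qed.

Lemma smooth1_Derive F : smooth1 F -> smooth1 (Derive F).
Proof. intros H t. now apply smooth_at_Derive. Qed.

Lemma smooth1_derive F t : smooth1 F -> is_derive F t (Derive F t).
Proof. intros H. now apply smooth_at_derive. Qed.

Lemma smooth1_continuous F t : smooth1 F -> continuous F t.
Proof. intros H. now apply smooth_at_continuous. Qed.

Lemma smooth1_continuity F : smooth1 F -> continuity F.
Proof. intros H t. apply continuity_pt_filterlim. now apply smooth1_continuous. Qed.

Lemma smooth1_of_derivative F G : (forall t, is_derive F t (G t)) -> smooth1 G -> smooth1 F.
Proof.
  intros H HG t [|n]; simpl; auto. exists G. split. now apply filter_forall. apply HG.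
Qed.

Lemma smooth1_Derive_n F n : smooth1 F -> smooth1 (Derive_n F n).
Proof. intros H. induction n; simpl; auto. now apply smooth1_Derive. Qed.

Lemma smooth1_iff F : smooth1 F <-> forall n t, ex_derive_n F n t.
Proof.
  split.
  - intros H [|n] t; simpl; auto. exists (Derive (Derive_n F n) t).
    apply smooth1_derive. now apply smooth1_Derive_n.
  - intros H t n. change F with (Derive_n F 0). generalize 0%nat as k.
    induction n; intros k; simpl; auto. exists (Derive_n F (S k)). split; [|apply IHn].
    apply filter_forall. intros u. apply (Derive_correct (Derive_n F k)), (H (S k)).
Qed.

(** * Constancy, monotonicity and signs *)

Lemma constant_of_derive0 (F : R -> R) : (forall t, is_derive F t 0) -> forall a b, F a = F b.
Proof.
  intros H a b. destruct (Rtotal_order a b) as [Hab|[->|Hab]]; auto.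
  - apply (eq_is_derive F a b); auto.
  - symmetry. apply (eq_is_derive F b a); auto.
Qed.

Lemma strictly_increasing_on (F : R -> R) a b :
  (forall t, ex_derive F t) -> (forall t, a < t < b -> 0 < Derive F t) ->
  forall x y, a <= x -> x < y -> y <= b -> F x < F y.
Proof.
  intros Hd Hp x y Hx Hxy Hy.
  destruct (MVT_cor2 F (Derive F) x y Hxy) as [c [Hc1 Hc2]].
  - intros c _. apply is_derive_Reals, Derive_correct, Hd.
  - assert (0 < Derive F c) by (apply Hp; lra). nra.
Qed.

Lemma strictly_monotone_on (s : R) (F : R -> R) a b :
  (forall t, ex_derive F t) -> (forall t, a < t < b -> 0 < s * Derive F t) ->
  forall x y, a <= x -> x < y -> y <= b -> s * F x < s * F y.
Proof.
  intros Hd Hp. apply (strictly_increasing_on (fun t => s * F t)).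
  - intros t. now apply ex_derive_scal.
  - intros t Ht. rewrite Derive_scal. now apply Hp.
Qed.

Lemma constant_sign (F : R -> R) a b :
  continuity F -> (forall t, a < t < b -> F t <> 0) ->
  exists s : Z, (s = 1 \/ s = -1)%Z /\ forall t, a < t < b -> 0 < IZR s * F t.
Proof.
  intros Hc Hn. destruct (Rlt_le_dec a b) as [Hab|Hab].
  2: exists 1%Z; split; auto; intros; lra.
  assert (Key : forall t u, a < t < b -> a < u < b -> 0 < F t -> F u < 0 -> False).
  { intros t u Ht Hu H1 H2. destruct (IVT_gen F t u 0 Hc) as [z [Hz1 Hz2]].
    - rewrite Rmin_right, Rmax_left; lra.
    - apply (Hn z); auto. unfold Rmin, Rmax in Hz1; destruct Rle_dec; lra. }
  assert (Hm : a < (a + b) / 2 < b) by lra.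
  destruct (Rtotal_order (F ((a + b) / 2)) 0) as [H|[H|H]].
  - exists (-1)%Z. split; auto. intros t Ht. destruct (Rtotal_order (F t) 0) as [H1|[H1|H1]].
    lra. now apply Hn in H1. exfalso. exact (Key t _ Ht Hm H1 H).
  - now apply Hn in H.
  - exists 1%Z. split; auto. intros t Ht. destruct (Rtotal_order (F t) 0) as [H1|[H1|H1]].
    exfalso. exact (Key _ t Hm Ht H H1). now apply Hn in H1. lra.
Qed.

Lemma nondecreasing_onto_continuous (H : R -> R) :
  (forall x y, x <= y -> H x <= H y) -> (forall y, exists x, H x = y) ->
  forall t, continuous H t.
Proof.
  intros Hm Hs t Q HQ. apply window_of_locally in HQ. destruct HQ as [e [He HQ]].
  destruct (Hs (H t - e / 2)) as [a Ha], (Hs (H t + e / 2)) as [b Hb].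
  assert (a < t). { destruct (Rlt_le_dec a t); auto. apply Hm in r. lra. }
  assert (t < b). { destruct (Rlt_le_dec t b); auto. apply Hm in r. lra. }
  assert (Hmin := Rmin_l (t - a) (b - t)). assert (Hmin' := Rmin_r (t - a) (b - t)).
  apply (locally_of_window t (Rmin (t - a) (b - t))).
  apply Rmin_glb_lt; lra.
  intros u Hu. apply HQ.
  assert (H a <= H u) by (apply Hm; lra). assert (H u <= H b) by (apply Hm; lra). lra.
Qed.

(** * Implicitly defined smooth functions *)

(** Carathéodory's form of differentiability: the difference quotient extends
    continuously. It turns the chain rule for an implicit function into the
    division of two such quotients. *)
Lemma caratheodory (F : R -> R) (t l : R) :
  is_derive F t l <->
  exists q : R -> R, continuous q t /\ q t = l /\ forall u, F u - F t = (u - t) * q u.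
Proof.
  split.
  - intros H. exists (fun u => if Req_EM_T u t then l else (F u - F t) / (u - t)).
    split; [|split].
    + apply is_derive_Reals in H. intros Q HQ. simpl in HQ.
      destruct (Req_EM_T t t) as [_|]; [|tauto].
      apply window_of_locally in HQ. destruct HQ as [e [He HQ]].
      destruct (H e He) as [d Hd]. apply (locally_of_window t d). apply cond_pos.
      intros u Hu. simpl. apply HQ. destruct (Req_EM_T u t) as [->|Hn]. lra.
      specialize (Hd (u - t) ltac:(lra)). replace (t + (u - t)) with u in Hd by ring.
      assert (Rabs (u - t) < d) by (apply Rabs_def1; lra). apply Hd in H0.
      apply Rabs_def2 in H0. lra.
    + destruct (Req_EM_T t t); tauto.
    + intros u. destruct (Req_EM_T u t) as [->|Hn]. ring. field. lra.
  - intros [q [Hc [Hq HF]]]. apply is_derive_Reals. intros e He.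
    assert (HQ : locally (q t) (fun y => Rabs (y - l) < e)).
    { rewrite Hq. apply (locally_of_window l e); auto. intros; apply Rabs_def1; lra. }
    apply Hc in HQ. apply window_of_locally in HQ. destruct HQ as [d [Hd HQ]].
    exists (mkposreal d Hd). simpl. intros h Hh Hhd. rewrite HF.
    replace (t + h - t) with h by ring. replace (h * q (t + h) / h) with (q (t + h)) by (field; auto).
    apply HQ. apply Rabs_def2 in Hhd. lra.
Qed.

Lemma is_derive_implicit (G H Phi : R -> R) (t g p : R) :
  continuous H t -> locally t (fun u => G (H u) = Phi u) ->
  is_derive G (H t) g -> g <> 0 -> is_derive Phi t p -> is_derive H t (p / g).
Proof.
  intros Hc He HG Hg HP.
  apply caratheodory in HG. destruct HG as [qG [cG [eG HG]]].
  apply caratheodory in HP. destruct HP as [qP [cP [eP HP]]].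
  assert (cGH : continuous (fun u => qG (H u)) t) by (now apply continuous_comp).
  assert (Hn : locally t (fun u => qG (H u) <> 0)) by (apply continuous_neq; auto; rewrite eG; auto).
  assert (Ht : G (H t) = Phi t) by (now apply locally_singleton in He).
  apply is_derive_ext_loc with (fun u => H t + (u - t) * (qP u / qG (H u))).
  - generalize (filter_and _ _ He Hn). apply filter_imp. intros u [E1 E2].
    assert (E : (H u - H t) * qG (H u) = (u - t) * qP u) by (rewrite <- HG, <- HP; lra).
    apply Rmult_eq_reg_r with (qG (H u)); auto. field_simplify; auto. lra.
  - apply caratheodory. exists (fun u => qP u / qG (H u)). split; [|split].
    + apply (continuous_mult qP (fun u => / qG (H u))); auto.
      apply (continuous_comp (fun u => qG (H u)) Rinv); auto.
      apply (@is_derive_continuous _ _ (- / (qG (H t)) ^ 2)).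
      eapply is_derive_eq. apply (is_derive_inv (fun u => u) _ 1). apply is_derive_Rid.
      rewrite eG; auto. rewrite eG. field; auto.
    + now rewrite eG, eP.
    + intros u. ring.
Qed.

(** The derivative of an implicitly defined function is an expression in the
    function itself, so its smoothness bootstraps from mere continuity. This
    also covers inverse functions, with [Phi] the identity. *)
Lemma smooth_at_implicit (G H Phi : R -> R) t :
  locally t (fun u => continuous H u) -> locally t (fun u => G (H u) = Phi u) ->
  smooth_at G (H t) -> smooth_at Phi t -> Derive G (H t) <> 0 ->
  smooth_at H t /\ is_derive H t (Derive Phi t / Derive G (H t)).
Proof.
  intros Hc He HG HP Hn.
  pose proof (locally_singleton _ _ Hc) as Hc0.
  assert (L : locally t (fun u => is_derive H u (Derive Phi u / Derive G (H u)))).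
  { pose proof (smooth_at_locally_derive _ _ HP) as L1.
    pose proof (continuous_locally H t _ Hc0 (smooth_at_locally_derive _ _ HG)) as L2.
    assert (L3 : locally t (fun u => Derive G (H u) <> 0)).
    { apply (continuous_neq (fun u => Derive G (H u))); auto.
      apply (continuous_comp H (Derive G)); auto.
      apply smooth_at_continuous. now apply smooth_at_Derive. }
    apply locally_locally in He.
    generalize (filter_and _ _ Hc (filter_and _ _ He (filter_and _ _ L1 (filter_and _ _ L2 L3)))).
    apply filter_imp. intros u [A [B [C [D E]]]]. now apply is_derive_implicit with G Phi. }
  split; [|now apply locally_singleton in L].
  intros n. induction n; simpl; auto.
  exists (fun u => Derive Phi u / Derive G (H u)). split; auto.
  apply Cn_mult. now apply smooth_at_Derive.
  apply (Cn_comp n Rinv). now apply Cn_Rinv.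
  apply (Cn_comp n (Derive G)); auto. now apply smooth_at_Derive.
Qed.

(** * Primitives and the Morse lemma *)

Lemma ex_RInt_smooth F a b : smooth1 F -> ex_RInt F a b.
Proof. intros H. apply (@ex_RInt_continuous R_CompleteNormedModule). intros z _. now apply smooth1_continuous. Qed.

Lemma is_derive_primitive F a t : smooth1 F -> is_derive (RInt F a) t (F t).
Proof.
  intros H. apply (is_derive_RInt F (RInt F a) a t).
  - apply filter_forall. intros b. apply (@RInt_correct R_CompleteNormedModule). now apply ex_RInt_smooth.
  - now apply smooth1_continuous.
Qed.

Lemma smooth1_primitive F a : smooth1 F -> smooth1 (RInt F a).
Proof. intros H. apply smooth1_of_derivative with F; auto. intros t. now apply is_derive_primitive. Qed.

Lemma primitive_at_base F a : RInt F a a = 0.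
Proof. exact (@RInt_point R_CompleteNormedModule a F). Qed.

Definition moment (k : nat) (g : R -> R) (u : R) : R := RInt (fun r => r ^ k * g (r * u)) 0 1.

Lemma smooth1_pow k : smooth1 (fun r => r ^ k).
Proof. induction k; simpl. apply smooth1_const. apply smooth1_mult; auto. apply smooth1_id. Qed.

Lemma smooth1_scale g c : smooth1 g -> smooth1 (fun r => g (r * c)).
Proof.
  intros H. apply (smooth1_comp g (fun r => r * c)); auto. apply smooth1_mult.
  apply smooth1_id. apply smooth1_const.
Qed.

Lemma is_derive_moment k g u : smooth1 g -> is_derive (moment k g) u (moment (S k) (Derive g) u).
Proof.
  intros Hg.
  assert (D : forall r v, is_derive (fun z => r ^ k * g (r * z)) v (r ^ S k * Derive g (r * v))).
  { intros r v. eapply is_derive_eq. apply (is_derive_scal (fun z => g (r * z)) v (r ^ k)).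
    apply (is_derive_Rcomp g (fun z => r * z)). now apply smooth1_derive.
    apply (is_derive_scal (fun z => z) v r). apply is_derive_Rid.
    unfold scal; simpl; unfold mult; simpl. unfold one; simpl. ring. }
  unfold moment at 2. erewrite RInt_ext; [apply is_derive_RInt_param|].
  - apply filter_forall. intros v r _. eexists; apply D.
  - intros r _. apply continuity_2d_pt_ext with (fun v r => r ^ S k * Derive g (r * v)).
    + intros v z. symmetry. apply is_derive_unique, D.
    + apply continuity_2d_pt_mult.
      * apply (continuity_1d_2d_pt_comp (fun z => z ^ S k) (fun _ z => z)).
        apply (smooth1_continuity _ (smooth1_pow (S k))). apply continuity_2d_pt_id2.
      * apply (continuity_1d_2d_pt_comp (Derive g) (fun v z => z * v)).
        apply (smooth1_continuity _ (smooth1_Derive _ Hg)).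
        apply continuity_2d_pt_mult. apply continuity_2d_pt_id2. apply continuity_2d_pt_id1.
  - apply filter_forall. intros v. apply ex_RInt_smooth. apply smooth1_mult.
    apply smooth1_pow. now apply smooth1_scale.
  - intros r _. simpl. symmetry. apply is_derive_unique, D.
Qed.

(** Differentiation under the integral sign raises [k] and differentiates [g],
    so the family of all moments is closed under derivation. *)
Lemma smooth1_moment k g : smooth1 g -> smooth1 (moment k g).
Proof.
  intros Hg t n. revert k g Hg t. induction n; intros k g Hg t; simpl; auto.
  exists (moment (S k) (Derive g)). split.
  - apply filter_forall. intros u. now apply is_derive_moment.
  - apply IHn. now apply smooth1_Derive.
Qed.

(** Hadamard's lemma; the cofactor is the mean of [Derive g] over the segment
    from [0] to [u]. *)
Lemma hadamard g u : smooth1 g -> g u = g 0 + u * moment 0 (Derive g) u.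
Proof.
  intros Hg. unfold moment.
  assert (E : is_RInt (fun r => scal u (Derive g (u * r + 0))) 0 1 (g u - g 0)).
  { apply (is_RInt_comp_lin (Derive g) u 0 0 1). replace (u * 0 + 0) with 0 by ring.
    replace (u * 1 + 0) with u by ring. apply (is_RInt_derive g (Derive g)).
    intros; now apply smooth1_derive. intros; now apply smooth1_continuous, smooth1_Derive. }
  apply (@is_RInt_unique R_CompleteNormedModule) in E.
  rewrite (RInt_ext _ (fun r => scal u (r ^ 0 * Derive g (r * u)))) in E.
  - assert (X : RInt (fun r => scal u (r ^ 0 * Derive g (r * u))) 0 1
                = u * RInt (fun r => r ^ 0 * Derive g (r * u)) 0 1).
    { apply (@RInt_scal R_CompleteNormedModule (fun r => r ^ 0 * Derive g (r * u)) 0 1 u).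
      apply ex_RInt_smooth. apply smooth1_mult. apply smooth1_pow. apply smooth1_scale.
      now apply smooth1_Derive. }
    rewrite E in X. lra.
  - intros r _. unfold scal; simpl; unfold mult; simpl. rewrite Rplus_0_r, (Rmult_comm u r). ring.
Qed.

Lemma moment_0 k g : smooth1 g -> moment k g 0 = g 0 / INR (S k).
Proof.
  intros Hg. unfold moment. apply is_RInt_unique.
  assert (Hk := not_0_INR (S k) ltac:(lia)).
  assert (D : forall r, is_derive (fun r => r ^ S k * (g 0 / INR (S k))) r (r ^ k * g (r * 0))).
  { intros r. eapply is_derive_eq. apply (is_derive_Rmult (fun r => r ^ S k)).
    apply (is_derive_pow (fun r => r) (S k) r 1). apply is_derive_Rid. apply is_derive_Rconst.
    simpl pred. rewrite (Rmult_0_r r). field. auto. }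
  replace (g 0 / INR (S k)) with (minus (1 ^ S k * (g 0 / INR (S k))) (0 ^ S k * (g 0 / INR (S k)))).
  - apply (is_RInt_derive (fun r => r ^ S k * (g 0 / INR (S k)))).
    + intros r _. apply D.
    + intros r _. apply smooth1_continuous. apply smooth1_mult. apply smooth1_pow. now apply smooth1_scale.
  - rewrite pow1, pow_i by lia. unfold minus, plus, opp; simpl. ring.
Qed.

(** The Morse lemma: two applications of Hadamard's lemma give
    [F = F t + (u - t)^2 a u] with [a t <> 0], and [X] is
    [(u - t) * sqrt |a u|]. *)
Lemma morse F t : smooth1 F -> Derive F t = 0 -> Derive (Derive F) t <> 0 ->
  exists (s : Z) (X : R -> R), (s = 1 \/ s = -1)%Z /\ smooth_at X t /\ X t = 0 /\ 0 < Derive X t /\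
    locally t (fun u => F u = F t + IZR s * (X u * X u) /\ (u < t -> X u < 0) /\ (t < u -> 0 < X u)).
Proof.
  intros HF H1 H2.
  pose (G := fun v => F (t + v)).
  assert (sT : smooth1 (fun v => t + v)) by (apply smooth1_plus; [apply smooth1_const|apply smooth1_id]).
  assert (dT : forall v, is_derive (fun v => t + v) v 1).
  { intros v. eapply is_derive_eq. apply is_derive_Rplus. apply is_derive_Rconst. apply is_derive_Rid.
    ring. }
  assert (sG : smooth1 G) by (now apply (smooth1_comp F (fun v => t + v))).
  assert (dG : forall v, Derive G v = Derive F (t + v)).
  { intros v. apply is_derive_unique. eapply is_derive_eq.
    apply (is_derive_Rcomp F (fun v => t + v)). now apply smooth1_derive. apply dT. ring. }
  assert (dG2 : Derive (Derive G) 0 = Derive (Derive F) t).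
  { rewrite (Derive_ext _ _ _ dG). apply is_derive_unique. eapply is_derive_eq.
    apply (is_derive_Rcomp (Derive F) (fun v => t + v)). apply smooth1_derive, smooth1_Derive, HF. apply dT.
    rewrite Rplus_0_r. ring. }
  pose (g1 := moment 0 (Derive G)).
  assert (sg1 : smooth1 g1) by (apply smooth1_moment, smooth1_Derive, sG).
  pose (a := moment 0 (Derive g1)).
  assert (sa : smooth1 a) by (apply smooth1_moment, smooth1_Derive, sg1).
  assert (g10 : g1 0 = 0).
  { unfold g1. rewrite moment_0 by (now apply smooth1_Derive). rewrite dG, Rplus_0_r, H1. simpl. field. }
  assert (a0 : a 0 <> 0).
  { unfold a. rewrite moment_0 by (now apply smooth1_Derive).
    replace (Derive g1 0) with (moment 1 (Derive (Derive G)) 0)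
      by (symmetry; apply is_derive_unique, is_derive_moment, smooth1_Derive, sG).
    rewrite moment_0 by (now apply smooth1_Derive, smooth1_Derive). rewrite dG2. simpl. lra. }
  assert (EG : forall v, G v = F t + v * v * a v).
  { intros v. rewrite (hadamard G v sG). fold g1. rewrite (hadamard g1 v sg1). fold a.
    rewrite g10. unfold G at 1. rewrite Rplus_0_r. ring. }
  assert (Hs : exists s : Z, (s = 1 \/ s = -1)%Z /\ 0 < IZR s * a 0).
  { destruct (Rdichotomy _ _ a0). exists (-1)%Z. split; auto; lra. exists 1%Z; split; auto; lra. }
  destruct Hs as [s [Hs Hpos]].
  pose (b := fun u => IZR s * a (u - t)).
  assert (sb : smooth1 b).
  { apply smooth1_mult. apply smooth1_const. apply (smooth1_comp a (fun u => u - t)); auto.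
    apply smooth1_minus. apply smooth1_id. apply smooth1_const. }
  assert (bt : 0 < b t) by (unfold b; rewrite Rminus_diag; auto).
  assert (Lb : locally t (fun u => 0 < b u)) by (apply continuous_lt; auto; now apply smooth1_continuous).
  assert (Ssq : smooth_at (fun u => sqrt (b u)) t).
  { intros n. apply (Cn_comp n sqrt b). now apply Cn_sqrt. apply sb. }
  exists s, (fun u => (u - t) * sqrt (b u)). split; auto. split; [|split; [|split]].
  - intros n. apply Cn_mult; auto. apply (smooth1_minus (fun u => u) (fun _ => t)).
    apply smooth1_id. apply smooth1_const.
  - ring.
  - replace (Derive _ t) with (sqrt (b t)). now apply sqrt_lt_R0.
    symmetry. apply is_derive_unique. eapply is_derive_eq.
    apply (is_derive_Rmult (fun u => u - t)). apply (is_derive_Rminus (fun u => u) (fun _ => t)).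
    apply is_derive_Rid. apply is_derive_Rconst. apply smooth_at_derive, Ssq.
    cbv beta. ring.
  - revert Lb. apply filter_imp. intros u Hu. split; [|split; intros; pose proof (sqrt_lt_R0 _ Hu); nra].
    replace ((u - t) * sqrt (b u) * ((u - t) * sqrt (b u))) with ((u - t) * (u - t) * (sqrt (b u) * sqrt (b u))) by ring.
    rewrite sqrt_sqrt by lra. unfold b.
    replace (F u) with (G (u - t)) by (unfold G; f_equal; ring). rewrite EG.
    destruct Hs as [-> | ->]; ring.
Qed.

(** * Flat functions *)

(** The factors [(/ x) ^ k] make the family stable under derivation, see
    [is_derive_flat], so that all its members are smooth at once. *)
Definition flat (k : nat) (x : R) : R := if Rlt_dec 0 x then (/ x) ^ k * exp (- / x) else 0.

Lemma exp_pow y n : exp y ^ n = exp (INR n * y).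
Proof.
  induction n. simpl. now rewrite Rmult_0_l, exp_0. 
  rewrite S_INR, Rmult_plus_distr_r, Rmult_1_l, exp_plus, <- IHn. simpl. ring.
Qed.

Lemma flat_le k x : 0 < x -> flat k x <= INR (S k) ^ S k * x.
Proof.
  intros Hx. unfold flat. destruct Rlt_dec; [|lra].
  assert (Hk : 0 < INR (S k)) by (apply lt_0_INR; lia).
  assert (Hi : 0 < / x) by (now apply Rinv_0_lt_compat).
  (* [exp y = exp (y / n)^n >= (y / n)^n] with [y = / x] and [n = k + 1]. *)
  assert (E : (/ x / INR (S k)) ^ S k <= exp (/ x)).
  { replace (exp (/ x)) with (exp (/ x / INR (S k)) ^ S k).
    - apply pow_incr. split. apply Rlt_le, Rdiv_lt_0_compat; auto.
      generalize (exp_ineq1_le (/ x / INR (S k))). lra.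
    - rewrite exp_pow. f_equal. field. split; lra. }
  unfold Rdiv in E. rewrite Rpow_mult_distr, (pow_inv (INR (S k))) in E.
  assert (0 < INR (S k) ^ S k) by (now apply pow_lt).
  assert (E' : (/ x) ^ S k <= INR (S k) ^ S k * exp (/ x)).
  { apply Rmult_le_reg_r with (/ INR (S k) ^ S k). now apply Rinv_0_lt_compat.
    eapply Rle_trans; [exact E|]. right. field. lra. }
  rewrite exp_Ropp. apply Rmult_le_reg_r with (/ x * exp (/ x)).
  - apply Rmult_lt_0_compat; auto. apply exp_pos.
  - pose proof (exp_pos (/ x)).
    replace ((/ x) ^ k * / exp (/ x) * (/ x * exp (/ x))) with ((/ x) ^ S k) by (simpl; field; lra).
    replace (INR (S k) ^ S k * x * (/ x * exp (/ x))) with (INR (S k) ^ S k * exp (/ x)) by (field; lra).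
    exact E'.
Qed.

Lemma flat_nonneg k x : 0 <= flat k x.
Proof.
  unfold flat. destruct Rlt_dec; [|lra]. apply Rmult_le_pos. apply pow_le. left.
  now apply Rinv_0_lt_compat. left; apply exp_pos.
Qed.

Lemma flat_0 k x : x <= 0 -> flat k x = 0.
Proof. intros. unfold flat. destruct Rlt_dec; lra. Qed.

Lemma flat_pos x : 0 < x -> 0 < flat 0 x.
Proof. intros. unfold flat. destruct Rlt_dec; [|lra]. simpl. rewrite Rmult_1_l. apply exp_pos. Qed.

Lemma is_derive_flat k x : is_derive (flat k) x (flat (S (S k)) x - INR k * flat (S k) x).
Proof.
  destruct (Rtotal_order x 0) as [H|[->|H]].
  - rewrite !flat_0 by lra. apply is_derive_ext_loc with (fun _ => 0).
    + apply (locally_of_window x (-x)). lra. intros; rewrite flat_0; lra.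
    + eapply is_derive_eq. apply is_derive_Rconst. ring.
  - rewrite !flat_0 by lra. replace (0 - INR k * 0) with 0 by ring.
    (* the quotient [flat k x / x] is [flat (k + 1) x], which tends to [0] *)
    apply caratheodory. exists (flat (S k)). split; [|split].
    + intros Q HQ. rewrite flat_0 in HQ by lra. apply window_of_locally in HQ. destruct HQ as [e [He HQ]].
      assert (Hc : 0 < INR (S (S k)) ^ S (S k)) by (apply pow_lt, lt_0_INR; lia).
      apply (locally_of_window 0 (e / (INR (S (S k)) ^ S (S k)))). now apply Rdiv_lt_0_compat.
      intros u Hu. apply HQ. pose proof (flat_nonneg (S k) u). split; [lra|].
      destruct (Rlt_le_dec 0 u).
      * apply Rle_lt_trans with (1 := flat_le (S k) u r).
        apply Rlt_le_trans with (INR (S (S k)) ^ S (S k) * (e / INR (S (S k)) ^ S (S k))).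
        apply Rmult_lt_compat_l; lra. right. field. lra.
      * rewrite flat_0; lra.
    + apply flat_0; lra.
    + intros u. rewrite (flat_0 k 0) by lra. unfold flat. destruct Rlt_dec; [simpl; field; lra|ring].
  - assert (L : locally x (fun u => (/ u) ^ k * exp (- / u) = flat k u)).
    { apply (locally_of_window x x); auto. intros u Hu. unfold flat. destruct Rlt_dec; lra. }
    apply (is_derive_ext_loc _ _ _ _ L).
    assert (D : is_derive Rinv x (- / x ^ 2)).
    { eapply is_derive_eq. apply (is_derive_inv (fun u => u) x 1). apply is_derive_Rid. lra. field; lra. }
    eapply is_derive_eq. apply is_derive_Rmult.
    + apply (is_derive_pow Rinv k x _ D).
    + apply (is_derive_Rcomp exp (fun u => - / u)). apply is_derive_exp. apply (is_derive_Ropp Rinv x _ D).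
    + unfold flat. destruct Rlt_dec; [|lra].
      destruct k; simpl pred; simpl pow; [simpl INR|]; field; lra.
Qed.

Lemma smooth1_flat k : smooth1 (flat k).
Proof.
  intros t n. revert k. induction n; intros k; simpl; auto.
  exists (fun x => flat (S (S k)) x - INR k * flat (S k) x). split.
  - apply filter_forall. intros; apply is_derive_flat.
  - apply Cn_plus; auto. apply Cn_opp. apply Cn_mult; auto. apply Cn_const.
Qed.

(** * The covering of the circle by the line *)

Lemma S1_eq (x y : S1) : proj1_sig x = proj1_sig y -> x = y.
Proof.
  destruct x as [x hx], y as [y hy]; simpl; intros E; subst. f_equal. apply proof_irrelevance.
Qed.

Lemma cos_1_period t : cos t = 1 -> exists k : Z, t = IZR k * (2 * PI).
Proof.
  intros H. replace t with (2 * (t / 2)) in H by field.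
  rewrite cos_2a_sin in H. assert (E : sin (t / 2) = 0) by nra.
  destruct (sin_eq_0_0 _ E) as [k Hk]. exists k. lra.
Qed.

Lemma periodic_Z (Q : R -> Prop) : (forall t, Q (t + 2 * PI) <-> Q t) ->
  forall t (k : Z), Q (t + IZR k * (2 * PI)) <-> Q t.
Proof.
  intros H t k. apply (Z.bi_induction (fun k => Q (t + IZR k * (2 * PI)) <-> Q t)).
  - intros x y ->; tauto.
  - now rewrite Rmult_0_l, Rplus_0_r.
  - intros j. rewrite succ_IZR. replace (t + (IZR j + 1) * (2 * PI)) with (t + IZR j * (2 * PI) + 2 * PI) by ring.
    now rewrite H.
Qed.

Lemma cos_sin_period t (k : Z) :
  cos (t + IZR k * (2 * PI)) = cos t /\ sin (t + IZR k * (2 * PI)) = sin t.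
Proof.
  apply (periodic_Z (fun u => cos u = cos t /\ sin u = sin t)); auto.
  intros u. rewrite cos_plus, sin_plus, cos_2PI, sin_2PI, !Rmult_0_r, !Rmult_1_r, Rminus_0_r, Rplus_0_r. tauto.
Qed.

Lemma P_eq_iff t u : P t = P u <-> exists k : Z, u = t + IZR k * (2 * PI).
Proof.
  split.
  - intros E. apply (f_equal (@proj1_sig _ _)) in E. simpl in E. injection E; intros E1 E2.
    destruct (cos_1_period (u - t)) as [k Hk].
    + rewrite cos_minus, E1, E2. pose proof (sin2_cos2 u). unfold Rsqr in H. lra.
    + exists k. lra.
  - intros [k ->]. apply S1_eq. simpl. destruct (cos_sin_period t k) as [-> ->]. reflexivity.
Qed.

Lemma P_period t k : P (t + IZR k * (2 * PI)) = P t.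
Proof. symmetry. apply P_eq_iff. now exists k. Qed.

Lemma two_PI_pos : 0 < 2 * PI.
Proof. generalize PI_RGT_0; lra. Qed.

Lemma P_onto (x : S1) : exists t, 0 <= t < 2 * PI /\ P t = x.
Proof.
  destruct x as [[a b] h]. simpl in h. pose proof PI_RGT_0.
  assert (Ha : -1 <= a <= 1) by nra.
  pose proof (acos_bound a) as B. pose proof (sin2_cos2 (acos a)) as E. unfold Rsqr in E.
  rewrite cos_acos in E by auto.
  assert (S0 : 0 <= sin (acos a)) by (apply sin_ge_0; lra).
  destruct (Rle_lt_dec 0 b).
  - exists (acos a). split; [lra|]. apply S1_eq. simpl. rewrite cos_acos by auto. f_equal. nra.
  - exists (2 * PI - acos a). assert (sin (acos a) = - b) by nra. split.
    + split; [lra|]. destruct (Req_dec (acos a) 0) as [E0|]; [|lra].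
      rewrite E0, sin_0 in H0. lra.
    + apply S1_eq. simpl. replace (2 * PI - acos a) with (- acos a + IZR 1 * (2 * PI)) by (simpl; ring).
      destruct (cos_sin_period (- acos a) 1) as [-> ->]. rewrite cos_neg, sin_neg, cos_acos by auto.
      f_equal. lra.
Qed.

Definition angle (x : S1) : R := proj1_sig (constructive_indefinite_description _ (P_onto x)).

Lemma P_angle x : P (angle x) = x.
Proof. unfold angle. destruct constructive_indefinite_description; simpl; tauto. Qed.

Lemma angle_range x : 0 <= angle x < 2 * PI.
Proof. unfold angle. destruct constructive_indefinite_description; simpl; tauto. Qed.

Lemma representative t : exists k : Z, 0 <= t + IZR k * (2 * PI) < 2 * PI.
Proof.
  pose proof (angle_range (P t)) as H. destruct (proj1 (P_eq_iff t (angle (P t)))) as [k Hk].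
  now rewrite P_angle. exists k. lra.
Qed.

Lemma same_representative t u : 0 <= t < 2 * PI -> 0 <= u < 2 * PI -> P t = P u -> t = u.
Proof.
  intros Ht Hu E. apply P_eq_iff in E. destruct E as [k Hk]. pose proof two_PI_pos.
  assert (-1 < k < 1)%Z. { split; apply lt_IZR; simpl; nra. }
  replace k with 0%Z in Hk by lia. lra.
Qed.

(** * Lifts *)

(** Lifts of circle maps of degree [d]. *)
Definition equivariant (F : R -> R) (d : Z) : Prop :=
  forall t, F (t + 2 * PI) = F t + IZR d * (2 * PI).

Lemma equivariant_Z F d k t :
  equivariant F d -> F (t + IZR k * (2 * PI)) = F t + IZR (d * k) * (2 * PI).
Proof.
  intros H.
  assert (E : F (t + IZR k * (2 * PI)) - IZR d * (t + IZR k * (2 * PI)) = F t - IZR d * t).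
  { apply (periodic_Z (fun u => F u - IZR d * u = F t - IZR d * t)); auto.
    intros u. rewrite H. split; intros E; lra. }
  rewrite mult_IZR. lra.
Qed.

Definition descend (F : R -> R) (x : S1) : S1 := P (F (angle x)).

Lemma descend_P F d t : equivariant F d -> descend F (P t) = P (F t).
Proof.
  intros H. unfold descend. destruct (proj1 (P_eq_iff t (angle (P t)))) as [k Hk].
  now rewrite P_angle. rewrite Hk, (equivariant_Z F d) by auto. apply P_period.
Qed.

Definition lifts (f : S1 -> S1) (F : R -> R) : Prop := forall t, f (P t) = P (F t).

Lemma curve1_lift f F t : lifts f F -> curve1 f t = cos (F t).
Proof. intros H. unfold curve1. now rewrite H. Qed.
Lemma curve2_lift f F t : lifts f F -> curve2 f t = sin (F t).
Proof. intros H. unfold curve2. now rewrite H. Qed.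

Lemma smooth_iff_curves f : smooth f <-> smooth1 (curve1 f) /\ smooth1 (curve2 f).
Proof.
  rewrite !smooth1_iff. unfold smooth. split.
  - intros H. split; intros n t; apply H.
  - intros [H1 H2] n t. split; auto.
Qed.

Lemma smooth_of_lift f F : lifts f F -> smooth1 F -> smooth f.
Proof.
  intros HL HF. apply smooth_iff_curves. split.
  - intros t n. apply Cn_ext_loc with (fun u => cos (F u)).
    apply filter_forall; intros; symmetry; now apply curve1_lift.
    now apply (smooth1_comp cos F smooth1_cos).
  - intros t n. apply Cn_ext_loc with (fun u => sin (F u)).
    apply filter_forall; intros; symmetry; now apply curve2_lift.
    now apply (smooth1_comp sin F smooth1_sin).
Qed.

(** A rigidity principle: it applies to the difference of two lifts of one map,
    whose values are multiples of [2 PI]. *)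
Lemma constant_of_discrete (D : R -> R) :
  smooth1 D -> (forall t, exists k : Z, D t = IZR k * (2 * PI)) -> forall a b, D a = D b.
Proof.
  intros SD HD. apply constant_of_derive0. intros t. pose proof two_PI_pos.
  apply is_derive_ext_loc with (fun _ => D t); [|apply is_derive_Rconst].
  assert (L : locally (D t) (fun y => D t - 2 * PI < y < D t + 2 * PI)).
  { now apply (locally_of_window _ (2 * PI)). }
  apply (continuous_locally _ _ _ (smooth1_continuous _ t SD)) in L.
  revert L. apply filter_imp. intros u Hu.
  destruct (HD t) as [k Hk], (HD u) as [j Hj]. rewrite Hk, Hj in *.
  assert (-1 < j - k < 1)%Z. { split; apply lt_IZR; rewrite minus_IZR; simpl; nra. }
  now replace j with k by lia.
Qed.

Lemma equivariant_of_lift f F : lifts f F -> smooth1 F -> exists d, equivariant F d.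
Proof.
  intros HL HF.
  assert (E : forall t, exists k : Z, F (t + 2 * PI) - F t = IZR k * (2 * PI)).
  { intros t. destruct (proj1 (P_eq_iff (F t) (F (t + 2 * PI)))) as [k Hk].
    - rewrite <- !HL. f_equal. apply P_eq_iff. exists 1%Z. simpl; ring.
    - exists k. lra. }
  destruct (E 0) as [d Hd]. exists d. intros t.
  assert (C := constant_of_discrete (fun t => F (t + 2 * PI) - F t)). simpl in C.
  assert (F (t + 2 * PI) - F t = F (0 + 2 * PI) - F 0); [|lra].
  apply C; auto. apply smooth1_minus; auto. apply (smooth1_comp F (fun u => u + 2 * PI)); auto.
  apply smooth1_plus. apply smooth1_id. apply smooth1_const.
Qed.

(** A lift is the primitive of the angular speed [c1 c2' - c2 c1']; the angle
    between the curve and the point it prescribes is then constant. *)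
Lemma lift_exists f : smooth f -> exists F d, smooth1 F /\ lifts f F /\ equivariant F d.
Proof.
  intros Hf. apply smooth_iff_curves in Hf. destruct Hf as [H1 H2].
  set (c1 := curve1 f) in *. set (c2 := curve2 f) in *.
  assert (N : forall t, c1 t * c1 t + c2 t * c2 t = 1).
  { intros t. unfold c1, c2, curve1, curve2. destruct (f (P t)) as [[a b] h]. simpl in *. lra. }
  assert (N' : forall t, c1 t * Derive c1 t + c2 t * Derive c2 t = 0).
  { intros t. assert (D : is_derive (fun u => c1 u * c1 u + c2 u * c2 u) t
       (Derive c1 t * c1 t + c1 t * Derive c1 t + (Derive c2 t * c2 t + c2 t * Derive c2 t))).
    { apply is_derive_Rplus; apply is_derive_Rmult; now apply smooth1_derive. }
    apply is_derive_unique in D. pose proof (Derive_ext _ (fun _ => 1) t N) as E.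
    rewrite Derive_const in E. pose proof (eq_trans (eq_sym D) E). lra. }
  pose (rho := fun t => c1 t * Derive c2 t - c2 t * Derive c1 t).
  assert (Sr : smooth1 rho).
  { apply smooth1_minus; apply smooth1_mult; auto; now apply smooth1_Derive. }
  pose (t0 := angle (f (P 0))).
  pose (F := fun t => t0 + RInt rho 0 t).
  assert (DF : forall t, is_derive F t (rho t)).
  { intros t. eapply is_derive_eq. apply is_derive_Rplus. apply is_derive_Rconst.
    now apply is_derive_primitive. ring. }
  assert (SF : smooth1 F) by (now apply smooth1_of_derivative with rho).
  assert (L : lifts f F).
  { assert (D1 : forall t, c1 t * cos (F t) + c2 t * sin (F t) = 1).
    { intros t. rewrite (constant_of_derive0 (fun t => c1 t * cos (F t) + c2 t * sin (F t))) with t 0.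
      - unfold F. rewrite primitive_at_base, Rplus_0_r. unfold c1, c2, curve1, curve2, t0.
        rewrite <- (P_angle (f (P 0))) at 1 3. simpl.
        pose proof (sin2_cos2 (angle (f (P 0)))) as E. unfold Rsqr in E. lra.
      - intros u. eapply is_derive_eq.
        + apply is_derive_Rplus; apply is_derive_Rmult. now apply smooth1_derive.
          apply (is_derive_Rcomp cos F). apply is_derive_cos. apply DF. now apply smooth1_derive.
          apply (is_derive_Rcomp sin F). apply is_derive_sin. apply DF.
        + unfold rho. pose proof (N u). pose proof (N' u).
          replace (Derive c1 u * cos (F u)) with ((c1 u * c1 u + c2 u * c2 u) * Derive c1 u * cos (F u)) by (rewrite H; ring).
          replace (Derive c2 u * sin (F u)) with ((c1 u * c1 u + c2 u * c2 u) * Derive c2 u * sin (F u)) by (rewrite H; ring).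
          transitivity ((c1 u * Derive c1 u + c2 u * Derive c2 u) * (c1 u * cos (F u) + c2 u * sin (F u))); [ring|].
          rewrite H0. ring. }
    intros t. apply S1_eq. rewrite (surjective_pairing (proj1_sig (f (P t)))).
    change (fst (proj1_sig (f (P t)))) with (c1 t). change (snd (proj1_sig (f (P t)))) with (c2 t).
    simpl. pose proof (D1 t). pose proof (N t). pose proof (sin2_cos2 (F t)) as E. unfold Rsqr in E.
    assert (Q : Rsqr (c1 t - cos (F t)) + Rsqr (c2 t - sin (F t)) = 0) by (unfold Rsqr; lra).
    pose proof (Rplus_sqr_eq_0_l _ _ Q). rewrite Rplus_comm in Q. pose proof (Rplus_sqr_eq_0_l _ _ Q).
    f_equal; lra. }
  destruct (equivariant_of_lift f F L SF) as [d Hd]. now exists F, d.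
Qed.

Lemma lifts_descend F d : equivariant F d -> lifts (descend F) F.
Proof. intros H t. now apply descend_P with d. Qed.

Lemma equivariant_period F d t : smooth1 F -> equivariant F d -> Derive F (t + 2 * PI) = Derive F t.
Proof.
  intros HF Hd. symmetry. apply is_derive_unique.
  apply is_derive_Rext with (fun u => F (u + 2 * PI) - IZR d * (2 * PI)).
  - intros u. rewrite Hd. ring.
  - eapply is_derive_eq. apply is_derive_Rminus. apply (is_derive_Rcomp F (fun u => u + 2 * PI)).
    now apply smooth1_derive. apply is_derive_Rplus. apply is_derive_Rid. apply is_derive_Rconst.
    apply is_derive_Rconst. ring.
Qed.

Lemma equivariant_Derive F d : smooth1 F -> equivariant F d -> equivariant (Derive F) 0.
Proof. intros HF Hd t. rewrite (equivariant_period F d); auto. simpl; ring. Qed.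

Lemma Derive_period_Z F d t k :
  smooth1 F -> equivariant F d -> Derive F (t + IZR k * (2 * PI)) = Derive F t.
Proof.
  intros HF Hd. rewrite (equivariant_Z (Derive F) 0) by (now apply equivariant_Derive with d).
  simpl. ring.
Qed.

Lemma Sigma_lift f F d t :
  smooth1 F -> lifts f F -> equivariant F d -> (Sigma f (P t) <-> Derive F t = 0).
Proof.
  intros HF HL Hd.
  assert (D1 : forall u, Derive (curve1 f) u = - sin (F u) * Derive F u).
  { intros u. rewrite (Derive_ext (curve1 f) (fun v => cos (F v))) by (intros; now apply curve1_lift).
    apply is_derive_unique. eapply is_derive_eq. apply (is_derive_Rcomp cos F). apply is_derive_cos.
    now apply smooth1_derive. ring. }
  assert (D2 : forall u, Derive (curve2 f) u = cos (F u) * Derive F u).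
  { intros u. rewrite (Derive_ext (curve2 f) (fun v => sin (F v))) by (intros; now apply curve2_lift).
    apply is_derive_unique. eapply is_derive_eq. apply (is_derive_Rcomp sin F). apply is_derive_sin.
    now apply smooth1_derive. ring. }
  split.
  - intros [u [E [H1 H2]]]. symmetry in E. apply P_eq_iff in E. destruct E as [k Hk].
    rewrite D1 in H1. rewrite D2 in H2. rewrite Hk in H1, H2. rewrite (Derive_period_Z F d) in H1, H2 by auto.
    rewrite <- Hk in H1, H2. pose proof (sin2_cos2 (F u)) as E. unfold Rsqr in E.
    replace (Derive F t) with ((sin (F u) * sin (F u) + cos (F u) * cos (F u)) * Derive F t) by (rewrite E; ring).
    replace ((sin (F u) * sin (F u) + cos (F u) * cos (F u)) * Derive F t) with
      (- sin (F u) * (- sin (F u) * Derive F t) + cos (F u) * (cos (F u) * Derive F t)) by ring.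
    rewrite H1, H2. ring.
  - intros H. exists t. rewrite D1, D2, H. repeat split; ring.
Qed.

(** * Diffeomorphisms *)

(** Lifts of circle diffeomorphisms; [e] is the orientation sign. *)
Definition ldiff (e : Z) (H : R -> R) : Prop :=
  (e = 1 \/ e = -1)%Z /\ smooth1 H /\ equivariant H e /\ forall t, 0 < IZR e * Derive H t.

Lemma regular_sign F d : smooth1 F -> equivariant F d -> (forall t, Derive F t <> 0) ->
  exists s : Z, (s = 1 \/ s = -1)%Z /\ forall t, 0 < IZR s * Derive F t.
Proof.
  intros SF EF Hn. pose proof two_PI_pos.
  destruct (constant_sign (Derive F) (-1) (2 * PI + 1)) as [s [Hs Hsp]].
  { now apply smooth1_continuity, smooth1_Derive. }
  { intros t _. apply Hn. }
  exists s. split; auto. intros t. destruct (representative t) as [k Hk].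
  rewrite <- (Derive_period_Z F d t k) by auto. apply Hsp. lra.
Qed.

Lemma monotone_equivariant_bijective (s : Z) F d :
  smooth1 F -> equivariant F d -> (s = 1 \/ s = -1)%Z -> (forall t, 0 < IZR s * Derive F t) ->
  (0 < s * d)%Z /\ (forall x y, x < y -> IZR s * F x < IZR s * F y) /\ (forall y, exists x, F x = y).
Proof.
  intros HF Hd Hs Hp. pose proof two_PI_pos.
  assert (M : forall x y, x < y -> IZR s * F x < IZR s * F y).
  { intros x y Hxy. apply (strictly_monotone_on (IZR s) F x y); auto; try lra.
    intros t. eexists. now apply smooth1_derive. }
  assert (Pos : (0 < s * d)%Z).
  { apply lt_IZR. rewrite mult_IZR. specialize (M 0 (0 + 2 * PI) ltac:(lra)). rewrite Hd in M. nra. }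
  split; auto. split; auto. intros y.
  assert (Hn : exists k : Z, Rabs (y - F 0) <= IZR k * (2 * PI) /\ (0 <= k)%Z).
  { exists (up (Rabs (y - F 0) / (2 * PI))). destruct (archimed (Rabs (y - F 0) / (2 * PI))) as [A _].
    assert (0 <= Rabs (y - F 0) / (2 * PI)) by (apply Rdiv_le_0_compat; auto; apply Rabs_pos).
    split. apply Rmult_le_reg_r with (/ (2 * PI)). now apply Rinv_0_lt_compat.
    field_simplify; [|lra|lra]. unfold Rdiv in *. lra. apply le_IZR. lra. }
  destruct Hn as [k [Hk1 Hk2]]. apply Rabs_le_between in Hk1.
  assert (B : forall j : Z, F (0 + IZR j * (2 * PI)) = F 0 + IZR (d * j) * (2 * PI)).
  { intros j. now apply equivariant_Z. }
  assert (Hdk : (k <= s * (d * k))%Z) by nia. apply IZR_le in Hdk. rewrite mult_IZR in Hdk.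
  apply (Rmult_le_compat_r (2 * PI)) in Hdk; [|lra].
  pose proof (B k) as B1. pose proof (B (- k)%Z) as B2.
  rewrite Z.mul_opp_r, (opp_IZR (d * k)) in B2.
  destruct (IVT_gen F (0 + IZR (- k) * (2 * PI)) (0 + IZR k * (2 * PI)) y) as [x [_ Hx]].
  - now apply smooth1_continuity.
  - rewrite B1, B2. destruct Hs as [-> | ->]; [rewrite Rmin_left, Rmax_right | rewrite Rmin_right, Rmax_left]; lra.
  - now exists x.
Qed.

Lemma inverse_of_monotone (s : Z) F d :
  smooth1 F -> equivariant F d -> (s = 1 \/ s = -1)%Z -> (forall t, 0 < IZR s * Derive F t) ->
  exists G, smooth1 G /\ (forall t, F (G t) = t) /\ (forall t, G (F t) = t) /\
    (forall t, 0 < IZR s * Derive G t).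
Proof.
  intros HF Hd Hs Hp.
  destruct (monotone_equivariant_bijective s F d HF Hd Hs Hp) as [_ [M Sj]].
  pose (G := fun y => proj1_sig (constructive_indefinite_description _ (Sj y))).
  assert (FG : forall y, F (G y) = y).
  { intros y. unfold G. now destruct constructive_indefinite_description. }
  assert (Inj : forall x y, F x = F y -> x = y).
  { intros x y E. destruct (Rtotal_order x y) as [L|[L|L]]; auto; apply M in L; rewrite E in L; lra. }
  assert (GF : forall t, G (F t) = t) by (intros; apply Inj; now rewrite FG).
  assert (MG : forall x y, x <= y -> IZR s * G x <= IZR s * G y).
  { intros x y L. destruct (Rle_lt_dec (IZR s * G x) (IZR s * G y)) as [|L2]; auto. exfalso.
    destruct Hs as [-> | ->].
    - assert (L3 : G y < G x) by lra. apply M in L3. rewrite !FG in L3. lra.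
    - assert (L3 : G x < G y) by lra. apply M in L3. rewrite !FG in L3. lra. }
  assert (Gc : forall t, continuous G t).
  { intros t. assert (E : forall u, IZR s * (IZR s * G u) = G u) by (intros u; destruct Hs as [-> | ->]; ring).
    apply (continuous_ext _ G t E).
    apply (continuous_scal_r (IZR s) (fun u => IZR s * G u)). apply nondecreasing_onto_continuous; auto.
    intros y. exists (F (IZR s * y)). rewrite GF. destruct Hs as [-> | ->]; ring. }
  assert (I : forall t, smooth_at G t /\ is_derive G t (Derive (fun u => u) t / Derive F (G t))).
  { intros t. apply smooth_at_implicit.
    - now apply filter_forall.
    - apply filter_forall. intros; apply FG.
    - apply HF.
    - apply smooth1_id.
    - specialize (Hp (G t)). nra. }
  exists G. split; [|split; [|split]]; auto.
  - intros t. apply I.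
  - intros t. destruct (I t) as [_ D]. apply is_derive_unique in D. rewrite D, Derive_id.
    unfold Rdiv. rewrite Rmult_1_l. specialize (Hp (G t)).
    destruct Hs as [-> | ->].
    + rewrite !Rmult_1_l in *. now apply Rinv_0_lt_compat.
    + assert (/ Derive F (G t) < 0) by (apply Rinv_lt_0_compat; lra). lra.
Qed.

Lemma ldiff_inverse e H : ldiff e H ->
  exists G, ldiff e G /\ (forall t, H (G t) = t) /\ (forall t, G (H t) = t).
Proof.
  intros [He [SH [EH PH]]].
  destruct (inverse_of_monotone e H e SH EH He PH) as [G [SG [HG [GH PG]]]].
  exists G. repeat split; auto. intros t.
  rewrite <- (HG t) at 1.
  replace (H (G t) + 2 * PI) with (H (G t + IZR e * (2 * PI))).
  - now rewrite GH.
  - rewrite (equivariant_Z H e) by auto. destruct He as [-> | ->]; simpl; ring.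
Qed.

Lemma diffeo_of_ldiff e H : ldiff e H -> diffeo (descend H).
Proof.
  intros HH. destruct (ldiff_inverse e H HH) as [G [HG [E1 E2]]].
  destruct HH as [_ [SH [EH _]]]. destruct HG as [_ [SG [EG _]]].
  split. now apply smooth_of_lift with H; auto; apply lifts_descend with e.
  exists (descend G). split. now apply smooth_of_lift with G; auto; apply lifts_descend with e.
  split; intros x; rewrite <- (P_angle x).
  - rewrite (descend_P H e), (descend_P G e) by auto. now rewrite E2.
  - rewrite (descend_P G e), (descend_P H e) by auto. now rewrite E1.
Qed.

(** The lifts of [h] and of its inverse compose to a translation. Hence their
    degrees have product [1], and the derivative of each vanishes nowhere. *)
Lemma ldiff_of_diffeo h : diffeo h -> exists e H, ldiff e H /\ lifts h H.
Proof.
  intros [Sh [h' [Sh' [E1 E2]]]].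
  destruct (lift_exists h Sh) as [H [d [SH [LH EH]]]].
  destruct (lift_exists h' Sh') as [G [d' [SG [LG EG]]]].
  assert (C : forall t, G (H t) - t = G (H 0) - 0).
  { intros t. apply (constant_of_discrete (fun t => G (H t) - t)).
    - apply smooth1_minus. now apply (smooth1_comp G H). apply smooth1_id.
    - intros u. destruct (proj1 (P_eq_iff u (G (H u)))) as [k Hk].
      now rewrite <- LG, <- LH, E1. exists k. lra. }
  assert (D : forall t, Derive H t * Derive G (H t) = 1).
  { intros t. assert (D1 : is_derive (fun t => G (H t)) t (Derive H t * Derive G (H t))).
    { apply is_derive_Rcomp; now apply smooth1_derive. }
    apply is_derive_unique in D1. rewrite <- D1. apply is_derive_unique.
    apply is_derive_Rext with (fun t => t + (G (H 0) - 0)). intros u; rewrite <- (C u); ring.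
    eapply is_derive_eq. apply is_derive_Rplus. apply is_derive_Rid. apply is_derive_Rconst. ring. }
  assert (Dd : (d' * d = 1)%Z).
  { apply eq_IZR. pose proof (C (0 + 2 * PI)) as C1. rewrite EH in C1.
    rewrite (equivariant_Z G d') in C1 by auto. pose proof two_PI_pos.
    apply Rmult_eq_reg_r with (2 * PI); lra. }
  assert (Hdd : (d = 1 \/ d = -1)%Z). { destruct (Z.eq_mul_1 d' d Dd); nia. }
  destruct (regular_sign H d SH EH) as [s [Hs Hp]].
  { intros t Z0. specialize (D t). rewrite Z0 in D. lra. }
  destruct (monotone_equivariant_bijective s H d SH EH Hs Hp) as [Hsd _].
  replace s with d in Hp by (destruct Hs, Hdd; subst; lia).
  exists d, H. repeat split; auto.
Qed.

(** * Counting and listing *)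

Lemma card_eq {X : Type} (S : X -> Prop) l : NoDup l -> (forall x, In x l <-> S x) -> card S = length l.
Proof.
  intros Hl HS. unfold card.
  assert (E : exists n, exists l, NoDup l /\ length l = n /\ forall x, In x l <-> S x) by eauto.
  apply (epsilon_spec (inhabits 0%nat)) in E. destruct E as [l' [N' [L' S']]]. rewrite <- L'.
  apply Nat.le_antisymm; apply NoDup_incl_length; auto; intros x Hx.
  - apply HS, S'; auto.
  - apply S', HS; auto.
Qed.

Lemma sorted_unique l l' :
  StronglySorted Rlt l -> StronglySorted Rlt l' -> (forall x, In x l <-> In x l') -> l = l'.
Proof.
  revert l'. induction l as [|a l IH]; intros [|b l'] H H' E; auto.
  - exfalso. apply (E b). now left.
  - exfalso. apply (E a). now left.
  - inversion H as [|? ? Hl Ha]. inversion H' as [|? ? Hl' Hb]. subst.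
    rewrite Forall_forall in Ha, Hb.
    assert (a = b).
    { destruct (proj1 (E a) (or_introl eq_refl)) as [|I1]; auto.
      destruct (proj2 (E b) (or_introl eq_refl)) as [|I2]; auto. apply Ha in I2. apply Hb in I1. lra. }
    subst b. f_equal. apply IH; auto. intros x. split; intros Hx.
    + destruct (proj1 (E x) (or_intror Hx)); auto. subst. apply Ha in Hx. lra.
    + destruct (proj2 (E x) (or_intror Hx)); auto. subst. apply Hb in Hx. lra.
Qed.

Lemma increasing_enum_eq (S : R -> Prop) l :
  StronglySorted Rlt l -> (forall x, In x l <-> S x) -> increasing_enum S = l.
Proof.
  intros Hl HS. unfold increasing_enum.
  assert (E : exists l, StronglySorted Rlt l /\ forall x, In x l <-> S x) by eauto.
  apply (epsilon_spec (inhabits nil)) in E. destruct E as [H1 H2].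
  apply sorted_unique; auto. intros x. now rewrite H2, HS.
Qed.

Lemma sorted_insert l a : StronglySorted Rlt l ->
  exists l', StronglySorted Rlt l' /\ forall x, In x l' <-> x = a \/ In x l.
Proof.
  induction l as [|b l IH]; intros H.
  - exists (a :: nil). split. repeat constructor. intros x; simpl; intuition.
  - inversion H as [|? ? Hl Hb]; subst. rewrite Forall_forall in Hb.
    destruct (Rtotal_order a b) as [L|[->|L]].
    + exists (a :: b :: l). split. constructor; auto. constructor; auto.
      apply Forall_forall. intros x Hx. apply Hb in Hx. lra. intros x; simpl; intuition.
    + exists (b :: l). split; auto. intros x; simpl; intuition.
    + destruct (IH Hl) as [l' [S' E']]. exists (b :: l'). split.
      * constructor; auto. apply Forall_forall. intros x Hx. apply E' in Hx.
        destruct Hx as [->|Hx]; auto.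
      * intros x; simpl. rewrite E'. intuition.
Qed.

Lemma sorted_of_finite l (S : R -> Prop) : (forall x, S x -> In x l) ->
  exists l', StronglySorted Rlt l' /\ forall x, In x l' <-> S x.
Proof.
  revert S. induction l as [|a l IH]; intros S H.
  - exists nil. split. constructor. intros x; split; [intros []|apply H].
  - destruct (IH (fun x => S x /\ x <> a)) as [l' [S' E']].
    { intros x [Hx Hn]. apply H in Hx. destruct Hx; auto. now subst. }
    destruct (classic (S a)) as [Ha|Ha].
    + destruct (sorted_insert l' a S') as [l'' [S'' E'']]. exists l''. split; auto.
      intros x. rewrite E'', E'. split. intros [->|[]]; auto. intros Hx.
      destruct (Req_dec x a); auto.
    + exists l'. split; auto. intros x. rewrite E'. split. tauto. intros Hx. split; auto.
      intros ->. auto.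
Qed.

Definition isolated (S : R -> Prop) : Prop := forall t, locally t (fun u => u <> t -> ~ S u).

(** By compactness finitely many windows, each meeting [S] at most in its
    centre, cover the segment [a <= x <= b]; the centres contain all of [S]. *)
Lemma isolated_finite S a b : isolated S ->
  exists l, StronglySorted Rlt l /\ forall x, In x l <-> a <= x <= b /\ S x.
Proof.
  intros HS.
  assert (D : forall t, exists d : posreal, forall u, Rabs (u - t) < d -> u <> t -> ~ S u).
  { intros t. destruct (HS t) as [d Hd]. exists d. intros u Hu. now apply Hd. }
  pose (delta := fun x : Compactness.Tn 1 R =>
    proj1_sig (constructive_indefinite_description _ (D (fst x)))).
  assert (C := compactness_list 1 (a, tt) (b, tt) delta). apply NNPP in C.
  destruct C as [l Hl]. apply (sorted_of_finite (map fst l)).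
  intros x [Hx Sx]. destruct (Hl (x, tt)) as [[t []] [I [_ [Hd _]]]]. split; simpl; auto.
  apply in_map_iff. exists (t, tt). split; auto. simpl. unfold delta in Hd.
  destruct constructive_indefinite_description as [d Hd']. simpl in Hd, Hd'.
  destruct (Req_dec x t); auto. now apply Hd' in Sx.
Qed.

(** * Periodic enumerations *)

Definition advancing (a : Z -> R) (N : Z) : Prop :=
  (0 < N)%Z /\ (forall i, a i < a (i + 1)%Z) /\ (forall i, a (i + N)%Z = a i + 2 * PI).

(** Periodic discrete subsets of the line are listed by the integers, which
    turns the cyclic order on the circle into the order of indices. *)
Definition enumerates (a : Z -> R) (N : Z) (S : R -> Prop) : Prop :=
  advancing a N /\ forall t, S t <-> exists i, a i = t.

Section Advancing.
Variables (a : Z -> R) (N : Z).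
Hypothesis Ha : advancing a N.

Lemma advancing_lt i j : (i < j)%Z -> a i < a j.
Proof.
  intros H. destruct Ha as [_ [Hi _]].
  assert (K : forall n : nat, a i < a (i + Z.of_nat n + 1)%Z).
  { induction n. simpl. replace (i + 0)%Z with i by lia. apply Hi.
    eapply Rlt_trans; [exact IHn|]. replace (i + Z.of_nat (S n))%Z with (i + Z.of_nat n + 1)%Z by lia. apply Hi. }
  specialize (K (Z.to_nat (j - i - 1))). rewrite Z2Nat.id in K by lia.
  now replace (i + (j - i - 1) + 1)%Z with j in K by lia.
Qed.

Lemma advancing_le i j : (i <= j)%Z -> a i <= a j.
Proof. intros H. destruct (Z.eq_dec i j) as [->|]; [lra|]. left. apply advancing_lt; lia. Qed.

Lemma advancing_lt_inv i j : a i < a j -> (i < j)%Z.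
Proof. intros H. destruct (Z_lt_le_dec i j); auto. apply advancing_le in l. lra. Qed.

Lemma advancing_inj i j : a i = a j -> i = j.
Proof.
  intros H. destruct (Z.lt_total i j) as [L|[L|L]]; auto; apply advancing_lt in L; lra.
Qed.

Lemma advancing_gap i j t : a i < t < a (i + 1)%Z -> a j <> t.
Proof.
  intros [H1 H2] <-. apply advancing_lt_inv in H1. apply advancing_lt_inv in H2. lia.
Qed.

Lemma advancing_shift i k : a (i + N * k)%Z = a i + IZR k * (2 * PI).
Proof.
  destruct Ha as [_ [_ Hp]].
  apply (Z.bi_induction (fun k => a (i + N * k)%Z = a i + IZR k * (2 * PI))).
  - intros x y ->; tauto.
  - rewrite Z.mul_0_r, Z.add_0_r. ring.
  - intros j. replace (i + N * Z.succ j)%Z with (i + N * j + N)%Z by ring. rewrite Hp, succ_IZR. lra.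
Qed.

Lemma advancing_locate t : exists i, a i <= t < a (i + 1)%Z.
Proof.
  assert (K : forall (n : nat) i, a i <= t -> t < a (i + Z.of_nat n)%Z -> exists i, a i <= t < a (i + 1)%Z).
  { induction n; intros i H1 H2. replace (i + Z.of_nat 0)%Z with i in H2 by lia. lra.
    destruct (Rlt_le_dec t (a (i + 1)%Z)). now exists i.
    apply (IHn (i + 1)%Z); auto. now replace (i + 1 + Z.of_nat n)%Z with (i + Z.of_nat (S n))%Z by lia. }
  destruct (representative (t - a 0%Z)) as [k Hk]. 
  apply (K (Z.to_nat N) (0 + N * (- k))%Z); destruct Ha as [HN [_ Hp]].
  - rewrite advancing_shift, opp_IZR. lra.
  - rewrite Z2Nat.id by lia. rewrite Hp, advancing_shift, opp_IZR. lra.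
Qed.

Lemma advancing_origin : exists c, 0 <= a c /\ a (c - 1)%Z < 0.
Proof.
  destruct (advancing_locate 0) as [i [H1 H2]]. destruct (Req_dec (a i) 0).
  - exists i. split. lra. rewrite <- H. apply advancing_lt. lia.
  - exists (i + 1)%Z. split. lra. replace (i + 1 - 1)%Z with i by lia. lra.
Qed.

Lemma advancing_fundamental c i : 0 <= a c -> a (c - 1)%Z < 0 ->
  (0 <= a (c + i)%Z < 2 * PI <-> (0 <= i < N)%Z).
Proof.
  intros H1 H2. destruct Ha as [HN [_ Hp]]. split.
  - intros [H3 H4]. assert (c - 1 < c + i)%Z by (apply advancing_lt_inv; lra).
    assert (c + i < c + N)%Z by (apply advancing_lt_inv; rewrite Hp; lra). lia.
  - intros [H3 H4]. split. apply Rle_trans with (a c); auto. apply advancing_le; lia.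
    apply Rle_lt_trans with (a (c - 1 + N)%Z). apply advancing_le; lia. rewrite Hp. lra.
Qed.

Definition period_list (c : Z) : list R := map (fun k => a (c + Z.of_nat k)%Z) (seq 0 (Z.to_nat N)).

Lemma period_list_sorted c : StronglySorted Rlt (period_list c).
Proof.
  unfold period_list. generalize 0%nat as k. induction (Z.to_nat N); intros k; simpl; constructor; auto.
  apply Forall_forall. intros x Hx. apply in_map_iff in Hx. destruct Hx as [j [<- Hj]].
  apply in_seq in Hj. apply advancing_lt. lia.
Qed.

Lemma period_list_spec S c : (forall t, S t <-> exists i, a i = t) -> 0 <= a c -> a (c - 1)%Z < 0 ->
  forall x, In x (period_list c) <-> 0 <= x < 2 * PI /\ S x.
Proof.
  intros HS H1 H2 x. unfold period_list. rewrite in_map_iff. destruct Ha as [HN _]. split.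
  - intros [k [<- Hk]]. apply in_seq in Hk. split; [|apply HS; eauto].
    apply advancing_fundamental; auto. lia.
  - intros [Hx Sx]. apply HS in Sx. destruct Sx as [i <-].
    replace i with (c + (i - c))%Z in * by lia. apply advancing_fundamental in Hx; auto.
    exists (Z.to_nat (i - c)). rewrite Z2Nat.id by lia. split; auto. apply in_seq. lia.
Qed.

End Advancing.

Arguments advancing_lt {a N}.
Arguments advancing_le {a N}.
Arguments advancing_lt_inv {a N}.
Arguments advancing_inj {a N}.
Arguments advancing_gap {a N}.
Arguments advancing_shift {a N}.
Arguments advancing_locate {a N}.
Arguments advancing_origin {a N}.
Arguments advancing_fundamental {a N}.
Arguments period_list_sorted {a N}.
Arguments period_list_spec {a N}.

Lemma sorted_NoDup l : StronglySorted Rlt l -> NoDup l.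
Proof.
  induction 1 as [|x l Hl IH Hx]; constructor; auto. rewrite Forall_forall in Hx.
  intros I. apply Hx in I. lra.
Qed.

Lemma card_enumerated a N S (Q : S1 -> Prop) :
  enumerates a N S -> (forall t, Q (P t) <-> S t) -> card Q = Z.to_nat N.
Proof.
  intros [Ha HS] HQ. destruct (advancing_origin Ha) as [c [H1 H2]].
  pose proof (period_list_spec Ha S c HS H1 H2) as L.
  rewrite (card_eq Q (map P (period_list a N c))).
  - unfold period_list. now rewrite !length_map, length_seq.
  - apply NoDup_map_NoDup_ForallPairs.
    + intros x y Hx Hy. apply L in Hx. apply L in Hy. apply same_representative; tauto.
    + apply sorted_NoDup, period_list_sorted; auto.
  - intros x. rewrite in_map_iff. split.
    + intros [t [<- Ht]]. apply HQ. now apply L in Ht.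
    + intros Hx. exists (angle x). rewrite P_angle. split; auto. apply L.
      split. apply angle_range. apply HQ. now rewrite P_angle.
Qed.

Lemma sorted_nth l i j : StronglySorted Rlt l -> (i < j < length l)%nat -> nth i l 0 < nth j l 0.
Proof.
  intros H. revert i j. induction H as [|x l Hl IH Hx]; intros i j Hij; simpl in *. lia.
  rewrite Forall_forall in Hx. destruct j as [|j]. lia. destruct i as [|i].
  - apply Hx, nth_In. lia.
  - apply IH. lia.
Qed.

(** The sorted points of one period, repeated with the period [2 PI]. *)
Lemma enumeration_exists (S : R -> Prop) :
  (forall t, S (t + 2 * PI) <-> S t) -> isolated S -> (exists t, S t) ->
  exists a N, enumerates a N S.
Proof.
  intros Hper Hiso [t0 Ht0]. pose proof two_PI_pos.
  assert (HperZ := periodic_Z S Hper).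
  assert (L : exists l, StronglySorted Rlt l /\ forall x, In x l <-> 0 <= x < 2 * PI /\ S x).
  { destruct (isolated_finite S 0 (2 * PI) Hiso) as [l [_ Hl]]. apply (sorted_of_finite l).
    intros x [Hx Sx]. apply Hl. split; auto. lra. }
  destruct L as [l [Sl Hl]].
  destruct (representative t0) as [k0 Hk0].
  assert (Hlen : (0 < length l)%nat).
  { assert (I : In (t0 + IZR k0 * (2 * PI)) l) by (apply Hl; split; auto; now apply HperZ).
    destruct l; simpl in *; [tauto|lia]. }
  pose (N := Z.of_nat (length l)).
  pose (a := fun i : Z => nth (Z.to_nat (i mod N)) l 0 + IZR (i / N) * (2 * PI)).
  assert (HN : (0 < N)%Z) by (unfold N; lia).
  assert (In_nth' : forall i, (0 <= i < N)%Z -> 0 <= nth (Z.to_nat i) l 0 < 2 * PI /\ S (nth (Z.to_nat i) l 0)).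
  { intros i Hi. apply Hl, nth_In. unfold N in Hi. lia. }
  assert (Ea : forall q r, (0 <= r < N)%Z -> a (N * q + r)%Z = nth (Z.to_nat r) l 0 + IZR q * (2 * PI)).
  { intros q r Hr. unfold a. replace ((N * q + r) / N)%Z with q by (apply (Z.div_unique _ _ _ r); lia).
    now replace ((N * q + r) mod N)%Z with r by (apply (Z.mod_unique _ _ q r); lia). }
  exists a, N. split; [split; [|split]|]; auto.
  - intros i. rewrite (Z.div_mod i N) by lia. pose proof (Z.mod_pos_bound i N HN) as B.
    set (q := (i / N)%Z) in *. set (r := (i mod N)%Z) in *. rewrite Ea by auto.
    destruct (Z_lt_le_dec (r + 1) N).
    + rewrite <- Z.add_assoc, Ea by lia. apply Rplus_lt_compat_r, sorted_nth; auto.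
      unfold N in *. lia.
    + replace (N * q + r + 1)%Z with (N * (q + 1) + 0)%Z by lia. rewrite Ea by lia.
      destruct (In_nth' r B) as [B1 _]. destruct (In_nth' 0%Z) as [B2 _]. lia.
      rewrite plus_IZR. lra.
  - intros i. rewrite (Z.div_mod i N) by lia. pose proof (Z.mod_pos_bound i N HN) as B.
    set (q := (i / N)%Z) in *. set (r := (i mod N)%Z) in *.
    replace (N * q + r + N)%Z with (N * (q + 1) + r)%Z by lia. rewrite !Ea by lia.
    rewrite plus_IZR. ring.
  - intros t. split.
    + intros Ht. destruct (representative t) as [k Hk].
      assert (I : In (t + IZR k * (2 * PI)) l) by (apply Hl; split; auto; now apply HperZ).
      destruct (In_nth _ _ 0 I) as [n [Hn En]]. exists (N * - k + Z.of_nat n)%Z.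
      rewrite Ea by (unfold N; lia). rewrite Nat2Z.id, En, opp_IZR. ring.
    + intros [i <-]. unfold a. apply HperZ, In_nth'. apply Z.mod_pos_bound; lia.
Qed.

(** Successors and predecessors are determined by the order of [S], so a match
    of the origins propagates to all indices. *)
Lemma enumeration_unique a N b M S : enumerates a N S -> enumerates b M S ->
  N = M /\ exists c, forall i, b i = a (i + c)%Z.
Proof.
  intros [Ha Sa] [Hb Sb].
  destruct (proj1 (Sa (b 0%Z)) (proj2 (Sb _) (ex_intro _ 0%Z eq_refl))) as [c Hc].
  assert (E1 : forall i, b i = a (i + c)%Z -> b (i + 1)%Z = a (i + 1 + c)%Z).
  { intros i Hi.
    destruct (proj1 (Sa (b (i + 1)%Z)) (proj2 (Sb _) (ex_intro _ (i + 1)%Z eq_refl))) as [j Hj].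
    destruct (proj1 (Sb (a (i + 1 + c)%Z)) (proj2 (Sa _) (ex_intro _ (i + 1 + c)%Z eq_refl))) as [k Hk].
    assert (i + c < j)%Z by (apply (advancing_lt_inv Ha); rewrite Hj, <- Hi; apply Hb).
    assert (i < k)%Z. { apply (advancing_lt_inv Hb). rewrite Hk, Hi. apply (advancing_lt Ha). lia. }
    assert (b (i + 1)%Z <= b k) by (apply (advancing_le Hb); lia).
    assert (a (i + 1 + c)%Z <= a j) by (apply (advancing_le Ha); lia). lra. }
  assert (E2 : forall i, b (i + 1)%Z = a (i + 1 + c)%Z -> b i = a (i + c)%Z).
  { intros i Hi.
    destruct (proj1 (Sa (b i)) (proj2 (Sb _) (ex_intro _ i eq_refl))) as [j Hj].
    destruct (proj1 (Sb (a (i + c)%Z)) (proj2 (Sa _) (ex_intro _ (i + c)%Z eq_refl))) as [k Hk].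
    assert (j < i + 1 + c)%Z by (apply (advancing_lt_inv Ha); rewrite Hj, <- Hi; apply Hb).
    assert (k < i + 1)%Z. { apply (advancing_lt_inv Hb). rewrite Hk, Hi. apply (advancing_lt Ha). lia. }
    assert (b k <= b i) by (apply (advancing_le Hb); lia).
    assert (a j <= a (i + c)%Z) by (apply (advancing_le Ha); lia). lra. }
  assert (E : forall i, b i = a (i + c)%Z).
  { assert (E0 : b 0%Z = a (0 + c)%Z) by (rewrite Z.add_0_l; auto).
    intros i. apply (Z.bi_induction (fun i => b i = a (i + c)%Z)); auto.
    - intros x y ->; tauto.
    - intros j. split. intros H. apply E1 in H. now rewrite <- Z.add_1_r.
      intros H. apply E2. now rewrite Z.add_1_r. }
  split; [|now exists c].
  apply (Z.add_cancel_l _ _ c), (advancing_inj Ha).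
  destruct Ha as [_ [_ Pa]], Hb as [_ [_ Pb]]. rewrite Pa.
  replace (c + M)%Z with (0 + M + c)%Z by lia. rewrite <- E, Pb, <- Hc. ring.
Qed.

(** * Equivariant interpolation *)

Lemma RInt_Rplus F G a b : smooth1 F -> smooth1 G ->
  RInt (fun t => F t + G t) a b = RInt F a b + RInt G a b.
Proof. intros HF HG. apply (@RInt_plus R_CompleteNormedModule F G a b); now apply ex_RInt_smooth. Qed.

Lemma RInt_Rscal F c a b : smooth1 F -> RInt (fun t => c * F t) a b = c * RInt F a b.
Proof. intros HF. apply (@RInt_scal R_CompleteNormedModule F a b c). now apply ex_RInt_smooth. Qed.

Lemma RInt_Rchasles F a b c : smooth1 F -> RInt F a b + RInt F b c = RInt F a c.
Proof. intros HF. apply (@RInt_Chasles R_CompleteNormedModule F a b c); now apply ex_RInt_smooth. Qed.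

Lemma RInt_Rconst c a b : RInt (fun _ => c) a b = c * (b - a).
Proof. rewrite RInt_const. apply Rmult_comm. Qed.

Lemma RInt_vanish F a b : a <= b -> (forall t, a < t < b -> F t = 0) -> RInt F a b = 0.
Proof.
  intros Hab H. rewrite (RInt_ext F (fun _ => 0)).
  - rewrite RInt_Rconst. apply Rmult_0_l.
  - intros t. rewrite Rmin_left, Rmax_right by lra. apply H.
Qed.

Definition bump (lo hi t : R) : R := flat 0 (cos (t - (lo + hi) / 2) - cos ((hi - lo) / 2)).

Lemma smooth1_bump lo hi : smooth1 (bump lo hi).
Proof.
  apply (smooth1_comp (flat 0) (fun t => cos (t - (lo + hi) / 2) - cos ((hi - lo) / 2))). apply smooth1_flat.
  apply smooth1_minus; [|apply smooth1_const]. apply (smooth1_comp cos (fun t => t - (lo + hi) / 2)). apply smooth1_cos.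
  apply smooth1_minus; [apply smooth1_id|apply smooth1_const].
Qed.

Lemma bump_period lo hi t : bump lo hi (t + 2 * PI) = bump lo hi t.
Proof.
  unfold bump. replace (t + 2 * PI - (lo + hi) / 2) with (t - (lo + hi) / 2 + IZR 1 * (2 * PI)) by (simpl; ring).
  now destruct (cos_sin_period (t - (lo + hi) / 2) 1) as [-> _].
Qed.

(** This trigonometric polynomial changes sign exactly at the two ends of an
    arc, so a flat function of it is a bump that is periodic from the start. *)
Lemma cos_arc_pos lo hi t : hi <= lo + 2 * PI -> lo < t < hi ->
  0 < cos (t - (lo + hi) / 2) - cos ((hi - lo) / 2).
Proof.
  intros H Ht. pose proof PI_RGT_0.
  assert (cos ((hi - lo) / 2) < cos (t - (lo + hi) / 2)); [|lra].
  destruct (Rle_lt_dec 0 (t - (lo + hi) / 2)).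
  - apply cos_decreasing_1; lra.
  - rewrite <- cos_neg with (t - (lo + hi) / 2). apply cos_decreasing_1; lra.
Qed.

Lemma cos_arc_neg lo hi t : lo < hi -> hi < t < lo + 2 * PI ->
  cos (t - (lo + hi) / 2) - cos ((hi - lo) / 2) < 0.
Proof.
  intros H Ht. pose proof PI_RGT_0.
  assert (cos (t - (lo + hi) / 2) < cos ((hi - lo) / 2)); [|lra].
  destruct (Rle_lt_dec (t - (lo + hi) / 2) PI).
  - apply cos_decreasing_1; lra.
  - rewrite <- cos_neg with (t - (lo + hi) / 2).
    replace (cos (- (t - (lo + hi) / 2))) with (cos (2 * PI - (t - (lo + hi) / 2))).
    + apply cos_decreasing_1; lra.
    + replace (2 * PI - (t - (lo + hi) / 2)) with (- (t - (lo + hi) / 2) + IZR 1 * (2 * PI)) by (simpl; ring).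
      now destruct (cos_sin_period (- (t - (lo + hi) / 2)) 1) as [-> _].
Qed.

Lemma bump_pos lo hi t : hi <= lo + 2 * PI -> lo < t < hi -> 0 < bump lo hi t.
Proof. intros H Ht. apply flat_pos. now apply cos_arc_pos. Qed.

Lemma bump_0 lo hi t : lo < hi -> hi < t < lo + 2 * PI -> bump lo hi t = 0.
Proof. intros H Ht. apply flat_0. left. now apply cos_arc_neg. Qed.

Lemma common_scale (x y : nat -> R) n : (forall i, (i < n)%nat -> 0 < x i /\ 0 < y i) ->
  exists d, 0 < d /\ forall i, (i < n)%nat -> d * x i <= y i.
Proof.
  induction n; intros H. exists 1. split. lra. lia.
  destruct IHn as [d [Hd Hi]]. intros; apply H; lia.
  destruct (H n) as [Hx Hy]; auto.
  exists (Rmin d (y n / x n)). split. apply Rmin_glb_lt; auto. now apply Rdiv_lt_0_compat.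
  intros i Hi'. destruct (Nat.eq_dec i n) as [->|].
  - apply Rle_trans with (y n / x n * x n). apply Rmult_le_compat_r; [lra|apply Rmin_r].
    right. field. lra.
  - apply Rle_trans with (d * x i); [|apply Hi; lia]. apply Rmult_le_compat_r; [|apply Rmin_l].
    left. apply H. lia.
Qed.

(** The derivative of the interpolating map is a small constant plus one bump
    per gap of [a], scaled to give the prescribed increment over that gap. *)
Lemma interpolation a b N : advancing a N -> advancing b N ->
  exists K, ldiff 1 K /\ forall i, K (a i) = b i.
Proof.
  intros Ha Hb. pose proof two_PI_pos.
  pose (n := Z.to_nat N). pose (ga := fun i : nat => a (Z.of_nat i + 1)%Z - a (Z.of_nat i)).
  pose (gb := fun i : nat => b (Z.of_nat i + 1)%Z - b (Z.of_nat i)).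
  pose proof Ha as Ha0. pose proof Hb as Hb0.
  destruct Ha0 as [HN [Ia Pa]]. destruct Hb0 as [_ [Ib Pb]].
  destruct (common_scale ga gb n) as [d [Hd Hg]].
  { intros i _. unfold ga, gb. specialize (Ia (Z.of_nat i)). specialize (Ib (Z.of_nat i)). lra. }
  assert (Arc : forall i, a (i + 1)%Z <= a i + 2 * PI).
  { intros i. rewrite <- Pa. apply (advancing_le Ha). lia. }
  assert (Step : forall m, (m <= n)%nat -> exists rho, smooth1 rho /\ (forall t, rho (t + 2 * PI) = rho t) /\
     (forall t, 0 < rho t) /\ forall i, (i < n)%nat ->
       RInt rho (a (Z.of_nat i)) (a (Z.of_nat i + 1)%Z) = if (i <? m)%nat then gb i else d * ga i).
  { induction m; intros Hm.
    - exists (fun _ => d). split; [apply smooth1_const|]. repeat split; auto.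
      intros i Hi. simpl. apply RInt_Rconst.
    - destruct IHm as [rho [S1 [P1 [Q1 I1]]]]. lia.
      set (lo := a (Z.of_nat m)). set (hi := a (Z.of_nat m + 1)%Z).
      assert (Hlh : lo < hi) by apply Ia.
      assert (HB : 0 < RInt (bump lo hi) lo hi).
      { apply RInt_gt_0; auto. intros; apply bump_pos; auto. apply Arc.
        intros. apply continuity_pt_filterlim, smooth1_continuity, smooth1_bump. }
      pose (c := (gb m - d * ga m) / RInt (bump lo hi) lo hi).
      assert (Hc : 0 <= c).
      { apply Rdiv_le_0_compat; auto. specialize (Hg m ltac:(lia)). lra. }
      assert (Sc : smooth1 (fun t => c * bump lo hi t)).
      { apply smooth1_mult. apply smooth1_const. apply smooth1_bump. }
      exists (fun t => rho t + c * bump lo hi t). split; [now apply smooth1_plus|]. split; [|split].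
      + intros t. now rewrite P1, bump_period.
      + intros t. specialize (Q1 t). pose proof (flat_nonneg 0 (cos (t - (lo + hi) / 2) - cos ((hi - lo) / 2))) as Q.
        change (0 <= bump lo hi t) in Q. nra.
      + intros i Hi. rewrite RInt_Rplus, RInt_Rscal, I1 by (auto; apply smooth1_bump).
        destruct (Nat.eq_dec i m) as [->|Hn].
        * rewrite Nat.ltb_irrefl. destruct (Nat.ltb_spec m (S m)); [|lia]. fold lo hi. unfold c.
          change (d * ga m + (gb m - d * ga m) / RInt (bump lo hi) lo hi * RInt (bump lo hi) lo hi = gb m).
          field. lra.
        * replace (i <? S m)%nat with (i <? m)%nat
            by (destruct (Nat.ltb_spec i m), (Nat.ltb_spec i (S m)); auto; lia).
          (* the other gaps avoid the arc [lo, hi] modulo the period *)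
          rewrite (RInt_vanish (bump lo hi)). rewrite Rmult_0_r. apply Rplus_0_r. left; apply Ia.
          intros t Ht. destruct (lt_dec m i).
          -- apply bump_0; auto. split.
             ++ apply Rle_lt_trans with (a (Z.of_nat i)); [|lra]. apply (advancing_le Ha). lia.
             ++ apply Rlt_le_trans with (a (Z.of_nat i + 1)%Z); [lra|]. unfold lo. rewrite <- Pa.
                apply (advancing_le Ha). unfold n in *. lia.
          -- rewrite <- bump_period. apply bump_0; auto. split.
             ++ apply Rle_lt_trans with (a (Z.of_nat i + N)%Z); [|rewrite Pa; lra].
                apply (advancing_le Ha). unfold n in *. lia.
             ++ apply Rplus_lt_compat_r. apply Rlt_le_trans with (a (Z.of_nat i + 1)%Z); [lra|].
                apply (advancing_le Ha). lia. }
  destruct (Step n (Nat.le_refl n)) as [rho [Sr [Pr [Qr Ir]]]]. clear Step.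
  pose (K := fun t => b 0%Z + RInt rho (a 0%Z) t).
  assert (DK : forall t, is_derive K t (rho t)).
  { intros t. eapply is_derive_eq. apply is_derive_Rplus. apply is_derive_Rconst.
    now apply is_derive_primitive. ring. }
  assert (Kn : forall i : nat, (i <= n)%nat -> K (a (Z.of_nat i)) = b (Z.of_nat i)).
  { induction i; intros Hi. unfold K. simpl Z.of_nat. rewrite primitive_at_base. ring.
    unfold K. rewrite <- (RInt_Rchasles rho _ (a (Z.of_nat i))) by auto.
    rewrite Nat2Z.inj_succ, <- Z.add_1_r, Ir by lia. destruct (Nat.ltb_spec i n); [|lia].
    rewrite <- Rplus_assoc. change (K (a (Z.of_nat i)) + gb i = b (Z.of_nat i + 1)%Z).
    rewrite IHi by lia. unfold gb. ring. }
  assert (EK : equivariant K 1).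
  { intros t.
    assert (C : K (t + 2 * PI) - K t = K (a 0%Z + 2 * PI) - K (a 0%Z)).
    { apply (constant_of_derive0 (fun t => K (t + 2 * PI) - K t)). intros u. eapply is_derive_eq.
      apply is_derive_Rminus. apply (is_derive_Rcomp K (fun t => t + 2 * PI)). apply DK.
      apply is_derive_Rplus. apply is_derive_Rid. apply is_derive_Rconst. apply DK. rewrite Pr. ring. }
    rewrite <- Pa in C. rewrite Z.add_0_l in C.
    pose proof (Kn n (Nat.le_refl n)) as E1. unfold n in E1. rewrite Z2Nat.id in E1 by lia.
    pose proof (Kn 0%nat ltac:(lia)) as E2. simpl in E2. rewrite E1, E2 in C.
    pose proof (Pb 0%Z) as E3. rewrite Z.add_0_l in E3. simpl. lra. }
  exists K. split; [split; [|split; [|split]]|]; auto.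
  - now apply smooth1_of_derivative with rho.
  - intros t. rewrite (is_derive_unique _ _ _ (DK t)). specialize (Qr t). simpl. lra.
  - intros i. rewrite (Z.div_mod i N) by lia. pose proof (Z.mod_pos_bound i N HN) as B.
    rewrite Z.add_comm, (advancing_shift Ha), (advancing_shift Hb), (equivariant_Z K 1) by auto.
    rewrite <- (Z2Nat.id (i mod N)) by lia. rewrite Kn by (unfold n; lia). now rewrite Z.mul_1_l.
Qed.

(** * Itineraries *)

Definition critical_value (F : R -> R) (y : R) : Prop := exists c, Derive F c = 0 /\ P (F c) = P y.

Definition critical_fibre (F : R -> R) (t : R) : Prop := critical_value F (F t).

(** The combinatorics of a Morse lift [F]. Seen on the indices of the critical
    values [v], the map becomes a walk [w], whose turns are the letters [s] of
    the cyclic word. *)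
Record itinerary (F : R -> R) (d N M : Z) (a v : Z -> R) (w : Z -> Z) : Prop := {
  it_smooth : smooth1 F;
  it_equivariant : equivariant F d;
  it_source : advancing a N;
  it_target : advancing v M;
  it_value : forall i, F (a i) = v (w i);
  it_step : forall i, (w (i + 1) - w i = 1 \/ w (i + 1) - w i = -1)%Z;
  it_monotone : forall i t, a i < t < a (i + 1)%Z -> 0 < IZR (w (i + 1) - w i)%Z * Derive F t;
  it_morse : forall i, Derive F (a i) = 0 -> Derive (Derive F) (a i) <> 0;
  it_turn : forall i, Derive F (a i) = 0 <-> (w (i + 1) - w i = - (w i - w (i - 1)))%Z
}.
Arguments it_smooth {F d N M a v w}.
Arguments it_equivariant {F d N M a v w}.
Arguments it_source {F d N M a v w}.
Arguments it_target {F d N M a v w}.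
Arguments it_value {F d N M a v w}.
Arguments it_step {F d N M a v w}.
Arguments it_monotone {F d N M a v w}.
Arguments it_morse {F d N M a v w}.
Arguments it_turn {F d N M a v w}.

Lemma is_derive_locally_injective (F : R -> R) (t l : R) :
  is_derive F t l -> l <> 0 -> locally t (fun u => u <> t -> F u <> F t).
Proof.
  intros D Hl. apply caratheodory in D. destruct D as [q [Cq [Eq HF]]]. subst l.
  generalize (continuous_neq q t 0 Cq Hl). apply filter_imp. intros u Hu Hn E.
  specialize (HF u). rewrite E in HF. assert (Z0 : (u - t) * q u = 0) by lra.
  apply Rmult_integral in Z0. destruct Z0; [lra|auto].
Qed.

Lemma locally_forall_in {X : Type} (l : list X) (Q : X -> R -> Prop) t :
  (forall x, In x l -> locally t (Q x)) -> locally t (fun u => forall x, In x l -> Q x u).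
Proof.
  induction l as [|x l IH]; intros H.
  - apply filter_forall. intros u y [].
  - generalize (filter_and _ _ (H x (or_introl eq_refl)) (IH (fun y Hy => H y (or_intror Hy)))).
    apply filter_imp. intros u [H1 H2] y [<-|Hy]; auto.
Qed.

Lemma isolated_congruent z : isolated (fun u => P u = P z).
Proof.
  intros t. pose proof two_PI_pos as TP. destruct (classic (P t = P z)) as [E|E].
  - apply (locally_of_window t (2 * PI)); auto. intros u Hu Hn E'. rewrite <- E in E'. symmetry in E'.
    apply P_eq_iff in E'. destruct E' as [k Hk].
    assert (-1 < k < 1)%Z. { split; apply lt_IZR; simpl; nra. }
    replace k with 0%Z in Hk by lia. lra.
  - assert (L : locally t (fun u => cos (u - z) <> 1)).
    { apply continuous_neq.
      apply (smooth1_continuous (fun u => cos (u - z))). apply (smooth1_comp cos (fun u => u - z)). apply smooth1_cos.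
      apply smooth1_minus; [apply smooth1_id|apply smooth1_const].
      intros C. apply cos_1_period in C. destruct C as [k Hk]. apply E. symmetry. apply P_eq_iff.
      exists k. lra. }
    revert L. apply filter_imp. intros u Hu _ E'. apply Hu. symmetry in E'. apply P_eq_iff in E'.
    destruct E' as [k Hk]. replace (u - z) with (0 + IZR k * (2 * PI)) by lra.
    destruct (cos_sin_period 0 k) as [-> _]. apply cos_0.
Qed.

Section Isolation.
Variables (F : R -> R) (d : Z).
Hypotheses (SF : smooth1 F) (EF : equivariant F d).
Hypothesis morseF : forall t, Derive F t = 0 -> Derive (Derive F) t <> 0.

Lemma isolated_critical : isolated (fun t => Derive F t = 0).
Proof.
  intros t. destruct (Req_dec (Derive F t) 0) as [E|E].
  - assert (L := is_derive_locally_injective _ _ _ (smooth1_derive (Derive F) t (smooth1_Derive F SF)) (morseF t E)).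
    revert L. apply filter_imp. intros u Hu Hn. rewrite <- E. now apply Hu.
  - generalize (continuous_neq (Derive F) t 0 (smooth1_continuous _ t (smooth1_Derive F SF)) E).
    apply filter_imp. auto.
Qed.

(** Near a fold [F - F t] is plus or minus the square of a coordinate. *)
Lemma isolated_level t : locally t (fun u => u <> t -> F u <> F t).
Proof.
  destruct (Req_dec (Derive F t) 0) as [E|E].
  - destruct (morse F t SF E (morseF t E)) as [s [X [Hs [_ [_ [_ L]]]]]].
    revert L. apply filter_imp. intros u [E1 [H1 H2]] Hn E2.
    assert (X u <> 0). { destruct (Rdichotomy _ _ Hn) as [L|L]; [apply H1 in L|apply H2 in L]; lra. }
    assert (0 < X u * X u) by nra. destruct Hs as [-> | ->]; lra.
  - now apply is_derive_locally_injective with (Derive F t); [apply smooth1_derive|].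
Qed.

Lemma critical_representative c : Derive F c = 0 ->
  exists c', 0 <= c' <= 2 * PI /\ Derive F c' = 0 /\ P (F c') = P (F c).
Proof.
  intros Hc. destruct (representative c) as [k Hk]. exists (c + IZR k * (2 * PI)). split; [lra|].
  rewrite (Derive_period_Z F d), (equivariant_Z F d) by auto. split; auto. apply P_period.
Qed.

Lemma isolated_critical_value : isolated (critical_value F).
Proof.
  destruct (isolated_finite _ 0 (2 * PI) isolated_critical) as [l [_ Hl]].
  intros y. assert (L := locally_forall_in l (fun c u => u <> y -> P u <> P (F c)) y).
  assert (L' : locally y (fun u => forall c, In c l -> u <> y -> P u <> P (F c))).
  { apply L. intros c _. apply isolated_congruent. }
  revert L'. apply filter_imp. intros u Hu Hn [c [Hc E]].
  destruct (critical_representative c Hc) as [c' [H1 [H2 H3]]].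
  apply (Hu c'); auto. apply Hl; auto. congruence.
Qed.

Lemma isolated_critical_fibre : isolated (critical_fibre F).
Proof.
  intros t. assert (L := continuous_locally F t _ (smooth1_continuous F t SF) (isolated_critical_value (F t))).
  generalize (filter_and _ _ L (isolated_level t)). apply filter_imp. intros u [H1 H2] Hn. apply H1; auto.
Qed.

Lemma critical_value_period y : critical_value F (y + 2 * PI) <-> critical_value F y.
Proof.
  assert (E : P (y + 2 * PI) = P y).
  { replace (y + 2 * PI) with (y + IZR 1 * (2 * PI)) by (simpl; ring). apply P_period. }
  unfold critical_value. now rewrite E.
Qed.

Lemma critical_fibre_period t : critical_fibre F (t + 2 * PI) <-> critical_fibre F t.
Proof.
  unfold critical_fibre, critical_value. rewrite EF, P_period. tauto.
Qed.

(** By the intermediate value theorem no critical value separates the values at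
    consecutive points of the fibre, hence the unit steps. The walk turns where
    [F'] changes sign, that is at the simple zeros of [F']. *)
Lemma itinerary_exists a N v M :
  enumerates a N (critical_fibre F) -> enumerates v M (critical_value F) ->
  exists w, itinerary F d N M a v w.
Proof.
  intros [Ha Sa] [Hv Sv].
  assert (W : forall i, exists j, v j = F (a i)) by (intros i; apply Sv, Sa; eauto).
  pose (w := fun i => proj1_sig (constructive_indefinite_description _ (W i))).
  assert (Hw : forall i, v (w i) = F (a i)).
  { intros i. unfold w. now destruct constructive_indefinite_description. }
  assert (Ia : forall i, a i < a (i + 1)%Z) by apply Ha.
  assert (NF : forall i t, a i < t < a (i + 1)%Z -> ~ critical_fibre F t).
  { intros i t Ht C. apply Sa in C. destruct C as [j Hj]. now apply (advancing_gap Ha i j t) in Ht. }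
  assert (NC : forall i t, a i < t < a (i + 1)%Z -> Derive F t <> 0).
  { intros i t Ht C. apply (NF i t Ht). exists t. auto. }
  assert (CF : continuity F) by (now apply smooth1_continuity).
  assert (CD : continuity (Derive F)) by (now apply smooth1_continuity, smooth1_Derive).
  assert (St : forall i, exists s : Z, (s = 1 \/ s = -1)%Z /\ w (i + 1)%Z = (w i + s)%Z /\
             forall t, a i < t < a (i + 1)%Z -> 0 < IZR s * Derive F t).
  { intros i. destruct (constant_sign (Derive F) (a i) (a (i + 1)%Z) CD (NC i)) as [s [Hs Hp]].
    exists s. split; auto. split; auto.
    assert (M1 := strictly_monotone_on (IZR s) F (a i) (a (i + 1)%Z)
      (fun t => ex_intro _ _ (smooth1_derive F t SF)) Hp (a i) (a (i + 1)%Z)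
      ltac:(lra) (Ia i) ltac:(lra)).
    rewrite <- !Hw in M1.
    assert (G : forall j, ~ (Rmin (v (w i)) (v (w (i + 1)%Z)) < v j < Rmax (v (w i)) (v (w (i + 1)%Z)))).
    { intros j Hj. destruct (IVT_gen F (a i) (a (i + 1)%Z) (v j) CF) as [t [Ht1 Ht2]].
      rewrite <- !Hw. lra. pose proof (Ia i). rewrite Rmin_left, Rmax_right in Ht1 by lra.
      apply (NF i t).
      - split.
        + destruct (Req_dec t (a i)) as [E|]; [|lra]. rewrite E, <- Hw in Ht2. rewrite Ht2 in Hj.
          unfold Rmin, Rmax in Hj; repeat destruct Rle_dec in Hj; lra.
        + destruct (Req_dec t (a (i + 1)%Z)) as [E|]; [|lra]. rewrite E, <- Hw in Ht2. rewrite Ht2 in Hj.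
          unfold Rmin, Rmax in Hj; repeat destruct Rle_dec in Hj; lra.
      - apply Sv. exists j. auto. }
    destruct Hs as [-> | ->].
    - assert (L : (w i < w (i + 1))%Z) by (apply (advancing_lt_inv Hv); lra).
      destruct (Z.eq_dec (w (i + 1)%Z) (w i + 1)) as [|Hn]; auto. exfalso.
      apply (G (w i + 1)%Z). rewrite Rmin_left, Rmax_right by lra.
      split; apply (advancing_lt Hv); lia.
    - assert (L : (w (i + 1) < w i)%Z) by (apply (advancing_lt_inv Hv); lra).
      destruct (Z.eq_dec (w (i + 1)%Z) (w i + -1)) as [|Hn]; auto. exfalso.
      apply (G (w i - 1)%Z). rewrite Rmin_right, Rmax_left by lra.
      split; apply (advancing_lt Hv); lia. }
  assert (St1 : forall i, (w (i + 1) - w i = 1 \/ w (i + 1) - w i = -1)%Z).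
  { intros i. destruct (St i) as [s [Hs [E _]]]. rewrite E. replace (w i + s - w i)%Z with s by lia. auto. }
  assert (St2 : forall i t, a i < t < a (i + 1)%Z -> 0 < IZR (w (i + 1) - w i)%Z * Derive F t).
  { intros i t Ht. destruct (St i) as [s [Hs [E Hp]]]. rewrite E.
    replace (w i + s - w i)%Z with s by lia. auto. }
  assert (St3 : forall i t, a (i - 1)%Z < t < a i -> 0 < IZR (w i - w (i - 1))%Z * Derive F t).
  { intros i t Ht. replace i with (i - 1 + 1)%Z at 1 by lia. apply St2.
    now replace (i - 1 + 1)%Z with i by lia. }
  assert (Ia' : forall i, a (i - 1)%Z < a i).
  { intros i. specialize (Ia (i - 1)%Z). now replace (i - 1 + 1)%Z with i in Ia by lia. }
  assert (St1' : forall i, (w i - w (i - 1) = 1 \/ w i - w (i - 1) = -1)%Z).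
  { intros i. specialize (St1 (i - 1)%Z). now replace (i - 1 + 1)%Z with i in St1 by lia. }
  exists w. constructor; auto. intros i. specialize (St1 i). specialize (St1' i).
  assert (Near : forall Q, locally (a i) Q -> exists t u, a (i - 1)%Z < t < a i /\ a i < u < a (i + 1)%Z /\ Q t /\ Q u).
  { intros Q HQ. apply window_of_locally in HQ. destruct HQ as [e [He HQ]].
    specialize (Ia i). specialize (Ia' i).
    exists (a i - Rmin (e / 2) ((a i - a (i - 1)%Z) / 2)), (a i + Rmin (e / 2) ((a (i + 1)%Z - a i) / 2)).
    assert (0 < Rmin (e / 2) ((a i - a (i - 1)%Z) / 2)) by (apply Rmin_glb_lt; lra).
    assert (0 < Rmin (e / 2) ((a (i + 1)%Z - a i) / 2)) by (apply Rmin_glb_lt; lra).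
    pose proof (Rmin_l (e / 2) ((a i - a (i - 1)%Z) / 2)). pose proof (Rmin_r (e / 2) ((a i - a (i - 1)%Z) / 2)).
    pose proof (Rmin_l (e / 2) ((a (i + 1)%Z - a i) / 2)). pose proof (Rmin_r (e / 2) ((a (i + 1)%Z - a i) / 2)).
    repeat split; try lra; apply HQ; lra. }
  split.
  - intros Hc.
    (* [F'] has a simple zero at [a i], so it changes sign *)
    assert (D := smooth1_derive (Derive F) (a i) (smooth1_Derive F SF)).
    apply caratheodory in D. destruct D as [q [Cq [Eq HF]]]. rewrite Hc in HF.
    assert (Sq : exists s, s * q (a i) > 0).
    { exists (q (a i)). pose proof (morseF (a i) Hc). rewrite Eq. nra. }
    destruct Sq as [s Hs].
    assert (L : locally (a i) (fun u => 0 < s * q u)).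
    { apply (continuous_lt (fun u => s * q u)); auto. apply (continuous_scal_r s q). auto. }
    destruct (Near _ L) as [t [u [Ht [Hu [Qt Qu]]]]].
    pose proof (St3 i t Ht) as T1. pose proof (St2 i u Hu) as T2.
    specialize (HF t) as HFt. specialize (HF u) as HFu.
    replace (Derive F t) with ((t - a i) * q t) in T1 by lra.
    replace (Derive F u) with ((u - a i) * q u) in T2 by lra.
    destruct St1 as [E1|E1], St1' as [E2|E2]; rewrite E1 in *; rewrite E2 in *; try lia; exfalso.
    + assert (0 < q u) by nra. assert (q t < 0) by nra. nra.
    + assert (q u < 0) by nra. assert (0 < q t) by nra. nra.
  - intros E. destruct (Req_dec (Derive F (a i)) 0) as [|Hn]; auto. exfalso.
    assert (L : locally (a i) (fun u => 0 < Derive F (a i) * Derive F u)).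
    { apply (continuous_lt (fun u => Derive F (a i) * Derive F u)).
      apply (continuous_scal_r (Derive F (a i)) (Derive F)). now apply smooth1_continuous, smooth1_Derive. nra. }
    destruct (Near _ L) as [t [u [Ht [Hu [Qt Qu]]]]].
    pose proof (St3 i t Ht) as T1. pose proof (St2 i u Hu) as T2.
    destruct St1 as [E1|E1], St1' as [E2|E2]; rewrite E1 in *; rewrite E2 in *; try lia.
    + assert (0 < Derive F u) by lra. assert (Derive F t < 0) by lra. nra.
    + assert (Derive F u < 0) by lra. assert (0 < Derive F t) by lra. nra.
Qed.

End Isolation.

(** * Lifts with the same itinerary are equivalent *)

Lemma derive_nonneg_of_nondecreasing (H : R -> R) (t l : R) :
  (forall x y, x <= y -> H x <= H y) -> is_derive H t l -> 0 <= l.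
Proof.
  intros Hm D. apply caratheodory in D. destruct D as [q [Cq [<- HF]]].
  destruct (Rle_lt_dec 0 (q t)) as [|Hn]; auto. exfalso.
  assert (L : locally t (fun u => 0 < - q u)).
  { apply (continuous_lt (fun u => - q u)). apply (continuous_opp q). auto. lra. }
  apply window_of_locally in L. destruct L as [e [He L]]. specialize (L (t + e / 2) ltac:(lra)).
  specialize (HF (t + e / 2)). specialize (Hm t (t + e / 2) ltac:(lra)). nra.
Qed.

(** The walk sees the degree: one period of the source advances it by [M * d]. *)
Lemma itinerary_degree F d N M a v w : itinerary F d N M a v w -> w N = (w 0 + M * d)%Z.
Proof.
  intros I. apply (advancing_inj (it_target I)).
  rewrite (advancing_shift (it_target I)), <- !(it_value I).
  rewrite <- (it_equivariant I). f_equal.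
  destruct (it_source I) as [_ [_ Hp]]. rewrite <- Hp. f_equal.
Qed.

Section Matching.
Variables (F G : R -> R) (d N M : Z) (a b v u : Z -> R) (w : Z -> Z) (K : R -> R).
Hypotheses (IF : itinerary F d N M a v w) (IG : itinerary G d N M b u w).
Hypotheses (HK : ldiff 1 K) (Kv : forall j, K (v j) = u j).

Let Phi (t : R) : R := K (F t).

Lemma smooth1_Phi : smooth1 Phi.
Proof. apply (smooth1_comp K F). apply HK. apply IF. Qed.

Lemma Derive_Phi t : Derive Phi t = Derive F t * Derive K (F t).
Proof.
  apply is_derive_unique. apply (is_derive_Rcomp K F); apply smooth1_derive. apply HK. apply IF.
Qed.

Lemma Derive_K_pos y : 0 < Derive K y.
Proof. destruct HK as [_ [_ [_ Hp]]]. specialize (Hp y). lra. Qed.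

Lemma Phi_a i : Phi (a i) = u (w i).
Proof. unfold Phi. rewrite (it_value IF). apply Kv. Qed.

Lemma G_b i : G (b i) = u (w i).
Proof. apply (it_value IG). Qed.

Lemma Phi_monotone i x y : a i <= x -> x < y -> y <= a (i + 1)%Z ->
  IZR (w (i + 1) - w i)%Z * Phi x < IZR (w (i + 1) - w i)%Z * Phi y.
Proof.
  apply strictly_monotone_on.
  - intros t. exists (Derive Phi t). apply smooth1_derive, smooth1_Phi.
  - intros t Ht. rewrite Derive_Phi, <- Rmult_assoc. apply Rmult_lt_0_compat.
    now apply (it_monotone IF). apply Derive_K_pos.
Qed.

Lemma G_monotone i x y : b i <= x -> x < y -> y <= b (i + 1)%Z ->
  IZR (w (i + 1) - w i)%Z * G x < IZR (w (i + 1) - w i)%Z * G y.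
Proof.
  apply strictly_monotone_on.
  - intros t. exists (Derive G t). apply smooth1_derive, IG.
  - intros t Ht. now apply (it_monotone IG).
Qed.

Lemma G_injective i x y : b i <= x <= b (i + 1)%Z -> b i <= y <= b (i + 1)%Z -> G x = G y -> x = y.
Proof.
  intros Hx Hy E. destruct (Rtotal_order x y) as [L|[L|L]]; auto.
  - apply (G_monotone i) in L; try lra. rewrite E in L. lra.
  - apply (G_monotone i) in L; try lra. rewrite E in L. lra.
Qed.

Lemma a_succ i : a i < a (i + 1)%Z.
Proof. apply (it_source IF). Qed.

Lemma b_succ i : b i < b (i + 1)%Z.
Proof. apply (it_source IG). Qed.

Lemma between_of_monotone (s : R) (f : R -> R) x y t :
  x <= t <= y -> (forall x' y', x <= x' -> x' < y' -> y' <= y -> s * f x' < s * f y') ->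
  Rmin (f x) (f y) <= f t <= Rmax (f x) (f y).
Proof.
  intros Ht Hm.
  assert (E : t = x \/ t = y \/ x < t < y) by lra. destruct E as [->|[->|E]].
  - split; [apply Rmin_l|apply Rmax_l].
  - split; [apply Rmin_r|apply Rmax_r].
  - pose proof (Hm x t ltac:(lra) ltac:(lra) ltac:(lra)). pose proof (Hm t y ltac:(lra) ltac:(lra) ltac:(lra)).
    unfold Rmin, Rmax. repeat destruct Rle_dec; split; nra.
Qed.

(** On each interval of the fibre, [H] is the inverse of the monotone branch of
    [G] applied to [Phi]; the branches agree at the common end points. *)
Lemma H_exists t : exists y, forall i, a i <= t <= a (i + 1)%Z -> b i <= y <= b (i + 1)%Z /\ G y = Phi t.
Proof.
  destruct (advancing_locate (it_source IF) t) as [i Hi].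
  destruct (IVT_gen G (b i) (b (i + 1)%Z) (Phi t)) as [y [Hy Ey]].
  - apply smooth1_continuity, IG.
  - rewrite !G_b, <- !Phi_a. apply between_of_monotone with (IZR (w (i + 1) - w i)%Z). lra.
    apply Phi_monotone.
  - pose proof (b_succ i). rewrite Rmin_left, Rmax_right in Hy by lra. exists y. intros j Hj.
    assert (j < i + 1)%Z by (apply (advancing_lt_inv (it_source IF)); lra).
    destruct (Z.eq_dec j i) as [->|Hn]; auto.
    (* the only other interval containing [t] ends at [t = a i] *)
    assert (Hij : a (j + 1)%Z <= a i) by (apply (advancing_le (it_source IF)); lia).
    assert (E1 : a (j + 1)%Z = a i) by lra. apply (advancing_inj (it_source IF)) in E1.
    assert (E2 : t = a i) by (rewrite E1 in Hj; lra). subst t.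
    assert (y = b i). { apply (G_injective i); try lra. now rewrite Ey, G_b, Phi_a. }
    subst y. pose proof (b_succ j). rewrite E1 in *. split; auto. lra.
Qed.

Let H (t : R) : R := proj1_sig (constructive_indefinite_description _ (H_exists t)).

Lemma H_spec t i : a i <= t <= a (i + 1)%Z -> b i <= H t <= b (i + 1)%Z /\ G (H t) = Phi t.
Proof. unfold H. destruct constructive_indefinite_description; simpl; auto. Qed.

Lemma H_a i : H (a i) = b i.
Proof.
  pose proof (a_succ i). pose proof (b_succ i). destruct (H_spec (a i) i). lra.
  apply (G_injective i); try lra. now rewrite H3, Phi_a, G_b.
Qed.

Lemma G_H t : G (H t) = Phi t.
Proof.
  destruct (advancing_locate (it_source IF) t) as [i Hi].
  apply (H_spec t i). lra.
Qed.

Lemma H_increasing x y : x < y -> H x < H y.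
Proof.
  intros L. pose proof (it_source IF) as Ha. pose proof (it_source IG) as Hb.
  destruct (advancing_locate Ha x) as [i Hi], (advancing_locate Ha y) as [j Hj].
  destruct (H_spec x i) as [X1 X2]. lra. destruct (H_spec y j) as [Y1 Y2]. lra.
  assert (i < j + 1)%Z by (apply (advancing_lt_inv Ha); lra).
  destruct (Z.eq_dec i j) as [<-|Hn].
  - destruct (Rlt_le_dec (H x) (H y)) as [|[L2|L2]]; auto; exfalso.
    + apply (G_monotone i) in L2; try lra. apply (Phi_monotone i) in L; try lra.
      rewrite X2, Y2 in L2. lra.
    + apply (Phi_monotone i) in L; try lra. rewrite <- X2, <- Y2, L2 in L. lra.
  - apply Rlt_le_trans with (b (i + 1)%Z).
    + destruct X1 as [_ [X1|X1]]; auto. exfalso.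
      assert (L2 : x < a (i + 1)%Z) by lra. apply (Phi_monotone i) in L2; try lra.
      rewrite Phi_a, <- X2, X1, G_b in L2. lra.
    + apply Rle_trans with (b j); [|lra]. apply (advancing_le Hb). lia.
Qed.

Lemma H_nondecreasing x y : x <= y -> H x <= H y.
Proof. intros [L| ->]; [left; now apply H_increasing|lra]. Qed.

Lemma H_onto y : exists t, H t = y.
Proof.
  destruct (advancing_locate (it_source IG) y) as [i Hi].
  destruct (IVT_gen Phi (a i) (a (i + 1)%Z) (G y)) as [t [Ht Et]].
  - apply smooth1_continuity, smooth1_Phi.
  - rewrite !Phi_a, <- !G_b. apply between_of_monotone with (IZR (w (i + 1) - w i)%Z). lra.
    apply G_monotone.
  - pose proof (a_succ i). rewrite Rmin_left, Rmax_right in Ht by lra. exists t.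
    destruct (H_spec t i Ht). apply (G_injective i); try lra.
Qed.

Lemma H_continuous t : continuous H t.
Proof. apply nondecreasing_onto_continuous. apply H_nondecreasing. apply H_onto. Qed.

Lemma critical_a_iff_b i : Derive F (a i) = 0 <-> Derive G (b i) = 0.
Proof. rewrite (it_turn IF), (it_turn IG). tauto. Qed.

Lemma H_regular t : Derive F t <> 0 -> Derive G (H t) <> 0.
Proof.
  intros Ht. destruct (advancing_locate (it_source IF) t) as [i Hi].
  destruct (Req_dec t (a i)) as [->|Hn].
  - now rewrite H_a, <- critical_a_iff_b.
  - assert (B : b i < H t < b (i + 1)%Z).
    { rewrite <- !H_a. split; apply H_increasing; lra. }
    apply (it_monotone IG) in B. intros E. rewrite E in B. lra.
Qed.

(** At a fold both sides are [v + s X^2] and [v + s Y^2] with [X], [Y] local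
    coordinates, so [H] reads [Y (H t) = X t]: it is the change of coordinate
    in the source whatever the target diffeomorphism [K] is. *)
Lemma H_smooth t : smooth_at H t /\ 0 < Derive H t.
Proof.
  assert (Key : exists Y X : R -> R, smooth_at Y (H t) /\ smooth_at X t /\
     locally t (fun z => Y (H z) = X z) /\ Derive Y (H t) <> 0 /\ Derive X t <> 0).
  { destruct (Req_dec (Derive F t) 0) as [E|E].
    - destruct (advancing_locate (it_source IF) t) as [i Hi].
      destruct (Req_dec t (a i)) as [->|Hn].
      2: { assert (B : a i < t < a (i + 1)%Z) by lra. apply (it_monotone IF) in B.
           rewrite E in B. lra. }
      rewrite H_a. pose proof (proj1 (critical_a_iff_b i) E) as E'.
      destruct (morse Phi (a i) smooth1_Phi) as [s [X [Hs [SX [X0 [DX LX]]]]]].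
      { rewrite Derive_Phi, E. ring. }
      { rewrite (Derive_ext _ _ _ Derive_Phi).
        rewrite Derive_mult.
        - rewrite E, Rmult_0_l, Rplus_0_r. apply Rmult_integral_contrapositive. split.
          now apply (it_morse IF). pose proof (Derive_K_pos (F (a i))). lra.
        - eexists. apply smooth1_derive, smooth1_Derive, IF.
        - eexists. apply (smooth1_derive (fun z => Derive K (F z))). apply (smooth1_comp (Derive K) F).
          apply smooth1_Derive, HK. apply IF. }
      destruct (morse G (b i) (it_smooth IG) E' (it_morse IG i E'))
        as [s' [Y [Hs' [SY [Y0 [DY LY]]]]]].
      exists Y, X. repeat split; try lra; auto.
      rewrite <- H_a in LY. apply (continuous_locally H (a i) _ (H_continuous _)) in LY.
      generalize (filter_and _ _ LX LY). apply filter_imp. intros z [[EX [NX PX]] [EY [NY PY]]].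
      rewrite G_H, H_a, G_b, EX, Phi_a in EY.
      destruct (Rtotal_order z (a i)) as [L|[->|L]].
      + pose proof (NX L). pose proof (NY (H_increasing _ _ L)). destruct Hs as [-> | ->], Hs' as [-> | ->]; nra.
      + now rewrite H_a, X0, Y0.
      + pose proof (PX L). pose proof (PY (H_increasing _ _ L)). destruct Hs as [-> | ->], Hs' as [-> | ->]; nra.
    - exists G, Phi. split; [apply IG|]. split; [apply smooth1_Phi|]. split; [|split].
      + apply filter_forall. intros; apply G_H.
      + now apply H_regular.
      + rewrite Derive_Phi. pose proof (Derive_K_pos (F t)). apply Rmult_integral_contrapositive. lra. }
  destruct Key as [Y [X [SY [SX [L [DY DX]]]]]].
  destruct (smooth_at_implicit Y H X t) as [SH D]; auto.
  { apply filter_forall. intros; apply H_continuous. }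
  split; auto. rewrite (is_derive_unique _ _ _ D).
  pose proof (derive_nonneg_of_nondecreasing H t _ H_nondecreasing D) as [|E]; auto. exfalso.
  assert (Derive X t = 0); auto.
  replace (Derive X t) with (Derive X t / Derive Y (H t) * Derive Y (H t)) by (field; auto). rewrite <- E. ring.
Qed.

Lemma H_equivariant : equivariant H 1.
Proof.
  intros t. pose proof (it_source IF) as Ha. pose proof (it_source IG) as Hb.
  destruct (advancing_locate Ha t) as [i Hi].
  destruct (H_spec t i) as [X1 X2]. lra.
  destruct Ha as [_ [_ Pa]]. destruct Hb as [_ [_ Pb]].
  assert (E : (i + N + 1 = i + 1 + N)%Z) by lia.
  destruct (H_spec (t + 2 * PI) (i + N)%Z) as [Y1 Y2]. rewrite E, !Pa. lra.
  rewrite E, !Pb in Y1. rewrite Rmult_1_l.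
  assert (H (t + 2 * PI) - 2 * PI = H t); [|lra].
  apply (G_injective i); try lra.
  pose proof (it_equivariant IG (H (t + 2 * PI) - 2 * PI)) as EG.
  replace (H (t + 2 * PI) - 2 * PI + 2 * PI) with (H (t + 2 * PI)) in EG by ring.
  rewrite Y2 in EG. unfold Phi in EG. rewrite (it_equivariant IF) in EG.
  rewrite (equivariant_Z K 1) in EG by apply HK. rewrite Z.mul_1_l in EG.
  rewrite X2. unfold Phi. lra.
Qed.

Lemma matching : exists H, ldiff 1 H /\ forall t, K (F t) = G (H t).
Proof.
  exists H. split; [|intros; symmetry; apply G_H].
  split; auto. split; [intros t; apply H_smooth|]. split; [apply H_equivariant|].
  intros t. rewrite Rmult_1_l. apply H_smooth.
Qed.

End Matching.

Lemma same_itinerary F G d d' N M a b v u w :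
  itinerary F d N M a v w -> itinerary G d' N M b u w ->
  exists H K, ldiff 1 H /\ ldiff 1 K /\ forall t, K (F t) = G (H t).
Proof.
  intros IF IG.
  assert (d = d').
  { pose proof (itinerary_degree _ _ _ _ _ _ _ IF). pose proof (itinerary_degree _ _ _ _ _ _ _ IG).
    destruct (it_target IF) as [HM _]. nia. }
  subst d'.
  destruct (interpolation v u M (it_target IF) (it_target IG)) as [K [HK Kv]].
  destruct (matching F G d N M a b v u w K IF IG HK Kv) as [H [HH E]].
  now exists H, K.
Qed.

(** * Equivalence in terms of lifts *)

(** The two lifts of [k o f = g o h] differ by a constant, which is absorbed
    into [K]; this is why [K] need not lift [k] itself. *)
Lemma A_equiv_lift f g F G d d' :
  A_equiv f g -> lifts f F -> smooth1 F -> equivariant F d ->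
  lifts g G -> smooth1 G -> equivariant G d' ->
  exists h k e e' H K, diffeo h /\ diffeo k /\ (forall x, k (f x) = g (h x)) /\ lifts h H /\
    ldiff e H /\ ldiff e' K /\ forall t, K (F t) = G (H t).
Proof.
  intros [h [k [Dh [Dk E]]]] LF SF EF LG SG EG.
  destruct (ldiff_of_diffeo h Dh) as [e [H [HH LH]]].
  destruct (ldiff_of_diffeo k Dk) as [e' [K [HK LK]]].
  pose (c := K (F 0) - G (H 0)).
  assert (C : forall t, K (F t) - G (H t) = c).
  { intros t. apply (constant_of_discrete (fun t => K (F t) - G (H t))).
    - apply smooth1_minus. apply (smooth1_comp K F); auto. apply HK. apply (smooth1_comp G H); auto. apply HH.
    - intros u. destruct (proj1 (P_eq_iff (G (H u)) (K (F u)))) as [m Hm].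
      now rewrite <- LG, <- LH, <- LK, <- LF, E. exists m. lra. }
  exists h, k, e, e', H, (fun y => K y - c). do 5 (split; auto). split.
  - destruct HK as [He [SK [EK PK]]]. split; auto. split; [|split].
    + apply smooth1_minus; auto. apply smooth1_const.
    + intros t. rewrite EK. ring.
    + intros t. replace (Derive _ t) with (Derive K t); auto. symmetry. apply is_derive_unique.
      eapply is_derive_eq. apply is_derive_Rminus. now apply smooth1_derive. apply is_derive_Rconst. ring.
  - intros t. specialize (C t). lra.
Qed.

Lemma A_equiv_of_lift f g F G e e' H K :
  ldiff e H -> ldiff e' K -> lifts f F -> lifts g G -> (forall t, K (F t) = G (H t)) -> A_equiv f g.
Proof.
  intros HH HK LF LG E. exists (descend H), (descend K).
  split. now apply diffeo_of_ldiff with e. split. now apply diffeo_of_ldiff with e'.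
  intros x. rewrite <- (P_angle x). rewrite LF, (descend_P K e'), (descend_P H e), LG by (apply HK || apply HH).
  now rewrite E.
Qed.

Section Conjugate.
Variables (F G H K : R -> R) (e e' : Z).
Hypotheses (SF : smooth1 F) (SG : smooth1 G) (HH : ldiff e H) (HK : ldiff e' K).
Hypothesis E : forall t, K (F t) = G (H t).

Lemma ldiff_Derive_neq e0 H0 t : ldiff e0 H0 -> Derive H0 t <> 0.
Proof. intros [_ [_ [_ Hp]]] Z0. specialize (Hp t). rewrite Z0 in Hp. lra. Qed.

Lemma conjugate_Derive t : Derive F t * Derive K (F t) = Derive H t * Derive G (H t).
Proof.
  transitivity (Derive (fun t => K (F t)) t).
  - symmetry. apply is_derive_unique. apply (is_derive_Rcomp K F); apply smooth1_derive; auto. apply HK.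
  - rewrite (Derive_ext _ _ t E). apply is_derive_unique.
    apply (is_derive_Rcomp G H); apply smooth1_derive; auto. apply HH.
Qed.

Lemma conjugate_critical t : Derive F t = 0 <-> Derive G (H t) = 0.
Proof.
  pose proof (conjugate_Derive t) as D.
  pose proof (ldiff_Derive_neq e H t HH). pose proof (ldiff_Derive_neq e' K (F t) HK).
  split; intros Z0; rewrite Z0 in D.
  - rewrite Rmult_0_l in D. symmetry in D. apply Rmult_integral in D. tauto.
  - rewrite Rmult_0_r in D. apply Rmult_integral in D. tauto.
Qed.

(** At a critical point the second derivative is multiplied by nonzero factors
    only, the other terms of the chain rule having a zero first derivative. *)
Lemma conjugate_degenerate t :
  Derive F t = 0 -> Derive (Derive F) t = 0 -> Derive (Derive G) (H t) = 0.
Proof.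
  intros Z1 Z2. assert (SH : smooth1 H) by apply HH. assert (SK : smooth1 K) by apply HK.
  assert (D := Derive_ext _ _ t conjugate_Derive).
  rewrite (Derive_mult (Derive F) (fun t => Derive K (F t))), (Derive_mult (Derive H) (fun t => Derive G (H t))) in D.
  - rewrite Z1, Z2 in D. rewrite (proj1 (conjugate_critical t) Z1) in D.
    replace (Derive (fun t => Derive G (H t)) t) with (Derive H t * Derive (Derive G) (H t)) in D.
    + assert (D' : Derive H t * (Derive H t * Derive (Derive G) (H t)) = 0) by lra.
      pose proof (ldiff_Derive_neq e H t HH).
      apply Rmult_integral in D'. destruct D' as [|D']; [tauto|]. apply Rmult_integral in D'. tauto.
    + symmetry. apply is_derive_unique. apply (is_derive_Rcomp (Derive G) H); apply smooth1_derive; auto.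
      now apply smooth1_Derive.
  - eexists. now apply smooth1_derive, smooth1_Derive.
  - eexists. apply (smooth1_derive (fun t => Derive G (H t))). apply (smooth1_comp (Derive G) H); auto. now apply smooth1_Derive.
  - eexists. now apply smooth1_derive, smooth1_Derive.
  - eexists. apply (smooth1_derive (fun t => Derive K (F t))). apply (smooth1_comp (Derive K) F); auto. now apply smooth1_Derive.
Qed.

End Conjugate.

(** * Small perturbations of a lift *)

Definition size (i : R * R) : R := Rabs (fst i) + Rabs (snd i).

Lemma size_nonneg i : 0 <= size i.
Proof. unfold size. generalize (Rabs_pos (fst i)) (Rabs_pos (snd i)). lra. Qed.

(** Families of functions, indexed by the unit ball of the parameter plane, all
    of whose derivatives up to order [n] are bounded by a constant times the
    weight [om]. The weights used are [1] and [size]. *)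
Fixpoint dominated (om : R * R -> R) (n : nat) (u : R * R -> R -> R) : Prop :=
  (exists C, forall i t, size i <= 1 -> Rabs (u i t) <= C * om i) /\
  match n with
  | O => True
  | S m => exists u', (forall i t, size i <= 1 -> is_derive (u i) t (u' i t)) /\ dominated om m u'
  end.

Definition one_weight (_ : R * R) : R := 1.

Lemma dominated_bound om n u : dominated om n u -> exists C, forall i t, size i <= 1 -> Rabs (u i t) <= C * om i.
Proof. destruct n; intros [H _]; exact H. Qed.

Lemma dominated_S om n : forall u, dominated om (S n) u -> dominated om n u.
Proof.
  induction n; intros u [H [u' [D H']]]; split; auto. exists u'. split; auto.
Qed.

Lemma dominated_plus om n : forall u v, dominated om n u -> dominated om n v ->
  dominated om n (fun i t => u i t + v i t).
Proof.
  induction n; intros u v [[C HC] Hu] [[C' HC'] Hv].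
  - split; auto. exists (C + C'). intros i t Hi. specialize (HC i t Hi). specialize (HC' i t Hi).
    pose proof (Rabs_triang (u i t) (v i t)). lra.
  - split.
    + exists (C + C'). intros i t Hi. specialize (HC i t Hi). specialize (HC' i t Hi).
      pose proof (Rabs_triang (u i t) (v i t)). lra.
    + destruct Hu as [u' [Du Hu]], Hv as [v' [Dv Hv]]. exists (fun i t => u' i t + v' i t). split; auto.
      intros i t Hi. apply is_derive_Rplus; auto.
Qed.

Lemma dominated_mult om n : forall u v, dominated one_weight n u -> dominated om n v ->
  dominated om n (fun i t => u i t * v i t).
Proof.
  assert (B : forall m u v, dominated one_weight m u -> dominated om m v ->
     exists C, forall i t, size i <= 1 -> Rabs (u i t * v i t) <= C * om i).
  { intros m u v Hu Hv. apply dominated_bound in Hu. apply dominated_bound in Hv.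
    destruct Hu as [C HC], Hv as [C' HC']. exists (C * C'). intros i t Hi.
    specialize (HC i t Hi). specialize (HC' i t Hi). unfold one_weight in HC. rewrite Rmult_1_r in HC.
    rewrite Rabs_mult, Rmult_assoc. apply Rmult_le_compat; auto using Rabs_pos. }
  induction n; intros u v Hu Hv.
  - split; auto. now apply (B 0%nat).
  - split. now apply (B (S n)).
    pose proof (dominated_S _ _ _ Hu) as Hu1. pose proof (dominated_S _ _ _ Hv) as Hv1.
    destruct Hu as [_ [u' [Du Hu]]], Hv as [_ [v' [Dv Hv]]].
    exists (fun i t => u' i t * v i t + u i t * v' i t). split.
    + intros i t Hi. apply is_derive_Rmult; auto.
    + apply dominated_plus; auto.
Qed.

Lemma dominated_const om (c : R * R -> R) n :
  (exists C, forall i, size i <= 1 -> Rabs (c i) <= C * om i) -> dominated om n (fun i _ => c i).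
Proof.
  revert c. induction n; intros c [C HC]; split; eauto.
  exists (fun _ _ => 0). split.
  - intros i t _. apply is_derive_Rconst.
  - apply IHn. exists 0. intros i _. rewrite Rabs_R0. lra.
Qed.

Lemma dominated_weaken n : forall u, dominated size n u -> dominated one_weight n u.
Proof.
  assert (B : forall u, (exists C, forall i (t : R), size i <= 1 -> Rabs (u i t) <= C * size i) ->
     exists C, forall i t, size i <= 1 -> Rabs (u i t) <= C * one_weight i).
  { intros u [C HC]. exists (Rabs C). intros i t Hi. specialize (HC i t Hi). unfold one_weight.
    apply Rle_trans with (1 := HC). pose proof (size_nonneg i). pose proof (Rle_abs C). pose proof (Rabs_pos C). nra. }
  induction n; intros u [H1 H2]; split; auto.
  destruct H2 as [u' [D H2]]. exists u'. split; auto.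
Qed.

Lemma dominated_opp om n u : dominated om n u -> dominated om n (fun i t => (-1) * u i t).
Proof.
  intros H. apply (dominated_mult om n (fun _ _ => -1)); auto. apply dominated_const.
  exists 1. intros i _. unfold one_weight. rewrite Rmult_1_r. apply Rabs_le; lra.
Qed.

Lemma dominated_Derive_n om n : (forall i, 0 <= om i) -> forall u, dominated om n u ->
  exists C, forall i k t, size i <= 1 -> (k <= n)%nat -> Rabs (Derive_n (u i) k t) <= C * om i.
Proof.
  intros Hom. induction n; intros u [[C HC] H].
  - exists C. intros i k t Hi Hk. replace k with 0%nat by lia. simpl. auto.
  - destruct H as [u' [D H]]. destruct (IHn u' H) as [C' HC']. exists (Rmax C C'). intros i k t Hi Hk.
    specialize (Hom i). destruct k as [|k].
    + simpl. apply Rle_trans with (C * om i); auto. apply Rmult_le_compat_r; auto. apply Rmax_l.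
    + replace (Derive_n (u i) (S k) t) with (Derive_n (u' i) k t).
      * apply Rle_trans with (C' * om i). apply HC'; auto; lia.
        apply Rmult_le_compat_r; auto. apply Rmax_r.
      * replace (S k) with (k + 1)%nat by lia. rewrite <- (Derive_n_comp (u i) k 1). apply Derive_n_ext.
        intros z. symmetry. apply is_derive_unique. auto.
Qed.

Lemma periodic_bounded F : smooth1 F -> equivariant F 0 -> exists C, forall t, Rabs (F t) <= C.
Proof.
  intros SF EF. pose proof two_PI_pos.
  destruct (continuity_ab_maj (fun t => Rabs (F t)) 0 (2 * PI)) as [x [Hx _]]. lra.
  { intros c _. apply (continuity_pt_comp F Rabs). now apply smooth1_continuity. apply Rcontinuity_abs. }
  exists (Rabs (F x)). intros t. destruct (representative t) as [k Hk].
  replace (F t) with (F (t + IZR k * (2 * PI))). apply Hx. lra.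
  rewrite (equivariant_Z F 0) by auto. simpl. ring.
Qed.

Lemma dominated_periodic n : forall F, smooth1 F -> equivariant F 0 -> dominated one_weight n (fun _ => F).
Proof.
  assert (B : forall F, smooth1 F -> equivariant F 0 ->
    exists C, forall (i : R * R) t, size i <= 1 -> Rabs (F t) <= C * one_weight i).
  { intros F SF EF. destruct (periodic_bounded F SF EF) as [C HC]. exists C. intros i t _.
    unfold one_weight. rewrite Rmult_1_r. auto. }
  induction n; intros F SF EF; split; auto.
  exists (fun _ => Derive F). split. intros i t _. now apply smooth1_derive.
  apply IHn. now apply smooth1_Derive. now apply equivariant_Derive with 0%Z.
Qed.

Lemma lipschitz_of_derive (F : R -> R) (C : R) :
  (forall t, ex_derive F t) -> (forall t, Rabs (Derive F t) <= C) ->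
  forall x y, Rabs (F y - F x) <= C * Rabs (y - x).
Proof.
  intros HF HC x y. destruct (MVT_abs F (Derive F) x y) as [c [Hc _]].
  - intros c _. apply is_derive_Reals, Derive_correct, HF.
  - rewrite Hc. apply Rmult_le_compat_r; auto. apply Rabs_pos.
Qed.

Section Perturbation.
Variables (F psi1 psi2 : R -> R) (d : Z).
Hypotheses (SF : smooth1 F) (EF : equivariant F d).
Hypotheses (S1 : smooth1 psi1) (E1 : equivariant psi1 0) (S2 : smooth1 psi2) (E2 : equivariant psi2 0).

Definition perturbation (i : R * R) (t : R) : R := fst i * psi1 t + snd i * psi2 t.

Lemma smooth1_perturbation i : smooth1 (perturbation i).
Proof. apply smooth1_plus; apply smooth1_mult; auto; apply smooth1_const. Qed.

Lemma equivariant_perturbed i : equivariant (fun t => F t + perturbation i t) d.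
Proof. intros t. unfold perturbation. rewrite EF, E1, E2. simpl. ring. Qed.

Lemma dominated_perturbation n : dominated size n perturbation.
Proof.
  assert (C : forall (c : R * R -> R) psi, smooth1 psi -> equivariant psi 0 ->
     (forall i, Rabs (c i) <= size i) -> dominated size n (fun i t => psi t * c i)).
  { intros c psi Sp Ep Hc. apply (dominated_mult size n (fun _ => psi) (fun i _ => c i)).
    now apply dominated_periodic. apply dominated_const. exists 1. intros i _. rewrite Rmult_1_l. auto. }
  replace perturbation with (fun (i : R * R) t => psi1 t * fst i + psi2 t * snd i).
  - apply dominated_plus; apply C; auto; intros i; unfold size;
    generalize (Rabs_pos (fst i)) (Rabs_pos (snd i)); lra.
  - apply functional_extensionality; intros i; apply functional_extensionality; intros t.
    unfold perturbation; ring.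
Qed.

Lemma dominated_perturbed_trig n :
  dominated one_weight n (fun i t => cos (F t + perturbation i t)) /\
  dominated one_weight n (fun i t => sin (F t + perturbation i t)).
Proof.
  assert (B : forall x, Rabs (cos x) <= 1 /\ Rabs (sin x) <= 1).
  { intros x. pose proof (COS_bound x). pose proof (SIN_bound x). split; apply Rabs_le; lra. }
  induction n.
  - split; split; auto; exists 1; intros; unfold one_weight; rewrite Rmult_1_r; apply B.
  - destruct IHn as [IC IS]. destruct (dominated_perturbation (S n)) as [_ [p' [Dp Hp]]].
    assert (Hs : dominated one_weight n (fun i t => Derive F t + p' i t)).
    { apply (dominated_plus _ n (fun _ => Derive F)). apply dominated_periodic.
      now apply smooth1_Derive. now apply equivariant_Derive with d. now apply dominated_weaken. }
    assert (D : forall i t, size i <= 1 -> is_derive (fun t => F t + perturbation i t) t (Derive F t + p' i t)).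
    { intros i t Hi. apply is_derive_Rplus; auto. now apply smooth1_derive. }
    split; split; try (exists 1; intros; unfold one_weight; rewrite Rmult_1_r; apply B).
    + exists (fun i t => (-1) * ((Derive F t + p' i t) * sin (F t + perturbation i t))). split.
      * intros i t Hi. eapply is_derive_eq. apply (is_derive_Rcomp cos). apply is_derive_cos. now apply D. ring.
      * apply dominated_opp. now apply dominated_mult.
    + exists (fun i t => (Derive F t + p' i t) * cos (F t + perturbation i t)). split.
      * intros i t Hi. apply (is_derive_Rcomp sin). apply is_derive_sin. now apply D.
      * now apply dominated_mult.
Qed.

(** The increments of [cos] and [sin] satisfy a linear differential system whose
    forcing term has weight [size], so all their derivatives have this weight. *)
Lemma dominated_increment n :
  dominated size n (fun i t => cos (F t + perturbation i t) - cos (F t)) /\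
  dominated size n (fun i t => sin (F t + perturbation i t) - sin (F t)).
Proof.
  assert (Lc : forall x y, Rabs (cos y - cos x) <= 1 * Rabs (y - x)).
  { apply lipschitz_of_derive. intros t; eexists; apply is_derive_cos.
    intros t. rewrite (is_derive_unique _ _ _ (is_derive_cos t)), Rabs_Ropp. apply Rabs_le, SIN_bound. }
  assert (Ls : forall x y, Rabs (sin y - sin x) <= 1 * Rabs (y - x)).
  { apply lipschitz_of_derive. intros t; eexists; apply is_derive_sin.
    intros t. rewrite (is_derive_unique _ _ _ (is_derive_sin t)). apply Rabs_le, COS_bound. }
  destruct (dominated_bound _ _ _ (dominated_perturbation 0)) as [C HC].
  assert (Bc : exists C, forall i t, size i <= 1 -> Rabs (cos (F t + perturbation i t) - cos (F t)) <= C * size i).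
  { exists C. intros i t Hi. eapply Rle_trans. apply Lc. rewrite Rmult_1_l.
    replace (F t + perturbation i t - F t) with (perturbation i t) by ring. auto. }
  assert (Bs : exists C, forall i t, size i <= 1 -> Rabs (sin (F t + perturbation i t) - sin (F t)) <= C * size i).
  { exists C. intros i t Hi. eapply Rle_trans. apply Ls. rewrite Rmult_1_l.
    replace (F t + perturbation i t - F t) with (perturbation i t) by ring. auto. }
  induction n. split; split; auto.
  destruct IHn as [IC IS]. destruct (dominated_perturbation (S n)) as [_ [p' [Dp Hp]]].
  destruct (dominated_perturbed_trig n) as [TC TS].
  assert (DF : dominated one_weight n (fun _ => Derive F)).
  { apply dominated_periodic. now apply smooth1_Derive. now apply equivariant_Derive with d. }
  assert (D : forall i t, size i <= 1 -> is_derive (fun t => F t + perturbation i t) t (Derive F t + p' i t)).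
  { intros i t Hi. apply is_derive_Rplus; auto. now apply smooth1_derive. }
  split; split; auto.
  - exists (fun i t => (-1) * (Derive F t * (sin (F t + perturbation i t) - sin (F t)) + sin (F t + perturbation i t) * p' i t)).
    split.
    + intros i t Hi. eapply is_derive_eq. apply is_derive_Rminus.
      apply (is_derive_Rcomp cos). apply is_derive_cos. now apply D.
      apply (is_derive_Rcomp cos F). apply is_derive_cos. now apply smooth1_derive. ring.
    + apply dominated_opp, dominated_plus; now apply dominated_mult.
  - exists (fun i t => Derive F t * (cos (F t + perturbation i t) - cos (F t)) + cos (F t + perturbation i t) * p' i t).
    split.
    + intros i t Hi. eapply is_derive_eq. apply is_derive_Rminus.
      apply (is_derive_Rcomp sin). apply is_derive_sin. now apply D.
      apply (is_derive_Rcomp sin F). apply is_derive_sin. now apply smooth1_derive. ring.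
    + apply dominated_plus; now apply dominated_mult.
Qed.

(** Beyond smoothness, stability is used only through such two-parameter
    families. *)
Lemma stable_perturbed f : stable f -> lifts f F ->
  exists eta, 0 < eta /\ forall i, size i < eta -> A_equiv f (descend (fun t => F t + perturbation i t)).
Proof.
  intros [Sf [r [eps [He Hst]]]] LF.
  destruct (dominated_increment r) as [Bc Bs].
  apply (dominated_Derive_n _ _ size_nonneg) in Bc. apply (dominated_Derive_n _ _ size_nonneg) in Bs.
  destruct Bc as [C HC], Bs as [C' HC'].
  pose (B := Rabs C + Rabs C' + 1).
  assert (HB : 0 < B /\ C <= B /\ C' <= B).
  { unfold B. pose proof (Rabs_pos C). pose proof (Rabs_pos C'). pose proof (Rle_abs C). pose proof (Rle_abs C'). lra. }
  exists (Rmin 1 (eps / B)). split. apply Rmin_glb_lt. lra. apply Rdiv_lt_0_compat; lra.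
  intros i Hi.
  assert (Hi1 : size i <= 1) by (pose proof (Rmin_l 1 (eps / B)); lra).
  assert (Hi2 : B * size i < eps).
  { pose proof (Rmin_r 1 (eps / B)). apply Rlt_le_trans with (B * (eps / B)).
    apply Rmult_lt_compat_l; lra. right. field. lra. }
  pose (G := fun t => F t + perturbation i t).
  assert (SG : smooth1 G) by (apply smooth1_plus; auto; apply smooth1_perturbation).
  assert (LG : lifts (descend G) G) by (apply lifts_descend with d, equivariant_perturbed).
  apply Hst. now apply smooth_of_lift with G.
  assert (Diff : forall (c : R -> R), smooth1 c -> forall n t, Derive_n (fun u => c (G u)) n t - Derive_n (fun u => c (F u)) n t
     = Derive_n (fun u => c (G u) - c (F u)) n t).
  { intros c Sc n t. symmetry. apply Derive_n_minus; apply filter_forall; intros u k _.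
    - apply (proj1 (smooth1_iff (fun u => c (G u)))). now apply smooth1_comp.
    - apply (proj1 (smooth1_iff (fun u => c (F u)))). now apply smooth1_comp. }
  intros n t Hn. pose proof (size_nonneg i). split.
  - rewrite (Derive_n_ext (curve1 (descend G)) (fun u => cos (G u))) by (intros; now apply curve1_lift).
    rewrite (Derive_n_ext (curve1 f) (fun u => cos (F u))) by (intros; now apply curve1_lift).
    rewrite (Diff cos smooth1_cos). eapply Rle_lt_trans. apply (HC i n t Hi1 Hn). nra.
  - rewrite (Derive_n_ext (curve2 (descend G)) (fun u => sin (G u))) by (intros; now apply curve2_lift).
    rewrite (Derive_n_ext (curve2 f) (fun u => sin (F u))) by (intros; now apply curve2_lift).
    rewrite (Diff sin smooth1_sin). eapply Rle_lt_trans. apply (HC' i n t Hi1 Hn). nra.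
Qed.

End Perturbation.

(** * Stable maps are Morse *)

Lemma pigeonhole (n m : nat) (c : nat -> nat) : (m < n)%nat -> (forall k, (k < n)%nat -> (c k < m)%nat) ->
  exists i j, (i < n)%nat /\ (j < n)%nat /\ i <> j /\ c i = c j.
Proof.
  intros Hmn Hc. apply NNPP. intros Hno.
  assert (ND : NoDup (map c (seq 0 n))).
  { apply NoDup_map_NoDup_ForallPairs; [|apply seq_NoDup].
    intros i j Hi Hj E. apply in_seq in Hi. apply in_seq in Hj.
    destruct (Nat.eq_dec i j); auto. exfalso. apply Hno. exists i, j. repeat split; auto; lia. }
  assert (L : (length (map c (seq 0 n)) <= length (seq 0 m))%nat).
  { apply NoDup_incl_length; auto. intros x Hx. apply in_map_iff in Hx. destruct Hx as [k [<- Hk]].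
    apply in_seq in Hk. apply in_seq. specialize (Hc k). lia. }
  rewrite length_map, !length_seq in L. lia.
Qed.

Lemma cell_exists (m : nat) (t : R) : (0 < m)%nat -> 0 <= t < 2 * PI ->
  exists k : nat, (k < m)%nat /\ INR k * (2 * PI) <= t * INR m < (INR k + 1) * (2 * PI).
Proof.
  intros Hm Ht. pose proof two_PI_pos. assert (Hm' : 0 < INR m) by (now apply lt_0_INR).
  pose (x := t * INR m / (2 * PI)).
  assert (Ex : x * (2 * PI) = t * INR m) by (unfold x; field; lra).
  assert (Hx : 0 <= x < INR m). { split; apply Rmult_le_reg_r with (2 * PI) || apply Rmult_lt_reg_r with (2 * PI); nra. }
  destruct (base_Int_part x) as [B1 B2].
  assert (0 <= Int_part x)%Z. { assert (-1 < Int_part x)%Z by (apply lt_IZR; simpl; lra). lia. }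
  exists (Z.to_nat (Int_part x)).
  rewrite INR_IZR_INZ, Z2Nat.id by auto. split.
  - apply INR_lt. rewrite INR_IZR_INZ, Z2Nat.id by auto. lra.
  - rewrite <- Ex. split; [apply Rmult_le_compat_r|apply Rmult_lt_compat_r]; lra.
Qed.

(** A Lipschitz curve does not fill a square: of [K^2] grid points with mesh
    [delta / K], two would be reached within time [2 PI / (K^2 - 1)], whereas
    travelling between them takes a time at least of order [1 / K]. *)
Lemma curve_misses (g1 g2 : R -> R) (L delta : R) :
  0 < delta -> (forall t u, Rabs (g1 t - g1 u) <= L * Rabs (t - u)) ->
  (forall t u, Rabs (g2 t - g2 u) <= L * Rabs (t - u)) ->
  exists a b, 0 <= a <= delta /\ 0 <= b <= delta /\ forall t, 0 <= t < 2 * PI -> ~ (g1 t = a /\ g2 t = b).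
Proof.
  intros Hd L1 L2. pose proof two_PI_pos. apply NNPP. intros Hno.
  assert (Hall : forall a b, 0 <= a <= delta -> 0 <= b <= delta -> exists t, 0 <= t < 2 * PI /\ g1 t = a /\ g2 t = b).
  { intros a b Ha Hb. apply NNPP. intros Hn. apply Hno. exists a, b. split; auto. split; auto.
    intros t Ht [E1 E2]. apply Hn. exists t. auto. }
  assert (L0 : 0 <= L).
  { specialize (L1 1 0). pose proof (Rabs_pos (g1 1 - g1 0)). rewrite Rminus_0_r, Rabs_R1 in L1. lra. }
  assert (HK : exists K : nat, (2 <= K)%nat /\ 2 * (L * (2 * PI)) < delta * INR K).
  { destruct (INR_unbounded (2 * (L * (2 * PI)) / delta)) as [K0 HK0]. exists (K0 + 2)%nat. split. lia.
    rewrite plus_INR. simpl (INR 2). apply Rlt_le_trans with (delta * INR K0); [|nra].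
    apply Rmult_lt_reg_r with (/ delta). now apply Rinv_0_lt_compat.
    replace (delta * INR K0 * / delta) with (INR K0) by (field; lra). unfold Rdiv in HK0. lra. }
  destruct HK as [K [HK2 HK]].
  assert (HKp : 0 < INR K) by (apply lt_0_INR; lia).
  pose (m := (K * K - 1)%nat).
  assert (Hm : INR K * INR K <= 2 * INR m).
  { unfold m. rewrite minus_INR by nia. rewrite mult_INR. simpl (INR 1).
    assert (2 <= INR K) by (apply (le_INR 2); auto). nra. }
  assert (Hmp : 0 < INR m) by nra.
  pose (co := fun j : nat => delta / INR K * INR j).
  assert (Hco : forall j, (j < K)%nat -> 0 <= co j <= delta).
  { intros j Hj. apply lt_INR in Hj. pose proof (pos_INR j). unfold co.
    assert (0 < delta / INR K) by (now apply Rdiv_lt_0_compat). split. nra.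
    apply Rle_trans with (delta / INR K * INR K). nra. right. field. lra. }
  assert (T : forall k : nat, exists tc : R * nat, (k < K * K)%nat ->
     0 <= fst tc < 2 * PI /\ g1 (fst tc) = co (k / K)%nat /\ g2 (fst tc) = co (k mod K)%nat /\
     (snd tc < m)%nat /\ INR (snd tc) * (2 * PI) <= fst tc * INR m < (INR (snd tc) + 1) * (2 * PI)).
  { intros k. destruct (lt_dec k (K * K)) as [Hk|Hk]; [|exists (0, 0%nat); tauto].
    destruct (Hall (co (k / K)%nat) (co (k mod K)%nat)) as [t [Ht [E1 E2]]].
    - apply Hco. apply Nat.Div0.div_lt_upper_bound; lia.
    - apply Hco. apply Nat.mod_upper_bound. lia.
    - destruct (cell_exists m t) as [c Hc]; auto. apply INR_lt. simpl. lra.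
      exists (t, c). simpl. tauto. }
  pose (tc := fun k => proj1_sig (constructive_indefinite_description _ (T k))).
  assert (Htc : forall k, (k < K * K)%nat ->
     0 <= fst (tc k) < 2 * PI /\ g1 (fst (tc k)) = co (k / K)%nat /\ g2 (fst (tc k)) = co (k mod K)%nat /\
     (snd (tc k) < m)%nat /\ INR (snd (tc k)) * (2 * PI) <= fst (tc k) * INR m < (INR (snd (tc k)) + 1) * (2 * PI)).
  { intros k. unfold tc. now destruct constructive_indefinite_description. }
  destruct (pigeonhole (K * K) m (fun k => snd (tc k))) as [i [j [Hi [Hj [Hij Ec]]]]].
  { unfold m. nia. }
  { intros k Hk. now apply Htc. }
  destruct (Htc i Hi) as [_ [A1 [A2 [_ A3]]]]. destruct (Htc j Hj) as [_ [B1 [B2 [_ B3]]]].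
  simpl in Ec. rewrite Ec in A3.
  assert (Dt : Rabs (fst (tc i) - fst (tc j)) * INR m <= 2 * PI).
  { rewrite <- (Rabs_pos_eq (INR m)) by lra. rewrite <- Rabs_mult. apply Rabs_le. nra. }
  assert (Bound : forall x y, Rabs (co x - co y) <= L * Rabs (fst (tc i) - fst (tc j)) -> x = y).
  { intros x y Hxy. destruct (Nat.eq_dec x y) as [|Hn]; auto. exfalso.
    assert (1 <= Rabs (INR x - INR y)).
    { rewrite !INR_IZR_INZ, <- minus_IZR, <- abs_IZR. apply IZR_le. lia. }
    unfold co in Hxy. rewrite <- Rmult_minus_distr_l, Rabs_mult in Hxy.
    assert (Hdk : 0 < delta / INR K) by (now apply Rdiv_lt_0_compat).
    rewrite (Rabs_pos_eq (delta / INR K)) in Hxy by lra.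
    assert (Q1 : delta / INR K <= L * Rabs (fst (tc i) - fst (tc j))) by nra.
    assert (Q2 : delta / INR K * INR m <= L * (2 * PI)).
    { apply Rle_trans with (L * (Rabs (fst (tc i) - fst (tc j)) * INR m)). rewrite <- Rmult_assoc.
      apply Rmult_le_compat_r; lra. now apply Rmult_le_compat_l. }
    assert (Q3 : delta / INR K * (INR K * INR K) <= delta / INR K * (2 * INR m)) by (apply Rmult_le_compat_l; lra).
    replace (delta / INR K * (INR K * INR K)) with (delta * INR K) in Q3 by (field; lra). lra. }
  apply Hij. rewrite (Nat.div_mod_eq i K), (Nat.div_mod_eq j K). f_equal; [f_equal|]; apply Bound.
  - rewrite <- A1, <- B1. apply L1.
  - rewrite <- A2, <- B2. apply L2.
Qed.

Lemma equivariant_cos : equivariant cos 0.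
Proof. intros t. destruct (cos_sin_period t 1) as [E _]. rewrite Rmult_1_l in E. rewrite E. simpl. ring. Qed.

Lemma equivariant_sin : equivariant sin 0.
Proof. intros t. destruct (cos_sin_period t 1) as [_ E]. rewrite Rmult_1_l in E. rewrite E. simpl. ring. Qed.

(** [F + a cos + b sin] has a degenerate critical point at [t] exactly when
    [(a, b)] is the point [(g1 t, g2 t)] of an explicit smooth closed curve.
    Parameters off this curve are arbitrarily small, and the Morse property of
    the perturbed map passes back to [F] through the equivalence. *)
Lemma stable_morse f F d : stable f -> lifts f F -> smooth1 F -> equivariant F d ->
  forall t, Derive F t = 0 -> Derive (Derive F) t <> 0.
Proof.
  intros Hst LF SF EF.
  destruct (stable_perturbed F cos sin d SF EF smooth1_cos equivariant_cos smooth1_sin equivariant_sin f Hst LF)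
    as [eta [Heta Hpert]].
  assert (S' : smooth1 (Derive F)) by (now apply smooth1_Derive).
  assert (S'' : smooth1 (Derive (Derive F))) by (now apply smooth1_Derive).
  assert (S''' : smooth1 (Derive (Derive (Derive F)))) by (now apply smooth1_Derive).
  pose (g1 := fun t => Derive F t * sin t + Derive (Derive F) t * cos t).
  pose (g2 := fun t => Derive (Derive F) t * sin t - Derive F t * cos t).
  assert (P' : equivariant (Derive F) 0) by (now apply equivariant_Derive with d).
  assert (P'' : equivariant (Derive (Derive F)) 0) by (now apply equivariant_Derive with 0%Z).
  assert (P''' : equivariant (Derive (Derive (Derive F))) 0) by (now apply equivariant_Derive with 0%Z).
  assert (HL : exists L, forall t, Rabs (Derive F t + Derive (Derive (Derive F)) t) <= L).
  { apply periodic_bounded. now apply smooth1_plus. intros t. rewrite P', P'''. simpl; ring. }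
  destruct HL as [L HL].
  assert (D1 : forall t, is_derive g1 t ((Derive F t + Derive (Derive (Derive F)) t) * cos t)).
  { intros t. eapply is_derive_eq. apply is_derive_Rplus; apply is_derive_Rmult.
    now apply smooth1_derive. apply is_derive_sin. now apply smooth1_derive. apply is_derive_cos. ring. }
  assert (D2 : forall t, is_derive g2 t ((Derive F t + Derive (Derive (Derive F)) t) * sin t)).
  { intros t. eapply is_derive_eq. apply is_derive_Rminus; apply is_derive_Rmult.
    now apply smooth1_derive. apply is_derive_sin. now apply smooth1_derive. apply is_derive_cos. ring. }
  assert (Trig : forall x y, Rabs x <= L -> Rabs y <= 1 -> Rabs (x * y) <= L).
  { intros x y Hx Hy. rewrite Rabs_mult. pose proof (Rabs_pos x). pose proof (Rabs_pos y). nra. }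
  destruct (curve_misses g1 g2 L (eta / 4)) as [a [b [Ha [Hb Hmiss]]]].
  { lra. }
  { intros t u. apply lipschitz_of_derive. intros z; eexists; apply D1.
    intros z. rewrite (is_derive_unique _ _ _ (D1 z)). apply Trig; auto. apply Rabs_le, COS_bound. }
  { intros t u. apply lipschitz_of_derive. intros z; eexists; apply D2.
    intros z. rewrite (is_derive_unique _ _ _ (D2 z)). apply Trig; auto. apply Rabs_le, SIN_bound. }
  pose (G := fun t => F t + perturbation cos sin (a, b) t).
  assert (SG : smooth1 G). { apply smooth1_plus; auto. apply smooth1_perturbation. apply smooth1_cos. apply smooth1_sin. }
  assert (EG : equivariant G d). { apply equivariant_perturbed; auto. apply equivariant_cos. apply equivariant_sin. }
  assert (DG1 : forall t, Derive G t = Derive F t + (- a * sin t + b * cos t)).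
  { intros t. apply is_derive_unique. apply is_derive_Rplus. now apply smooth1_derive.
    eapply is_derive_eq. apply is_derive_Rplus; apply is_derive_Rmult.
    apply is_derive_Rconst. apply is_derive_cos. apply is_derive_Rconst. apply is_derive_sin. simpl. ring. }
  assert (DG2 : forall t, Derive (Derive G) t = Derive (Derive F) t - a * cos t - b * sin t).
  { intros t. rewrite (Derive_ext _ _ _ DG1). apply is_derive_unique. eapply is_derive_eq.
    apply is_derive_Rplus. now apply smooth1_derive. apply is_derive_Rplus; apply is_derive_Rmult.
    apply is_derive_Rconst. apply is_derive_sin. apply is_derive_Rconst. apply is_derive_cos. cbv beta. ring. }
  assert (MG : forall t, Derive G t = 0 -> Derive (Derive G) t <> 0).
  { intros t Z1 Z2. destruct (representative t) as [k Hk].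
    rewrite <- (Derive_period_Z G d t k) in Z1 by auto.
    rewrite <- (Derive_period_Z (Derive G) 0 t k) in Z2
      by (try apply equivariant_Derive with d; auto; now apply smooth1_Derive).
    set (z := t + IZR k * (2 * PI)) in *. apply (Hmiss z Hk). unfold g1, g2. rewrite DG1 in Z1. rewrite DG2 in Z2.
    pose proof (sin2_cos2 z) as E. unfold Rsqr in E.
    replace (Derive F z) with (a * sin z - b * cos z) by lra.
    replace (Derive (Derive F) z) with (a * cos z + b * sin z) by lra.
    split.
    - transitivity (a * (sin z * sin z + cos z * cos z)); [ring|rewrite E; ring].
    - transitivity (b * (sin z * sin z + cos z * cos z)); [ring|rewrite E; ring]. }
  assert (HA : A_equiv f (descend G)).
  { apply Hpert. unfold size. simpl. rewrite !Rabs_pos_eq by lra. lra. }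
  destruct (A_equiv_lift f (descend G) F G d d HA LF SF EF (lifts_descend G d EG) SG EG)
    as [h [k [e [e' [H [K [_ [_ [_ [_ [HH [HK E]]]]]]]]]]]].
  intros t Z1 Z2. apply (MG (H t)).
  - now apply (conjugate_critical F G H K e e').
  - now apply (conjugate_degenerate F G H K e e').
Qed.

(** * Stable maps have distinct critical values *)

Lemma NoDup_of_finite {X : Type} (l : list X) (S : X -> Prop) : (forall x, S x -> In x l) ->
  exists l', NoDup l' /\ forall x, In x l' <-> S x.
Proof.
  intros H. pose (dec := fun x y : X => excluded_middle_informative (x = y)).
  exists (filter (fun x => if excluded_middle_informative (S x) then true else false) (nodup dec l)). split.
  - apply NoDup_filter, NoDup_nodup.
  - intros x. rewrite filter_In, nodup_In. destruct (excluded_middle_informative (S x)) as [Hx|Hx].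
    + split; auto.
    + split; [intros [_ C]; discriminate C|tauto].
Qed.

Lemma P_eq_iff_cos y z : P y = P z <-> cos (y - z) = 1.
Proof.
  rewrite P_eq_iff. split.
  - intros [k ->]. replace (y - (y + IZR k * (2 * PI))) with (0 + IZR (- k) * (2 * PI)) by (rewrite opp_IZR; ring).
    destruct (cos_sin_period 0 (- k)) as [-> _]. apply cos_0.
  - intros E. apply cos_1_period in E. destruct E as [k Hk]. exists (- k)%Z. rewrite opp_IZR. lra.
Qed.

Lemma RInt_positive g lo hi z : smooth1 g -> (forall t, lo < t < hi -> 0 <= g t) ->
  lo < z < hi -> 0 < g z -> 0 < RInt g lo hi.
Proof.
  intros Sg Hg Hz Pz.
  destruct (window_of_locally _ _ (continuous_lt g z 0 (smooth1_continuous g z Sg) Pz)) as [e [He L]].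
  pose (e' := Rmin e (Rmin (z - lo) (hi - z)) / 2).
  assert (He' : 0 < e' /\ e' < e /\ e' < z - lo /\ e' < hi - z).
  { unfold e'. pose proof (Rmin_l e (Rmin (z - lo) (hi - z))). pose proof (Rmin_r e (Rmin (z - lo) (hi - z))).
    pose proof (Rmin_l (z - lo) (hi - z)). pose proof (Rmin_r (z - lo) (hi - z)).
    assert (0 < Rmin e (Rmin (z - lo) (hi - z))) by (repeat apply Rmin_glb_lt; lra). lra. }
  rewrite <- (RInt_Rchasles g lo (z - e')), <- (RInt_Rchasles g (z - e') (z + e') hi) by auto.
  assert (0 <= RInt g lo (z - e')).
  { apply RInt_ge_0. lra. now apply ex_RInt_smooth. intros; apply Hg; lra. }
  assert (0 <= RInt g (z + e') hi).
  { apply RInt_ge_0. lra. now apply ex_RInt_smooth. intros; apply Hg; lra. }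
  assert (0 < RInt g (z - e') (z + e')).
  { apply RInt_gt_0. lra. intros; apply L; lra. intros. apply continuity_pt_filterlim. now apply smooth1_continuity. }
  lra.
Qed.

(** The derivative of [phi] is taken to be a multiple of [F'^2], so [F + eps phi] keeps the
    critical points of [F] for small [eps]; but it separates the values at [lo]
    and [hi]. The cofactor of [F'^2] is positive on the arc from [lo] to [hi]
    and negative on its complement up to a constant [c], and [c] is what makes
    [phi] periodic. *)
Lemma separating_function F d lo hi : smooth1 F -> equivariant F d ->
  (forall t, Derive F t = 0 -> Derive (Derive F) t <> 0) -> lo < hi < lo + 2 * PI ->
  exists phi rho, smooth1 phi /\ equivariant phi 0 /\ smooth1 rho /\ equivariant rho 0 /\
    (forall t, is_derive phi t (Derive F t * rho t)) /\ phi lo = 0 /\ 0 < phi hi.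
Proof.
  intros SF EF MF Hlh.
  assert (S' : smooth1 (Derive F)) by (now apply smooth1_Derive).
  assert (P' : equivariant (Derive F) 0) by (now apply equivariant_Derive with d).
  pose (w0 := fun t => cos (t - (lo + hi) / 2) - cos ((hi - lo) / 2)).
  assert (Sw : smooth1 w0).
  { apply smooth1_minus; [|apply smooth1_const]. apply (smooth1_comp cos (fun t => t - (lo + hi) / 2)). apply smooth1_cos.
    apply smooth1_minus; [apply smooth1_id|apply smooth1_const]. }
  assert (Pw : equivariant w0 0).
  { intros t. unfold w0. replace (t + 2 * PI - (lo + hi) / 2) with (t - (lo + hi) / 2 + 2 * PI) by ring.
    rewrite equivariant_cos. simpl. ring. }
  pose (q := fun t => Derive F t * Derive F t).
  assert (Sq : smooth1 q) by (now apply smooth1_mult).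
  assert (Sqw : smooth1 (fun t => q t * w0 t)) by (now apply smooth1_mult).
  assert (Nz : forall x y, x < y -> exists z, x < z < y /\ 0 < q z).
  { intros x y Hxy.
    destruct (window_of_locally _ _ (isolated_critical F SF MF ((x + y) / 2))) as [e [He L]].
    pose (e' := Rmin e (y - x) / 4).
    assert (0 < e' /\ e' < e /\ e' < (y - x) / 2).
    { unfold e'. pose proof (Rmin_l e (y - x)). pose proof (Rmin_r e (y - x)).
      assert (0 < Rmin e (y - x)) by (apply Rmin_glb_lt; lra). lra. }
    exists ((x + y) / 2 + e'). split; [lra|].
    assert (Derive F ((x + y) / 2 + e') <> 0) by (apply L; lra). unfold q. nra. }
  pose (A := RInt (fun t => q t * w0 t) lo hi). pose (B := RInt (fun t => q t * w0 t) hi (lo + 2 * PI)).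
  pose (a := RInt q lo hi). pose (b := RInt q hi (lo + 2 * PI)).
  assert (HA : 0 < A).
  { destruct (Nz lo hi) as [z [Hz Qz]]. lra. apply RInt_positive with z; auto.
    - intros t Ht. assert (0 < w0 t) by (apply cos_arc_pos; lra). unfold q. nra.
    - apply Rmult_lt_0_compat; auto. apply cos_arc_pos; lra. }
  assert (HB : 0 < - B).
  { assert (EB : RInt (fun t => -1 * (q t * w0 t)) hi (lo + 2 * PI) = -1 * B) by (now apply RInt_Rscal).
    replace (- B) with (-1 * B) by ring. rewrite <- EB.
    destruct (Nz hi (lo + 2 * PI)) as [z [Hz Qz]]. lra. apply RInt_positive with z; auto.
    - apply smooth1_mult; auto. apply smooth1_const.
    - intros t Ht. assert (w0 t < 0) by (apply cos_arc_neg; lra). unfold q. nra.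
    - assert (w0 z < 0) by (apply cos_arc_neg; lra). nra. }
  assert (Ha : 0 < a).
  { destruct (Nz lo hi) as [z [Hz Qz]]. lra. apply RInt_positive with z; auto. intros; unfold q; nra. }
  assert (Hb : 0 < b).
  { destruct (Nz hi (lo + 2 * PI)) as [z [Hz Qz]]. lra. apply RInt_positive with z; auto. intros; unfold q; nra. }
  pose (c := - (A + B) / (a + b)).
  pose (rho := fun t => Derive F t * (w0 t + c)).
  assert (Sr : smooth1 rho).
  { apply smooth1_mult; auto. apply smooth1_plus; auto. apply smooth1_const. }
  pose (dphi := fun t => q t * w0 t + c * q t).
  assert (Sd : smooth1 dphi).
  { apply smooth1_plus; auto. apply smooth1_mult; auto. apply smooth1_const. }
  assert (Int : forall x y, RInt dphi x y = RInt (fun t => q t * w0 t) x y + c * RInt q x y).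
  { intros x y. unfold dphi. rewrite RInt_Rplus, RInt_Rscal; auto. apply smooth1_mult; auto. apply smooth1_const. }
  assert (Dp : forall t, is_derive (RInt dphi lo) t (dphi t)) by (intros; now apply is_derive_primitive).
  assert (Full : RInt dphi lo (lo + 2 * PI) = 0).
  { rewrite <- (RInt_Rchasles dphi lo hi), !Int by auto.
    change (@eq R (A + c * a + (B + c * b)) 0). unfold c. field. lra. }
  exists (RInt dphi lo), rho. split; [now apply smooth1_primitive|]. split; [|split; [|split; [|split; [|split]]]]; auto.
  - intros t.
    assert (C : RInt dphi lo (t + 2 * PI) - RInt dphi lo t = RInt dphi lo (lo + 2 * PI) - RInt dphi lo lo).
    { apply (constant_of_derive0 (fun t => RInt dphi lo (t + 2 * PI) - RInt dphi lo t)). intros u.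
      eapply is_derive_eq. apply is_derive_Rminus. apply (is_derive_Rcomp (RInt dphi lo) (fun t => t + 2 * PI)). apply Dp.
      apply is_derive_Rplus. apply is_derive_Rid. apply is_derive_Rconst. apply Dp.
      unfold dphi, q. rewrite P', Pw. simpl. ring. }
    rewrite primitive_at_base, Full in C. simpl. lra.
  - intros t. unfold rho. rewrite P', Pw. simpl. ring.
  - intros t. eapply is_derive_eq. apply Dp. unfold dphi, rho, q. ring.
  - apply primitive_at_base.
  - rewrite Int. fold A a. unfold c.
    replace (A + - (A + B) / (a + b) * a) with ((A * b + a * (- B)) / (a + b)) by (field; lra).
    apply Rdiv_lt_0_compat; nra.
Qed.

Definition double_pair (f : S1 -> S1) (z : S1 * S1) : Prop :=
  Sigma f (fst z) /\ Sigma f (snd z) /\ f (fst z) = f (snd z).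

Lemma diffeo_injective h x y : diffeo h -> h x = h y -> x = y.
Proof. intros [_ [h' [_ [E _]]]] H. rewrite <- (E x), <- (E y). now f_equal. Qed.

(** An equivalence carries the double pairs of [f] injectively into those of [g],
    so the two finite sets have the same size and an inclusion is an equality. *)
Lemma double_pairs_invariant f g l : smooth f -> smooth g -> A_equiv f g ->
  NoDup l -> (forall z, In z l <-> double_pair f z) ->
  (forall z, double_pair g z -> double_pair f z) -> forall z, double_pair f z -> double_pair g z.
Proof.
  intros Sf Sg HA ND Hl Hsub.
  destruct (NoDup_of_finite l (double_pair g)) as [l' [ND' Hl']].
  { intros z Hz. apply Hl. auto. }
  destruct (lift_exists f Sf) as [F [d [SF [LF EF]]]]. destruct (lift_exists g Sg) as [G [d' [SG [LG EG]]]].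
  destruct (A_equiv_lift f g F G d d' HA LF SF EF LG SG EG)
    as [h [k [e [e' [H [K [Dh [Dk [E [LH [HH [HK EL]]]]]]]]]]]].
  assert (Crit : forall x, Sigma f x -> Sigma g (h x)).
  { intros x. rewrite <- (P_angle x), LH, (Sigma_lift f F d), (Sigma_lift g G d') by auto.
    now apply (conjugate_critical F G H K e e'). }
  pose (hh := fun z : S1 * S1 => (h (fst z), h (snd z))).
  assert (NDh : NoDup (map hh l)).
  { apply NoDup_map_NoDup_ForallPairs; auto. intros [x y] [x' y'] _ _ Ez. unfold hh in Ez. simpl in Ez.
    injection Ez; intros E2 E1. f_equal; now apply (diffeo_injective h). }
  assert (L1 : incl (map hh l) l').
  { intros z Hz. apply in_map_iff in Hz. destruct Hz as [[x y] [<- Hz]]. apply Hl in Hz.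
    destruct Hz as [H1 [H2 H3]]. simpl in *. apply Hl'. split; [|split]; simpl; auto.
    rewrite <- !E. now f_equal. }
  intros z Hz. apply Hl'.
  apply (NoDup_length_incl ND' (l' := l)).
  - rewrite <- (length_map hh l). now apply NoDup_incl_length.
  - intros z' Hz'. apply Hl, Hsub. now apply Hl'.
  - now apply Hl.
Qed.

Lemma critical_points_finite f F d : smooth1 F -> lifts f F -> equivariant F d ->
  (forall t, Derive F t = 0 -> Derive (Derive F) t <> 0) ->
  exists l, forall x, Sigma f x -> In x (map P l).
Proof.
  intros SF LF EF MF. destruct (isolated_finite _ 0 (2 * PI) (isolated_critical F SF MF)) as [l [_ Hl]].
  exists l. intros x Hx. rewrite <- (P_angle x) in *. apply in_map, Hl. split.
  pose proof (angle_range x); lra. now apply (Sigma_lift f F d).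
Qed.

(** Adding a small multiple of the separating function would destroy one double
    pair and create none. *)
Lemma stable_injective f F d : stable f -> lifts f F -> smooth1 F -> equivariant F d ->
  forall x y, Sigma f x -> Sigma f y -> f x = f y -> x = y.
Proof.
  intros Hst LF SF EF. pose proof two_PI_pos.
  pose proof (stable_morse f F d Hst LF SF EF) as MF.
  assert (Main : forall lo hi, 0 <= lo -> lo < hi -> hi < 2 * PI -> Derive F lo = 0 -> Derive F hi = 0 ->
     P (F lo) = P (F hi) -> False).
  { intros lo hi H0 H1 H2 Z1 Z2 EP.
    destruct (separating_function F d lo hi SF EF MF) as [phi [rho [Sp [Ep [Sr [Er [Dp [p0 p1]]]]]]]]. lra.
    destruct (stable_perturbed F phi (fun _ => 0) d SF EF Sp Ep (smooth1_const 0)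
      ltac:(intros t; simpl; ring) f Hst LF) as [eta [Heta Hpert]].
    destruct (periodic_bounded rho Sr Er) as [C HC].
    destruct (critical_points_finite f F d SF LF EF MF) as [l Hl].
    (* as [l] is finite, only finitely many open conditions are imposed on [eps] *)
    assert (Far : locally 0 (fun eps => forall z, In z (list_prod l l) -> P (F (fst z)) <> P (F (snd z)) ->
        P (F (fst z) + eps * phi (fst z)) <> P (F (snd z) + eps * phi (snd z)))).
    { apply (locally_forall_in (list_prod l l) (fun z eps => P (F (fst z)) <> P (F (snd z)) ->
        P (F (fst z) + eps * phi (fst z)) <> P (F (snd z) + eps * phi (snd z)))).
      intros [c c'] _. simpl. destruct (classic (P (F c) = P (F c'))) as [Eq|Ne].
      - apply filter_forall. tauto.
      - assert (L : locally 0 (fun eps => cos (F c + eps * phi c - (F c' + eps * phi c')) <> 1)).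
        { apply continuous_neq.
          - apply (smooth1_continuous (fun eps => cos (F c + eps * phi c - (F c' + eps * phi c')))).
            apply (smooth1_comp cos (fun eps => F c + eps * phi c - (F c' + eps * phi c'))). apply smooth1_cos.
            apply smooth1_minus; (apply smooth1_plus; [apply smooth1_const|]);
            (apply smooth1_mult; [apply smooth1_id|apply smooth1_const]).
          - rewrite !Rmult_0_l, !Rplus_0_r. rewrite <- P_eq_iff_cos. auto. }
        revert L. apply filter_imp. intros eps Heps _ Eq. apply Heps. now apply P_eq_iff_cos. }
    apply window_of_locally in Far. destruct Far as [e1 [He1 Far]].
    assert (HC0 : 0 <= C) by (pose proof (HC 0); pose proof (Rabs_pos (rho 0)); lra).
    assert (Heps : exists eps, 0 < eps /\ eps < e1 /\ eps < eta /\ eps * C < 1 /\ eps * phi hi < 2 * PI).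
    { pose (m := Rmin e1 (Rmin eta (Rmin (/ (C + 1)) (2 * PI / phi hi)))).
      assert (0 < / (C + 1)) by (apply Rinv_0_lt_compat; lra).
      assert (0 < 2 * PI / phi hi) by (now apply Rdiv_lt_0_compat).
      assert (Hm : 0 < m) by (repeat apply Rmin_glb_lt; auto).
      assert (M1 : m <= e1) by apply Rmin_l.
      assert (M2 : m <= eta) by (eapply Rle_trans; [apply Rmin_r|apply Rmin_l]).
      assert (M3 : m <= / (C + 1)).
      { eapply Rle_trans; [apply Rmin_r|]. eapply Rle_trans; [apply Rmin_r|apply Rmin_l]. }
      assert (M4 : m <= 2 * PI / phi hi).
      { eapply Rle_trans; [apply Rmin_r|]. eapply Rle_trans; [apply Rmin_r|apply Rmin_r]. }
      exists (m / 2). repeat split; try lra.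
      - apply (Rmult_le_compat_r (C + 1)) in M3; [|lra]. rewrite Rinv_l in M3 by lra. nra.
      - apply (Rmult_le_compat_r (phi hi)) in M4; [|lra].
        replace (2 * PI / phi hi * phi hi) with (2 * PI) in M4 by (field; lra). nra. }
    destruct Heps as [eps [He0 [He1' [He2 [He3 He4]]]]].
    pose (G := fun t => F t + perturbation phi (fun _ => 0) (eps, 0) t).
    assert (GE : forall t, G t = F t + eps * phi t) by (intros t; unfold G, perturbation; simpl; ring).
    assert (SG : smooth1 G).
    { apply smooth1_plus; auto. apply smooth1_perturbation; auto. apply smooth1_const. }
    assert (EG : equivariant G d).
    { apply equivariant_perturbed; auto. intros t; simpl; ring. }
    assert (LG := lifts_descend G d EG).
    assert (DG : forall t, Derive G t = Derive F t * (1 + eps * rho t)).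
    { intros t. rewrite (Derive_ext _ _ t GE). apply is_derive_unique. eapply is_derive_eq.
      apply is_derive_Rplus. now apply smooth1_derive. apply is_derive_Rmult. apply is_derive_Rconst. apply Dp. cbv beta. ring. }
    assert (CG : forall t, Derive G t = 0 <-> Derive F t = 0).
    { intros t. rewrite DG. assert (1 + eps * rho t <> 0).
      { specialize (HC t). apply Rabs_le_between in HC. assert (- 1 < eps * rho t) by nra. lra. }
      split; intros Z0. apply Rmult_integral in Z0. tauto. rewrite Z0; ring. }
    assert (SigG : forall x, Sigma (descend G) x <-> Sigma f x).
    { intros x. rewrite <- (P_angle x). rewrite (Sigma_lift _ G d), (Sigma_lift f F d) by auto. apply CG. }
    assert (HA : A_equiv f (descend G)).
    { apply Hpert. unfold size. simpl. rewrite Rabs_R0, Rabs_pos_eq; lra. }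
    destruct (NoDup_of_finite (list_prod (map P l) (map P l)) (double_pair f)) as [lp [ND Hlp]].
    { intros [x y] [Hx [Hy _]]. apply in_prod; auto. }
    assert (D : double_pair (descend G) (P lo, P hi)).
    { apply (double_pairs_invariant f (descend G) lp); auto.
      - apply Hst.
      - now apply smooth_of_lift with G.
      - intros [x y] [Hx [Hy Exy]]. simpl in *. apply SigG in Hx. apply SigG in Hy.
        split; [|split]; simpl; auto.
        destruct (proj1 (in_map_iff _ _ _) (Hl x Hx)) as [c [<- Hc]].
        destruct (proj1 (in_map_iff _ _ _) (Hl y Hy)) as [c' [<- Hc']].
        rewrite !LF. rewrite !LG, !GE in Exy. apply NNPP. intros Ne.
        apply (Far eps ltac:(lra) (c, c')); auto. now apply in_prod.
      - split; [|split]; simpl. now apply (Sigma_lift f F d). now apply (Sigma_lift f F d).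
        now rewrite !LF. }
    destruct D as [_ [_ D]]. simpl in D. rewrite !LG, !GE, p0 in D.
    apply P_eq_iff in EP. destruct EP as [j Hj]. apply P_eq_iff in D. destruct D as [k Hk].
    assert (0 < k - j < 1)%Z; [|lia]. split; apply lt_IZR; rewrite minus_IZR; simpl; nra. }
  intros x y Hx Hy E. rewrite <- (P_angle x), <- (P_angle y) in *.
  rewrite (Sigma_lift f F d) in Hx, Hy by auto. rewrite !LF in E.
  pose proof (angle_range x). pose proof (angle_range y).
  destruct (Rtotal_order (angle x) (angle y)) as [L|[->|L]]; auto; exfalso.
  - apply (Main (angle x) (angle y)); tauto.
  - apply (Main (angle y) (angle x)); try tauto. auto.
Qed.

(** * Cyclic words *)

Section CyclicWords.
Context {X : Type}.
Implicit Types t : list X.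

Lemma entry_shift t (i q : Z) : entry t (i + Z.of_nat (length t) * q) = entry t i.
Proof.
  unfold entry. destruct t as [|x t]. now destruct (Z.to_nat _), (Z.to_nat _).
  replace (i + Z.of_nat (length (x :: t)) * q - 1)%Z with (i - 1 + q * Z.of_nat (length (x :: t)))%Z by ring.
  rewrite Z.mod_add; auto. simpl. lia.
Qed.

(** Both sides are periodic in [i]. Without the bound on [i] the relation can be
    inverted and composed by substitution. *)
Lemma E_equiv_Z t t' : E_equiv t t' <-> length t = length t' /\
  exists a eps : Z, (eps = 1 \/ eps = -1)%Z /\ forall i : Z, entry t i = entry t' (eps * i + a)%Z.
Proof.
  split; intros [L [a [eps [He H]]]]; split; auto; exists a, eps; split; auto.
  intros i. destruct (Nat.eq_dec (length t) 0) as [E|E].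
  - rewrite E in L. apply length_zero_iff_nil in E. symmetry in L. apply length_zero_iff_nil in L. subst.
    unfold entry. now destruct (Z.to_nat _), (Z.to_nat _).
  - set (n := Z.of_nat (length t)). assert (Hn : (0 < n)%Z) by (unfold n; lia).
    pose proof (Z.div_mod (i - 1) n ltac:(lia)) as Ei. pose proof (Z.mod_pos_bound (i - 1) n Hn).
    set (q := ((i - 1) / n)%Z) in *. set (r := ((i - 1) mod n)%Z) in *.
    replace i with (r + 1 + n * q)%Z by lia. unfold n at 1. rewrite entry_shift, H by lia.
    replace (eps * (r + 1 + n * q) + a)%Z with (eps * (r + 1) + a + Z.of_nat (length t') * (eps * q))%Z
      by (rewrite <- L; fold n; ring).
    now rewrite entry_shift.
Qed.

Lemma E_equiv_refl t : E_equiv t t.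
Proof.
  apply E_equiv_Z. split; auto. exists 0%Z, 1%Z. split; auto. intros i. f_equal. ring.
Qed.

Lemma E_equiv_sym t t' : E_equiv t t' -> E_equiv t' t.
Proof.
  rewrite !E_equiv_Z. intros [L [a [eps [He H]]]]. split; auto. exists (- (eps * a))%Z, eps. split; auto.
  intros i. rewrite H. f_equal. destruct He; subst; ring.
Qed.

Lemma E_equiv_trans t t' t'' : E_equiv t t' -> E_equiv t' t'' -> E_equiv t t''.
Proof.
  rewrite !E_equiv_Z. intros [L [a [eps [He H]]]] [L' [a' [eps' [He' H']]]].
  split. congruence. exists (eps' * a + a')%Z, (eps' * eps)%Z. split. destruct He, He'; subst; auto.
  intros i. rewrite H, H'. f_equal. ring.
Qed.

Lemma E_class_eq t t' : E_class t = E_class t' <-> E_equiv t t'.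
Proof.
  split.
  - intros E. change (E_class t t'). rewrite E. apply E_equiv_refl.
  - intros E. apply functional_extensionality. intros u. apply propositional_extensionality. unfold E_class.
    split; intros H; eapply E_equiv_trans; eauto. now apply E_equiv_sym.
Qed.

End CyclicWords.

(** * Maps without singular points *)

(** The lift is a bijection of the line, and the multiples of [2 PI] pulled back
    by it form an enumeration of period [s * d], the absolute degree. *)
Lemma card_fiber f F d s : smooth1 F -> lifts f F -> equivariant F d ->
  (s = 1 \/ s = -1)%Z -> (forall t, 0 < IZR s * Derive F t) -> card (fiber_10 f) = Z.to_nat (s * d).
Proof.
  intros SF LF EF Hs Hp.
  destruct (inverse_of_monotone s F d SF EF Hs Hp) as [G [SG [FG [GF PG]]]].
  destruct (monotone_equivariant_bijective s F d SF EF Hs Hp) as [Hsd _].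
  pose proof two_PI_pos.
  apply (card_enumerated (fun i => G (IZR (s * i) * (2 * PI))) (s * d) (fun t => P (F t) = P 0)).
  - split; [split; [|split]|]; auto.
    + intros i.
      assert (M := strictly_increasing_on (fun u => G (IZR s * u)) (IZR i * (2 * PI)) (IZR (i + 1) * (2 * PI))).
      simpl in M. rewrite !mult_IZR, !Rmult_assoc. apply M; try lra.
      * intros t. eexists. apply (is_derive_Rcomp G (fun u => IZR s * u)). now apply smooth1_derive.
        apply is_derive_Rmult. apply is_derive_Rconst. apply is_derive_Rid.
      * intros t _. replace (Derive _ t) with (IZR s * Derive G (IZR s * t)); auto.
        symmetry. apply is_derive_unique. eapply is_derive_eq. apply (is_derive_Rcomp G (fun u => IZR s * u)). now apply smooth1_derive.
        apply is_derive_Rmult. apply is_derive_Rconst. apply is_derive_Rid. cbv beta. ring.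
      * rewrite plus_IZR. lra.
    + intros i. rewrite <- (GF (G _ + 2 * PI)), EF, FG. f_equal.
      replace (s * (i + s * d))%Z with (s * i + d)%Z by (destruct Hs; subst; ring). rewrite plus_IZR. ring.
    + intros t. split.
      * intros E. symmetry in E. apply P_eq_iff in E. destruct E as [k Hk]. exists (s * k)%Z.
        replace (s * (s * k))%Z with k by (destruct Hs; subst; ring). rewrite Rplus_0_l in Hk.
        now rewrite <- Hk, GF.
      * intros [i <-]. rewrite FG. symmetry. apply P_eq_iff. exists (s * i)%Z. ring.
  - intros t. unfold fiber_10. rewrite LF.
    assert (E0 : proj1_sig (P 0) = (1, 0)) by (simpl; now rewrite cos_0, sin_0).
    rewrite <- E0. split; [apply S1_eq|now intros ->].
Qed.

(** [K] is [id] or [- id], making both sides monotone in the same direction; then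
    [H] is the inverse of [G] applied to [K (F t)]. *)
Lemma regular_equivalence F G d d' s s' : smooth1 F -> smooth1 G -> equivariant F d -> equivariant G d' ->
  (s = 1 \/ s = -1)%Z -> (s' = 1 \/ s' = -1)%Z ->
  (forall t, 0 < IZR s * Derive F t) -> (forall t, 0 < IZR s' * Derive G t) -> (s * d = s' * d')%Z ->
  exists H K e, ldiff 1 H /\ ldiff e K /\ forall t, K (F t) = G (H t).
Proof.
  intros SF SG EF EG Hs Hs' PF PG Ed.
  destruct (inverse_of_monotone s' G d' SG EG Hs' PG) as [I [SI [GI [IG PI']]]].
  pose (K := fun y => IZR (s * s') * y).
  assert (He : (s * s' = 1 \/ s * s' = -1)%Z) by (destruct Hs, Hs'; subst; auto).
  assert (SK : smooth1 K) by (apply smooth1_mult; [apply smooth1_const|apply smooth1_id]).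
  assert (DK : forall y, is_derive K y (IZR (s * s'))).
  { intros y. eapply is_derive_eq. apply is_derive_Rmult. apply is_derive_Rconst. apply is_derive_Rid. cbv beta. ring. }
  exists (fun t => I (K (F t))), K, (s * s')%Z. split; [|split].
  - split; auto. split; [|split].
    + apply (smooth1_comp I (fun t => K (F t))); auto. now apply (smooth1_comp K F).
    + intros t. rewrite <- (IG (I (K (F t)) + 1 * (2 * PI))), Rmult_1_l, EG, GI, EF. f_equal. unfold K.
      replace d with (s * (s' * d'))%Z by (rewrite <- Ed; destruct Hs; subst; ring).
      rewrite !mult_IZR. destruct Hs as [-> | ->], Hs' as [-> | ->]; ring.
    + intros t. replace (Derive _ t) with (Derive F t * IZR (s * s') * Derive I (K (F t))).
      * specialize (PF t). specialize (PI' (K (F t))). rewrite mult_IZR.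
        replace (1 * (Derive F t * (IZR s * IZR s') * Derive I (K (F t))))
          with ((IZR s * Derive F t) * (IZR s' * Derive I (K (F t)))) by ring.
        now apply Rmult_lt_0_compat.
      * symmetry. apply is_derive_unique. apply (is_derive_Rcomp I (fun t => K (F t))). now apply smooth1_derive.
        apply (is_derive_Rcomp K F). apply DK. now apply smooth1_derive.
  - split; auto. split; auto. split.
    + intros t. unfold K. ring.
    + intros t. rewrite (is_derive_unique _ _ _ (DK t)). destruct He as [-> | ->]; lra.
  - intros t. now rewrite GI.
Qed.

Lemma conjugate_degree F G H K d d' e e' : equivariant F d -> equivariant G d' -> ldiff e H -> ldiff e' K ->
  (forall t, K (F t) = G (H t)) -> (e' * d = d' * e)%Z.
Proof.
  intros EF EG [_ [_ [EH _]]] [_ [_ [EK _]]] E. pose proof two_PI_pos.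
  pose proof (E (0 + 2 * PI)) as E1. rewrite EF, EH, (equivariant_Z K e'), (equivariant_Z G d'), E in E1 by auto.
  apply eq_IZR. apply Rmult_eq_reg_r with (2 * PI); lra.
Qed.

(** * The symbols of a map with singular points *)

Lemma T_lift f F d t : smooth1 F -> lifts f F -> equivariant F d ->
  T f t = if Req_EM_T (Derive F t) 0 then s else p.
Proof.
  intros SF LF EF. unfold T. pose proof (Sigma_lift f F d t SF LF EF).
  destruct excluded_middle_informative, Req_EM_T; tauto.
Qed.

Lemma T_eq_iff f g F G d d' t u : smooth1 F -> lifts f F -> equivariant F d ->
  smooth1 G -> lifts g G -> equivariant G d' ->
  (T f t = T g u <-> (Derive F t = 0 <-> Derive G u = 0)).
Proof.
  intros SF LF EF SG LG EG. rewrite (T_lift f F d), (T_lift g G d') by auto.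
  destruct (Req_EM_T (Derive F t) 0), (Req_EM_T (Derive G u) 0); split; try tauto; discriminate.
Qed.

Lemma Delta_lift f F d y : smooth1 F -> lifts f F -> equivariant F d ->
  (Delta f (P y) <-> critical_value F y).
Proof.
  intros SF LF EF. split.
  - intros [x [Hx E]]. rewrite <- (P_angle x) in *. exists (angle x). rewrite <- LF. split; auto.
    now apply (Sigma_lift f F d).
  - intros [c [Hc E]]. exists (P c). split. now apply (Sigma_lift f F d). now rewrite LF.
Qed.

Lemma A_set_lift f F d t : smooth1 F -> lifts f F -> equivariant F d ->
  (A_set f t <-> 0 <= t < 2 * PI /\ critical_fibre F t).
Proof.
  intros SF LF EF. unfold A_set. rewrite LF, (Delta_lift f F d) by auto. reflexivity.
Qed.

Section Symbols.
Variables (f : S1 -> S1) (F : R -> R) (d N : Z) (a : Z -> R).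
Hypotheses (SF : smooth1 F) (LF : lifts f F) (EF : equivariant F d).
Hypotheses (Hne : exists x, Sigma f x) (Ha : enumerates a N (critical_fibre F)).

Lemma N_of_enumerated : N_of f = Z.to_nat N.
Proof.
  unfold N_of. destruct excluded_middle_informative; [|tauto].
  apply (card_enumerated a N (critical_fibre F)); auto. intros t.
  rewrite LF. now apply (Delta_lift f F d).
Qed.

Lemma Ast_enumerated : exists c, Ast f = map (T f) (period_list a N c).
Proof.
  destruct Ha as [Adv Sp]. destruct (advancing_origin Adv) as [c [H1 H2]]. exists c.
  unfold Ast. destruct excluded_middle_informative; [|tauto]. f_equal.
  apply increasing_enum_eq. now apply period_list_sorted.
  intros x. rewrite (period_list_spec Adv _ c Sp H1 H2). symmetry. now apply (A_set_lift f F d).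
Qed.

Lemma T_periodic t k : T f (t + IZR k * (2 * PI)) = T f t.
Proof. unfold T. now rewrite P_period. Qed.

(** Reading the tuple modulo its length amounts to following the periodic
    enumeration beyond the fundamental period; the offset [c] is there because
    the tuple starts at the first point of the fibre with [0 <= t < 2 PI]. *)
Lemma entry_Ast : Z.of_nat (length (Ast f)) = N /\ exists c, forall i, entry (Ast f) i = Some (T f (a (i + c)%Z)).
Proof.
  destruct Ast_enumerated as [c E]. destruct Ha as [Adv _]. pose proof Adv as [HN _].
  assert (L : length (Ast f) = Z.to_nat N) by (rewrite E; unfold period_list; now rewrite !length_map, length_seq).
  split. lia. exists (c - 1)%Z. intros i. unfold entry. rewrite L, Z2Nat.id, E by lia.
  unfold period_list. rewrite map_map.
  pose proof (Z.mod_pos_bound (i - 1) N HN) as B. pose proof (Z.div_mod (i - 1) N ltac:(lia)) as Ei.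
  rewrite nth_error_map, nth_error_seq. destruct (Nat.ltb_spec (Z.to_nat ((i - 1) mod N)) (Z.to_nat N)); [|lia].
  simpl. f_equal. rewrite <- (T_periodic _ ((i - 1) / N)), <- (advancing_shift Adv). f_equal. f_equal.
  rewrite Z2Nat.id by lia. lia.
Qed.

Lemma Ast_singular : In s (Ast f).
Proof.
  destruct Hne as [x Hx]. destruct Ast_enumerated as [c E].
  unfold Ast. destruct excluded_middle_informative; [|tauto].
  apply in_map_iff. exists (angle x). split.
  - unfold T. rewrite P_angle. destruct excluded_middle_informative; tauto.
  - destruct Ha as [Adv Sp]. destruct (advancing_origin Adv) as [c' [H1 H2]].
    rewrite (increasing_enum_eq _ (period_list a N c')).
    + apply (period_list_spec Adv _ c' Sp H1 H2). split. apply angle_range.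
      exists (angle x). split; auto. apply (Sigma_lift f F d); auto. now rewrite P_angle.
    + now apply period_list_sorted.
    + intros z. rewrite (period_list_spec Adv _ c' Sp H1 H2). symmetry. now apply (A_set_lift f F d).
Qed.

End Symbols.

Lemma E_equiv_Ast f g F G d d' N N' a b :
  smooth1 F -> lifts f F -> equivariant F d -> (exists x, Sigma f x) -> enumerates a N (critical_fibre F) ->
  smooth1 G -> lifts g G -> equivariant G d' -> (exists x, Sigma g x) -> enumerates b N' (critical_fibre G) ->
  (E_equiv (Ast f) (Ast g) <-> N = N' /\ exists k e : Z, (e = 1 \/ e = -1)%Z /\
     forall i, Derive F (a i) = 0 <-> Derive G (b (e * i + k)%Z) = 0).
Proof.
  intros SF LF EF HF Ha SG LG EG HG Hb.
  destruct (entry_Ast f F d N a SF LF EF HF Ha) as [L1 [c1 E1]].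
  destruct (entry_Ast g G d' N' b SG LG EG HG Hb) as [L2 [c2 E2]].
  rewrite E_equiv_Z. split.
  - intros [L [k [e [He H]]]]. split. lia. exists (k + c2 - e * c1)%Z, e. split; auto. intros i.
    rewrite <- (T_eq_iff f g F G d d') by auto. specialize (H (i - c1)%Z). rewrite E1, E2 in H.
    injection H. replace (i - c1 + c1)%Z with i by ring.
    now replace (e * (i - c1) + k + c2)%Z with (e * i + (k + c2 - e * c1))%Z by ring.
  - intros [EN [k [e [He H]]]]. split. lia. exists (e * c1 + k - c2)%Z, e. split; auto. intros i.
    rewrite E1, E2. f_equal. replace (e * i + (e * c1 + k - c2) + c2)%Z with (e * (i + c1) + k)%Z by ring.
    now apply (T_eq_iff f g F G d d').
Qed.

(** * Maps with singular points *)

(** Any [N] consecutive indices, read in either direction, form a fundamental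
    domain, so a subset of the circle can be counted along them. *)
Lemma card_along_window a N S (Q : S1 -> Prop) (e k : Z) :
  enumerates a N S -> (forall t, Q (P t) -> S t) -> (e = 1 \/ e = -1)%Z ->
  card Q = length (filter (fun j => if excluded_middle_informative (Q (P (a (e * Z.of_nat j + k)%Z))) then true else false)
                          (seq 0 (Z.to_nat N))).
Proof.
  intros [Ha Sa] HQ He. pose proof Ha as [HN _].
  rewrite (card_eq Q (map (fun j => P (a (e * Z.of_nat j + k)%Z))
     (filter (fun j => if excluded_middle_informative (Q (P (a (e * Z.of_nat j + k)%Z))) then true else false)
                          (seq 0 (Z.to_nat N))))).
  - apply length_map.
  - apply NoDup_map_NoDup_ForallPairs; [|apply NoDup_filter, seq_NoDup].
    intros i j Hi Hj E. apply filter_In in Hi. apply filter_In in Hj. destruct Hi as [Hi _], Hj as [Hj _].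
    apply in_seq in Hi. apply in_seq in Hj. apply P_eq_iff in E. destruct E as [m Hm].
    rewrite <- (advancing_shift Ha) in Hm. apply (advancing_inj Ha) in Hm.
    assert (E : (Z.of_nat j - Z.of_nat i = N * (e * m))%Z) by (destruct He; subst; lia).
    assert (-1 < e * m < 1)%Z by nia. assert (e * m = 0)%Z by lia. nia.
  - intros x. rewrite in_map_iff. split.
    + intros [j [<- Hj]]. apply filter_In in Hj. destruct Hj as [_ Hj].
      destruct excluded_middle_informative; auto. discriminate.
    + intros Hx. rewrite <- (P_angle x) in Hx. assert (Sx := HQ _ Hx). apply Sa in Sx. destruct Sx as [i Ei].
      pose (j := ((e * (i - k)) mod N)%Z). pose proof (Z.mod_pos_bound (e * (i - k)) N HN) as B.
      pose proof (Z.div_mod (e * (i - k)) N ltac:(lia)) as D. fold j in B, D.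
      assert (Ej : P (a (e * j + k)%Z) = P (angle x)).
      { rewrite <- Ei. apply P_eq_iff. exists (e * (e * (i - k) / N))%Z. rewrite <- (advancing_shift Ha).
        f_equal. destruct He; subst; lia. }
      exists (Z.to_nat j). rewrite Z2Nat.id by lia. split. now rewrite Ej, P_angle.
      apply filter_In. split. apply in_seq. lia. rewrite Z2Nat.id by lia. rewrite Ej.
      destruct excluded_middle_informative; auto; tauto.
Qed.

(** [f] restricts to a bijection from critical points to critical values. *)
Lemma card_critical_values f F d v M : smooth1 F -> lifts f F -> equivariant F d ->
  (forall t, Derive F t = 0 -> Derive (Derive F) t <> 0) ->
  (forall x y, Sigma f x -> Sigma f y -> f x = f y -> x = y) ->
  enumerates v M (critical_value F) -> card (Sigma f) = Z.to_nat M.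
Proof.
  intros SF LF EF MF IF Hv.
  rewrite <- (card_enumerated v M (critical_value F) (Delta f)) by (auto; intros; now apply (Delta_lift f F d)).
  destruct (critical_points_finite f F d SF LF EF MF) as [l0 Hl0].
  destruct (NoDup_of_finite _ _ Hl0) as [l [ND Hl]].
  rewrite (card_eq _ l), (card_eq _ (map f l)); auto.
  - now rewrite length_map.
  - apply NoDup_map_NoDup_ForallPairs; auto. intros x y Hx Hy. apply IF; now apply Hl.
  - intros y. rewrite in_map_iff. split.
    + intros [x [<- Hx]]. exists x. split; auto. now apply Hl.
    + intros [x [Hx E]]. exists x. split; auto. now apply Hl.
Qed.

Lemma Derive_reflect G (x y : R) : smooth1 G ->
  forall t, Derive (fun t => x * G (y * t)) t = x * y * Derive G (y * t).
Proof.
  intros SG t. apply is_derive_unique. eapply is_derive_eq. apply is_derive_Rmult. apply is_derive_Rconst.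
  apply (is_derive_Rcomp G (fun t => y * t)). now apply smooth1_derive.
  apply is_derive_Rmult. apply is_derive_Rconst. apply is_derive_Rid. cbv beta. ring.
Qed.

(** Reflections and index shifts of source and target act on itineraries; they
    are the symmetries identified by [E_equiv]. *)
Lemma itinerary_reflect G d N M b u w (e de k m : Z) :
  itinerary G d N M b u w -> (e = 1 \/ e = -1)%Z -> (de = 1 \/ de = -1)%Z ->
  itinerary (fun t => IZR de * G (IZR e * t)) (de * e * d) N M
    (fun i => IZR e * b (e * i + k)%Z) (fun j => IZR de * u (de * j + m)%Z)
    (fun i => (de * (w (e * i + k) - m))%Z).
Proof.
  intros [SG EG Ab Au Hv Hst Hmon Hmor Htu] He Hde.
  assert (DG := Derive_reflect G (IZR de) (IZR e) SG).
  assert (DDG : forall t, Derive (Derive (fun t => IZR de * G (IZR e * t))) t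
            = IZR de * IZR e * IZR e * Derive (Derive G) (IZR e * t)).
  { intros t. rewrite (Derive_ext _ _ _ DG). apply is_derive_unique. eapply is_derive_eq.
    apply is_derive_Rmult. apply is_derive_Rconst.
    apply (is_derive_Rcomp (Derive G) (fun t => IZR e * t)). now apply smooth1_derive, smooth1_Derive.
    apply is_derive_Rmult. apply is_derive_Rconst. apply is_derive_Rid. cbv beta. ring. }
  assert (Bk : forall i, IZR e * (IZR e * b i) = b i) by (intros; destruct He; subst; ring).
  assert (Adv : forall (c : Z -> R) L x y, advancing c L -> (x = 1 \/ x = -1)%Z -> advancing (fun i => IZR x * c (x * i + y)%Z) L).
  { intros c L x y [H1 [H2 H3]] [-> | ->]; split; auto; split; intros i.
    - specialize (H2 (1 * i + y)%Z). replace (1 * (i + 1) + y)%Z with (1 * i + y + 1)%Z by ring. lra.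
    - specialize (H3 (1 * i + y)%Z). replace (1 * (i + L) + y)%Z with (1 * i + y + L)%Z by ring. lra.
    - specialize (H2 (-1 * (i + 1) + y)%Z). replace (-1 * (i + 1) + y + 1)%Z with (-1 * i + y)%Z in H2 by ring. lra.
    - specialize (H3 (-1 * (i + L) + y)%Z). replace (-1 * (i + L) + y + L)%Z with (-1 * i + y)%Z in H3 by ring. lra. }
  constructor; auto.
  - apply smooth1_mult. apply smooth1_const. apply (smooth1_comp G (fun t => IZR e * t)); auto.
    apply smooth1_mult. apply smooth1_const. apply smooth1_id.
  - intros t. replace (IZR e * (t + 2 * PI)) with (IZR e * t + IZR e * (2 * PI)) by ring.
    rewrite (equivariant_Z G d), !mult_IZR by auto. ring.
  - intros i. rewrite Bk, Hv. f_equal. f_equal. destruct Hde; subst; ring.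
  - intros i. destruct He as [-> | ->].
    + pose proof (Hst (1 * i + k)%Z). replace (1 * (i + 1) + k)%Z with (1 * i + k + 1)%Z by ring.
      destruct Hde; subst; lia.
    + pose proof (Hst (-1 * (i + 1) + k)%Z) as S1. replace (-1 * (i + 1) + k + 1)%Z with (-1 * i + k)%Z in S1 by ring.
      destruct Hde; subst; lia.
  - intros i t Ht. rewrite DG. destruct He as [-> | ->].
    + replace (1 * (i + 1) + k)%Z with (1 * i + k + 1)%Z in * by ring.
      pose proof (Hmon (1 * i + k)%Z (1 * t) ltac:(lra)) as Q.
      set (x := w (1 * i + k + 1)%Z) in *. set (y := w (1 * i + k)%Z) in *. set (D := Derive G (1 * t)) in *.
      rewrite !minus_IZR, !mult_IZR, !minus_IZR in *. destruct Hde as [-> | ->]; lra.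
    + pose proof (Hmon (-1 * (i + 1) + k)%Z (-1 * t)) as Q.
      replace (-1 * (i + 1) + k + 1)%Z with (-1 * i + k)%Z in Q by ring. specialize (Q ltac:(lra)).
      set (x := w (-1 * i + k)%Z) in *. set (y := w (-1 * (i + 1) + k)%Z) in *. set (D := Derive G (-1 * t)) in *.
      rewrite !minus_IZR, !mult_IZR, !minus_IZR in *. destruct Hde as [-> | ->]; lra.
  - intros i. rewrite DG, DDG, Bk. intros Z0. assert (Z1 : Derive G (b (e * i + k)%Z) = 0).
    { destruct He as [-> | ->], Hde as [-> | ->]; lra. }
    apply Hmor in Z1. destruct He as [-> | ->], Hde as [-> | ->]; lra.
  - intros i. rewrite DG, Bk.
    assert (Z1 : IZR de * IZR e * Derive G (b (e * i + k)%Z) = 0 <-> Derive G (b (e * i + k)%Z) = 0).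
    { split; [|intros ->; ring]. destruct He as [-> | ->], Hde as [-> | ->]; lra. }
    rewrite Z1, Htu. destruct He as [-> | ->].
    + replace (1 * (i + 1) + k)%Z with (1 * i + k + 1)%Z by ring.
      replace (1 * (i - 1) + k)%Z with (1 * i + k - 1)%Z by ring. destruct Hde; subst; lia.
    + replace (-1 * (i + 1) + k)%Z with (-1 * i + k - 1)%Z by ring.
      replace (-1 * (i - 1) + k)%Z with (-1 * i + k + 1)%Z by ring. destruct Hde; subst; lia.
Qed.

(** Each step is the previous one or its opposite according to the symbol, so
    agreement of one step propagates in both directions. *)
Lemma itinerary_determined F G d d' N M a b v u w w' :
  itinerary F d N M a v w -> itinerary G d' N M b u w' ->
  (forall i, Derive F (a i) = 0 <-> Derive G (b i) = 0) -> w 0%Z = w' 0%Z -> w 1%Z = w' 1%Z -> w = w'.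
Proof.
  intros IF IG Hc E0 E1.
  assert (St : forall i, (w i - w (i - 1) = w' i - w' (i - 1) <-> w (i + 1) - w i = w' (i + 1) - w' i)%Z).
  { intros i. pose proof (it_step IF i). pose proof (it_step IG i).
    pose proof (it_step IF (i - 1)%Z) as S1. pose proof (it_step IG (i - 1)%Z) as S2.
    replace (i - 1 + 1)%Z with i in S1, S2 by ring.
    pose proof (it_turn IF i) as T1. pose proof (it_turn IG i) as T2.
    rewrite (Hc i), T2 in T1. lia. }
  assert (Al : forall i, (w (i + 1) - w i = w' (i + 1) - w' i)%Z).
  { intros i. apply (Z.bi_induction (fun i => (w (i + 1) - w i = w' (i + 1) - w' i)%Z)).
    - intros x y ->; tauto.
    - simpl. lia.
    - intros j. rewrite <- (St (Z.succ j)). rewrite <- Z.add_1_r. now replace (j + 1 - 1)%Z with j by ring. }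
  apply functional_extensionality. intros i. apply (Z.bi_induction (fun i => w i = w' i)); auto.
  - intros x y ->; tauto.
  - intros j. specialize (Al j). rewrite <- Z.add_1_r. lia.
Qed.

(** The word leaves the starting point and the first direction of the walk
    undetermined. A shift [m] and a sign [de] in the target adjust them. *)
Lemma equivalence_of_itineraries F G d d' N M a b v u w w' (e k : Z) :
  itinerary F d N M a v w -> itinerary G d' N M b u w' -> (e = 1 \/ e = -1)%Z ->
  (forall i, Derive F (a i) = 0 <-> Derive G (b (e * i + k)%Z) = 0) ->
  exists H K de, ldiff e H /\ ldiff de K /\ forall t, K (F t) = G (H t).
Proof.
  intros IF IG He Hc.
  assert (Hde : exists de, (de = 1 \/ de = -1)%Z /\ (w 1 - w 0 = de * (w' (e * 1 + k) - w' (e * 0 + k)))%Z).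
  { pose proof (it_step IF 0%Z) as S1. simpl in S1.
    assert (S2 : (w' (e * 1 + k) - w' (e * 0 + k) = 1 \/ w' (e * 1 + k) - w' (e * 0 + k) = -1)%Z).
    { destruct He as [-> | ->].
      - pose proof (it_step IG k) as S2. now replace (1 * 1 + k)%Z with (k + 1)%Z by ring.
      - pose proof (it_step IG (k - 1)%Z) as S2. replace (k - 1 + 1)%Z with k in S2 by ring.
        replace (-1 * 1 + k)%Z with (k - 1)%Z by ring. replace (-1 * 0 + k)%Z with k by ring. lia. }
    destruct S1 as [-> | ->], S2 as [-> | ->]; [exists 1%Z|exists (-1)%Z|exists (-1)%Z|exists 1%Z]; auto. }
  destruct Hde as [de [Hde Ew]].
  pose (m := (w' (e * 0 + k) - de * w 0)%Z).
  assert (IG' := itinerary_reflect G d' N M b u w' e de k m IG He Hde).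
  assert (DG := Derive_reflect G (IZR de) (IZR e) (it_smooth IG)).
  rewrite <- (itinerary_determined _ _ _ _ _ _ _ _ _ _ _ _ IF IG') in IG'.
  - destruct (same_itinerary _ _ _ _ _ _ _ _ _ _ _ IF IG') as [H [K [HH [HK E]]]].
    assert (Sg : forall x L, (x = 1 \/ x = -1)%Z -> ldiff 1 L -> ldiff x (fun t => IZR x * L t)).
    { intros x L Hx [_ [SL [EL PL]]]. split; auto. split; [|split].
      - apply smooth1_mult; auto. apply smooth1_const.
      - intros t. rewrite EL. ring.
      - intros t. rewrite Derive_scal. specialize (PL t). destruct Hx as [-> | ->]; lra. }
    exists (fun t => IZR e * H t), (fun y => IZR de * K y), de. split; auto. split; auto.
    intros t. rewrite E. destruct Hde as [-> | ->]; ring.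
  - intros i. rewrite Hc, DG. replace (IZR e * (IZR e * b (e * i + k)%Z)) with (b (e * i + k)%Z)
      by (destruct He; subst; ring).
    split; [intros ->; ring|]. destruct He as [-> | ->], Hde as [-> | ->]; lra.
  - unfold m. destruct Hde; subst; ring.
  - unfold m. destruct Hde; subst; lia.
Qed.

Lemma critical_data f F d : stable f -> lifts f F -> smooth1 F -> equivariant F d -> (exists x, Sigma f x) ->
  exists a N v M w, enumerates a N (critical_fibre F) /\ itinerary F d N M a v w /\ card (Sigma f) = Z.to_nat M.
Proof.
  intros Hst LF SF EF [x Hx].
  assert (MF := stable_morse f F d Hst LF SF EF). assert (IF := stable_injective f F d Hst LF SF EF).
  rewrite <- (P_angle x) in Hx. apply (Sigma_lift f F d) in Hx; auto.
  destruct (enumeration_exists (critical_fibre F)) as [a [N Ha]].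
  { intros t. now apply critical_fibre_period with d. }
  { now apply isolated_critical_fibre with d. }
  { exists (angle x), (angle x). auto. }
  destruct (enumeration_exists (critical_value F)) as [v [M Hv]].
  { apply critical_value_period. }
  { now apply isolated_critical_value with d. }
  { exists (F (angle x)), (angle x). auto. }
  destruct (itinerary_exists F d SF EF MF a N v M Ha Hv) as [w I].
  exists a, N, v, M, w. split; auto. split; auto. now apply (card_critical_values f F d v M).
Qed.

Lemma conjugate_critical_fibre F G H K e e' : smooth1 F -> smooth1 G -> ldiff e H -> ldiff e' K ->
  (forall t, K (F t) = G (H t)) -> forall t, critical_fibre F t <-> critical_fibre G (H t).
Proof.
  intros SF SG HH HK E t. pose proof HK as [He' [_ [EK _]]].
  destruct (ldiff_inverse e' K HK) as [K' [_ [_ KK]]].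
  assert (Q : forall y z, P y = P z <-> P (K y) = P (K z)).
  { intros y z. rewrite !P_eq_iff. split; intros [k Hk].
    - exists (e' * k)%Z. rewrite Hk. now apply equivariant_Z.
    - exists (e' * k)%Z. rewrite <- (KK z), <- (KK (y + _)). f_equal. rewrite Hk, (equivariant_Z K e') by auto.
      do 3 f_equal. destruct He'; subst; ring. }
  split; intros [c [Hc Ec]].
  - exists (H c). split. now apply (conjugate_critical F G H K e e').
    rewrite <- !E. now apply (proj1 (Q _ _)).
  - destruct (ldiff_inverse e H HH) as [H' [_ [HH' _]]]. exists (H' c). split.
    apply (conjugate_critical F G H K e e'); auto. now rewrite HH'.
    apply (proj2 (Q _ _)). now rewrite !E, HH'.
Qed.

Lemma enumerates_image a N S S' e H : enumerates a N S -> ldiff e H -> (forall t, S t <-> S' (H t)) ->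
  enumerates (fun i => H (a (e * i)%Z)) N S'.
Proof.
  intros [Ha Sa] HH HS. pose proof HH as [He [SH [EH PH]]]. pose proof Ha as [HN _].
  destruct (ldiff_inverse e H HH) as [H' [_ [HH' H'H]]].
  destruct (monotone_equivariant_bijective e H e SH EH He PH) as [_ [Mo _]].
  split; [split; [|split]|]; auto.
  - intros i. destruct He as [-> | ->].
    + assert (L := Mo (a (1 * i)%Z) (a (1 * (i + 1))%Z)). rewrite !Rmult_1_l in L. apply L.
      apply (advancing_lt Ha). lia.
    + assert (L := Mo (a (-1 * (i + 1))%Z) (a (-1 * i)%Z)).
      assert (-1 * H (a (-1 * (i + 1))%Z) < -1 * H (a (-1 * i)%Z)); [|lra]. apply L.
      apply (advancing_lt Ha). lia.
  - intros i. replace (e * (i + N))%Z with (e * i + N * e)%Z by ring.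
    rewrite (advancing_shift Ha), (equivariant_Z H e) by auto. destruct He as [-> | ->]; simpl; ring.
  - intros t. rewrite <- (HH' t) at 1. rewrite <- HS, Sa. split.
    + intros [i Hi]. exists (e * i)%Z. replace (e * (e * i))%Z with i by (destruct He; subst; ring). now rewrite Hi.
    + intros [i <-]. exists (e * i)%Z. now rewrite H'H.
Qed.

Lemma A_equiv_Sigma f g : smooth f -> smooth g -> A_equiv f g -> ((exists x, Sigma f x) <-> exists x, Sigma g x).
Proof.
  intros Sf Sg HA.
  destruct (lift_exists f Sf) as [F [d [SF [LF EF]]]]. destruct (lift_exists g Sg) as [G [d' [SG [LG EG]]]].
  destruct (A_equiv_lift f g F G d d' HA LF SF EF LG SG EG)
    as [h [k [e [e' [H [K [[_ [h' [_ [_ hh']]]] [Dk [E [LH [HH [HK EL]]]]]]]]]]]].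
  assert (C : forall x, Sigma f x <-> Sigma g (h x)).
  { intros x. rewrite <- (P_angle x), LH, (Sigma_lift f F d), (Sigma_lift g G d') by auto.
    now apply (conjugate_critical F G H K e e'). }
  split; intros [x Hx].
  - exists (h x). now apply C.
  - exists (h' x). apply C. now rewrite hh'.
Qed.

Lemma nonsingular_sign f F d : smooth1 F -> lifts f F -> equivariant F d -> ~ (exists x, Sigma f x) ->
  exists s : Z, (s = 1 \/ s = -1)%Z /\ forall t, 0 < IZR s * Derive F t.
Proof.
  intros SF LF EF Hne. apply regular_sign with d; auto. intros t Z0. apply Hne. exists (P t).
  now apply (Sigma_lift f F d).
Qed.

(** Equality of the words also gives [M = M'], by counting the critical points
    along a window of [N] indices on both sides. *)
Lemma singular_classification f g : stable f -> stable g -> (exists x, Sigma f x) -> (exists x, Sigma g x) ->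
  (A_equiv f g <-> N_of f = N_of g /\ E_equiv (Ast f) (Ast g)).
Proof.
  intros Hf Hg Nf Ng.
  destruct (lift_exists f (proj1 Hf)) as [F [d [SF [LF EF]]]].
  destruct (lift_exists g (proj1 Hg)) as [G [d' [SG [LG EG]]]].
  destruct (critical_data f F d Hf LF SF EF Nf) as [a [N [v [M [w [Ha [IF CF]]]]]]].
  destruct (critical_data g G d' Hg LG SG EG Ng) as [b [N' [u [M' [w' [Hb [IG CG]]]]]]].
  rewrite (N_of_enumerated f F d N a), (N_of_enumerated g G d' N' b) by auto.
  rewrite (E_equiv_Ast f g F G d d' N N' a b) by auto. split.
  - intros HA. destruct (A_equiv_lift f g F G d d' HA LF SF EF LG SG EG)
      as [h [k [e [e' [H [K [_ [_ [_ [_ [HH [HK E]]]]]]]]]]]].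
    assert (Hb' := enumerates_image a N _ (critical_fibre G) e H Ha HH
       (conjugate_critical_fibre F G H K e e' SF SG HH HK E)).
    destruct (enumeration_unique b N' _ N _ Hb Hb') as [EN [c Hc]]. split; [now rewrite EN|]. split; auto.
    exists c, e. pose proof HH as [He _]. split; auto. intros i.
    rewrite <- (Hc (e * i)%Z). replace (e * (e * i))%Z with i by (destruct He; subst; ring).
    now apply (conjugate_critical F G H K e e').
  - intros [_ [EN [k [e [He Hc]]]]]. subst N'.
    assert (EM : M = M').
    { pose proof (it_target IF) as [M1 _]. pose proof (it_target IG) as [M2 _].
      apply Z2Nat.inj; try lia. rewrite <- CF, <- CG.
      rewrite (card_along_window a N (critical_fibre F) (Sigma f) 1 0); auto.
      - rewrite (card_along_window b N (critical_fibre G) (Sigma g) e k); auto.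
        + f_equal. apply filter_ext. intros j.
          replace (1 * Z.of_nat j + 0)%Z with (Z.of_nat j) by ring. specialize (Hc (Z.of_nat j)).
          rewrite <- (Sigma_lift f F d), <- (Sigma_lift g G d') in Hc by auto.
          destruct excluded_middle_informative, excluded_middle_informative; tauto.
        + intros t Ht. exists t. split; auto. now apply (Sigma_lift g G d').
      - intros t Ht. exists t. split; auto. now apply (Sigma_lift f F d). }
    subst M'.
    destruct (equivalence_of_itineraries F G d d' N M a b v u w w' e k IF IG He Hc) as [H [K [de [HH [HK E]]]]].
    now apply A_equiv_of_lift with F G e de H K.
Qed.

Lemma nonsingular_classification f g : smooth f -> smooth g -> ~ (exists x, Sigma f x) -> ~ (exists x, Sigma g x) ->
  (A_equiv f g <-> N_of f = N_of g).
Proof.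
  intros Sf Sg Nf Ng.
  destruct (lift_exists f Sf) as [F [d [SF [LF EF]]]]. destruct (lift_exists g Sg) as [G [d' [SG [LG EG]]]].
  destruct (nonsingular_sign f F d SF LF EF Nf) as [sf [Hsf Pf]].
  destruct (nonsingular_sign g G d' SG LG EG Ng) as [sg [Hsg Pg]].
  destruct (monotone_equivariant_bijective sf F d SF EF Hsf Pf) as [Posf _].
  destruct (monotone_equivariant_bijective sg G d' SG EG Hsg Pg) as [Posg _].
  unfold N_of. destruct excluded_middle_informative; [tauto|]. destruct excluded_middle_informative; [tauto|].
  rewrite (card_fiber f F d sf), (card_fiber g G d' sg) by auto. split.
  - intros HA. destruct (A_equiv_lift f g F G d d' HA LF SF EF LG SG EG)
      as [h [k [e [e' [H [K [_ [_ [_ [_ [HH [HK E]]]]]]]]]]]].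
    pose proof (conjugate_degree F G H K d d' e e' EF EG HH HK E) as D.
    destruct HH as [He _], HK as [He' _]. f_equal. destruct Hsf, Hsg, He, He'; subst; lia.
  - intros EN. assert (Ed : (sf * d = sg * d')%Z) by lia.
    destruct (regular_equivalence F G d d' sf sg SF SG EF EG Hsf Hsg Pf Pg Ed) as [H [K [e [HH [HK E]]]]].
    now apply A_equiv_of_lift with F G 1%Z e H K.
Qed.

Lemma singular_of_Ast f : stable f -> ((exists x, Sigma f x) <-> In s (Ast f)).
Proof.
  intros Hf. split.
  - intros Nf. destruct (lift_exists f (proj1 Hf)) as [F [d [SF [LF EF]]]].
    destruct (critical_data f F d Hf LF SF EF Nf) as [a [N [v [M [w [Ha _]]]]]].
    now apply (Ast_singular f F d N a).
  - unfold Ast. destruct excluded_middle_informative; auto. intros I. apply repeat_spec in I. discriminate.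
Qed.

Lemma E_equiv_In {X : Type} (x : X) t t' : E_equiv t t' -> In x t -> In x t'.
Proof.
  rewrite E_equiv_Z. intros [_ [a [e [_ H]]]] I. apply In_nth_error in I. destruct I as [n Hn].
  assert (n < length t)%nat by (apply nth_error_Some; congruence).
  specialize (H (Z.of_nat n + 1)%Z). unfold entry at 1 in H.
  replace (Z.of_nat n + 1 - 1)%Z with (Z.of_nat n) in H by ring.
  rewrite Z.mod_small, Nat2Z.id, Hn in H by lia. symmetry in H. now apply nth_error_In in H.
Qed.

Theorem theorem2p5 (f g : S1 -> S1) (hf : stable f) (hg : stable g) :
  A_equiv f g <-> N_of f = N_of g /\ E_class (Ast f) = E_class (Ast g).
Proof.
  rewrite E_class_eq.
  assert (Sw : A_equiv f g \/ E_equiv (Ast f) (Ast g) -> ((exists x, Sigma f x) <-> exists x, Sigma g x)).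
  { intros [HA|HE]. apply A_equiv_Sigma; auto. apply hf. apply hg.
    rewrite !singular_of_Ast by auto. split; apply E_equiv_In; auto. now apply E_equiv_sym. }
  destruct (classic (exists x, Sigma f x)) as [Nf|Nf], (classic (exists x, Sigma g x)) as [Ng|Ng]; try tauto.
  - now apply singular_classification.
  - rewrite (nonsingular_classification f g) by (auto; apply hf || apply hg). split; [|tauto].
    intros E. split; auto. revert E. unfold N_of, Ast.
    destruct excluded_middle_informative; [tauto|]. destruct excluded_middle_informative; [tauto|].
    intros ->. apply E_equiv_refl.
Qed.
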